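(* Let $R$ be a left noetherian ring and let $e$ be an idempotent in $R$. Suppose that the right $eRe$-module $Re$ has finite projective dimension. Then $i_\lambda=Re\otimes_{eRe}-$ induces a fully faithful triangle functor \[ \mathbf{D}_{\mathrm{sg}}(i_\lambda)\colon \mathbf{D}_{\mathrm{sg}}(eRe) \to \mathbf{D}_{\mathrm{sg}}(R).\] Moreover, $\mathbf{D}_{\mathrm{sg}}(i_\lambda)$ is a triangle equivalence if and only if for every finitely generated left $R$-module $M$ there is an integer $\ell$ and a projective resolution $P$ of $M$ (by finitely generated projective left $R$-modules) such that $P^{-i}\in \operatorname{add} Re$ for every $i\geq \ell$.
   Context: For a left noetherian ring $R$, $\operatorname{mod} R$ is the category of finitely generated left $R$-modules and $\operatorname{proj} R$ its full subcategory of projective modules. $\mathbf{K}^{-,\mathrm{b}}(\operatorname{proj} R)$ is the homotopy category of bounded above (cochain) complexes in $\operatorname{proj} R$ with bounded cohomology. A complex is perfect if it is quasi-isomorphic to a bounded complex in $\operatorname{proj} R$; $\mathbf{K}^{\mathrm{b}}(\operatorname{proj} R)$ denotes the full subcategory of perfect complexes in $\mathbf{K}^{-,\mathrm{b}}(\operatorname{proj} R)$. The singularity category of $R$ is the Verdier quotient $\mathbf{D}_{\mathrm{sg}}(R)=\mathbf{K}^{-,\mathrm{b}}(\operatorname{proj} R)/\mathbf{K}^{\mathrm{b}}(\operatorname{proj} R)$. For an idempotent $e\in R$, $i_\lambda\colon \operatorname{mod} eRe\to\operatorname{mod} R$ is the functor $N\mapsto Re\otimes_{eRe}N$, and $\operatorname{add}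 Re$ is the full subcategory of $\operatorname{mod} R$ of direct summands of finite direct sums of copies of $Re$. The functor $i_\lambda$ sends projectives to projectives; that it induces $\mathbf{D}_{\mathrm{sg}}(i_\lambda)$ means that, applied termwise to complexes, it sends $\mathbf{K}^{-,\mathrm{b}}(\operatorname{proj} eRe)$ into $\mathbf{K}^{-,\mathrm{b}}(\operatorname{proj} R)$ and perfect complexes to perfect complexes, and $\mathbf{D}_{\mathrm{sg}}(i_\lambda)$ is the resulting functor on Verdier quotients. Projective resolutions are written as cochain complexes with $P^{-i}$ ($i\ge 0$) the $i$-th term. *)

(* Defs.v *)
From HB Require Import structures.
From mathcomp Require Import all_boot all_order all_algebra.
From mathcomp Require Import generic_quotient zify boolp.
From Stdlib Require Import Relation_Operators.

Set Implicit Arguments.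
Unset Strict Implicit.
Unset Printing Implicit Defensive.

Import GRing.Theory.
Local Open Scope ring_scope.
Local Open Scope quotient_scope.

Definition mklinear (S : pzRingType) (A B : lmodType S) (f : A -> B)
    (hf : linear f) : {linear A -> B} :=
  HB.pack f (GRing.isLinear.Build S A B *:%R f hf).

Definition left_ideal (R : pzRingType) (I : R -> Prop) : Prop :=
  [/\ I 0, forall x y, I x -> I y -> I (x + y) & forall a x, I x -> I (a * x)].

Definition left_noetherian (R : pzRingType) : Prop :=
  forall I : R -> Prop, left_ideal I ->
  exists (n : nat) (g : 'I_n -> R),
    forall x, I x <-> exists c : 'I_n -> R, x = \sum_(i < n) c i * g i.

Definition fin_gen (S : pzRingType) (M : lmodType S) : Prop :=
  exists (n : nat) (g : 'I_n -> M),
    forall x, exists c : 'I_n -> S, x = \sum_(i < n) c i *: g i.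

Definition surj (A B : Type) (f : A -> B) : Prop := forall y, exists x, f x = y.

Definition projective (S : pzRingType) (P : lmodType S) : Prop :=
  forall (A B : lmodType S) (g : {linear A -> B}) (f : {linear P -> B}),
    surj g -> exists h : {linear P -> A}, forall x, g (h x) = f x.

Definition is_zero (S : pzRingType) (M : lmodType S) : Prop :=
  forall x : M, x = 0.

Definition fg_projective (S : pzRingType) (P : lmodType S) : Prop :=
  fin_gen P /\ projective P.

(* The term [pr_ob i] is the one written P^{-i} in cochain notation. *)
Record proj_resolution (S : pzRingType) (M : lmodType S) := ProjResolution {
  pr_ob : nat -> lmodType S;
  pr_d : forall i, {linear pr_ob i.+1 -> pr_ob i};
  pr_aug : {linear pr_ob 0 -> M};
  pr_projective : forall i, projective (pr_ob i);
  pr_aug_surj : surj pr_aug;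
  pr_exact0 : forall x, pr_aug x = 0 <-> exists y, pr_d 0 y = x;
  pr_exact : forall i x, pr_d i x = 0 <-> exists y, pr_d i.+1 y = x }.

Definition finite_proj_dim (S : pzRingType) (M : lmodType S) : Prop :=
  exists (P : proj_resolution M) (n : nat),
    forall i, (n < i)%N -> is_zero (pr_ob P i).

Definition in_add (S : pzRingType) (Q M : lmodType S) : Prop :=
  exists (n : nat) (N : lmodType S)
    (f : {linear (M * N)%type -> {ffun 'I_n -> Q}}), bijective f.

(* A right S-module is a left module over the converse ring [S^c]; the element
   written x.a on paper is [(a : S^c) *: x]. Elements of the tensor product are
   classes of finite formal sums, i.e. of lists of pure tensors. *)
Section Tensor.
Variables (S : pzRingType) (M : lmodType S^c) (N : lmodType S).

Inductive tens_eq : seq (M * N) -> seq (M * N) -> Prop :=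
| te_refl u : tens_eq u u
| te_sym u v : tens_eq u v -> tens_eq v u
| te_trans u v w : tens_eq u v -> tens_eq v w -> tens_eq u w
| te_cat u u' v v' : tens_eq u u' -> tens_eq v v' -> tens_eq (u ++ v) (u' ++ v')
| te_comm u v : tens_eq (u ++ v) (v ++ u)
| te_zero n : tens_eq [:: (0, n)] [::]
| te_addl x x' n : tens_eq [:: (x + x', n)] [:: (x, n); (x', n)]
| te_addr x n n' : tens_eq [:: (x, n + n')] [:: (x, n); (x, n')]
| te_bal x (a : S) n : tens_eq [:: ((a : S^c) *: x, n)] [:: (x, a *: n)].

Definition tens_rel : rel (seq (M * N)) := fun u v => `[< tens_eq u v >].

Lemma tens_rel_refl : reflexive tens_rel.
Proof. by move=> u; apply/asboolP; exact: te_refl. Qed.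
Lemma tens_rel_sym : symmetric tens_rel.
Proof. by move=> u v; apply/asboolP/asboolP => /te_sym. Qed.
Lemma tens_rel_trans : transitive tens_rel.
Proof.
by move=> v u w /asboolP uv /asboolP vw; apply/asboolP; exact: te_trans vw.
Qed.

Canonical tens_equiv := EquivRel tens_rel tens_rel_refl tens_rel_sym tens_rel_trans.

Definition tens := {eq_quot tens_rel}.
HB.instance Definition _ := Choice.on tens.
HB.instance Definition _ := EqQuotient.on tens.

Definition tcls (u : seq (M * N)) : tens := \pi_tens u.
Definition pure (x : M) (n : N) : tens := tcls [:: (x, n)].

Lemma tclsP u v : tcls u = tcls v <-> tens_eq u v.
Proof.
split; first by move/eqmodP/asboolP.
by move=> h; apply/eqmodP/asboolP.
Qed.

Lemma tclsW (P : tens -> Prop) : (forall u, P (tcls u)) -> forall t, P t.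
Proof. by move=> h; elim/quotW => u; exact: h. Qed.

Definition tens_lift (T : Type) (f : seq (M * N) -> T) (t : tens) : T := f (repr t).

Lemma tens_liftE (T : Type) (f : seq (M * N) -> T) :
  (forall u v, tens_eq u v -> f u = f v) -> forall u, tens_lift f (tcls u) = f u.
Proof. by move=> hf u; apply: hf; apply/tclsP; rewrite /tcls reprK. Qed.

Definition tneg_seq (u : seq (M * N)) := [seq (- p.1, p.2) | p <- u].

Lemma tens_eq_neg u v : tens_eq u v -> tens_eq (tneg_seq u) (tneg_seq v).
Proof.
elim=> {u v} [u|u v _|u v w _ h1 _|u u' v v' _ h1 _ h2|u v|n|x x' n|x n n'|x a n] /=.
- exact: te_refl.
- exact: te_sym.
- exact: te_trans.
- by rewrite /tneg_seq !map_cat; exact: te_cat.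
- by rewrite /tneg_seq !map_cat; exact: te_comm.
- by rewrite oppr0; exact: te_zero.
- by rewrite opprD; exact: te_addl.
- exact: te_addr.
- by rewrite -scalerN; exact: te_bal.
Qed.

Definition tadd (s t : tens) : tens := tcls (repr s ++ repr t).
Definition topp : tens -> tens := tens_lift (fun u => tcls (tneg_seq u)).

Lemma taddE u v : tadd (tcls u) (tcls v) = tcls (u ++ v).
Proof. by apply/tclsP; apply: te_cat; apply/tclsP; rewrite /tcls reprK. Qed.

Lemma toppE u : topp (tcls u) = tcls (tneg_seq u).
Proof. by rewrite /topp tens_liftE // => {}u v h; apply/tclsP; exact: tens_eq_neg. Qed.

Fact taddA : associative tadd.
Proof.
elim/tclsW=> u; elim/tclsW=> v; elim/tclsW=> w.
by rewrite !taddE catA.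
Qed.
Fact taddC : commutative tadd.
Proof.
elim/tclsW=> u; elim/tclsW=> v.
by rewrite !taddE; apply/tclsP; exact: te_comm.
Qed.
Fact tadd0 : left_id (tcls [::]) tadd.
Proof. by elim/tclsW=> u; rewrite taddE. Qed.
Fact taddN : left_inverse (tcls [::]) topp tadd.
Proof.
elim/tclsW; elim=> [|[x n] u ih]; first by rewrite toppE taddE.
have -> : tcls ((x, n) :: u) = tadd (tcls [:: (x, n)]) (tcls u) by rewrite taddE.
have -> : topp (tadd (tcls [:: (x, n)]) (tcls u)) =
  tadd (tcls [:: (- x, n)]) (topp (tcls u)) by rewrite taddE !toppE taddE.
rewrite (taddC (tcls [:: (x, n)])) taddA -[tadd (tadd _ _) (tcls u)]taddA ih.
rewrite [tadd _ (tcls [::])]taddC tadd0 taddE; apply/tclsP => /=.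
apply: te_trans (te_sym (te_addl _ _ _)) _.
by rewrite addNr; exact: te_zero.
Qed.

HB.instance Definition _ := GRing.isZmodule.Build tens taddA taddC tadd0 taddN.

Lemma tclsD u v : tcls (u ++ v) = tcls u + tcls v.
Proof. by rewrite -taddE. Qed.

Lemma tcls0 : tcls [::] = 0. Proof. by []. Qed.

Lemma pureDl x x' n : pure (x + x') n = pure x n + pure x' n.
Proof. by rewrite /pure -tclsD; apply/tclsP; exact: te_addl. Qed.

Lemma pureDr x n n' : pure x (n + n') = pure x n + pure x n'.
Proof. by rewrite /pure -tclsD; apply/tclsP; exact: te_addr. Qed.

Lemma pure_bal x (a : S) n : pure ((a : S^c) *: x) n = pure x (a *: n).
Proof. by apply/tclsP; exact: te_bal. Qed.

Lemma pureW (P : tens -> Prop) :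
  P 0 -> (forall x n t, P t -> P (pure x n + t)) -> forall t, P t.
Proof.
move=> P0 PS; elim/tclsW; elim=> [|[x n] u ih]; first by rewrite tcls0.
by rewrite -cat1s tclsD; exact: PS.
Qed.

Lemma tens_universal (A : zmodType) (b : M -> N -> A) :
  (forall x x' n, b (x + x') n = b x n + b x' n) ->
  (forall x n n', b x (n + n') = b x n + b x n') ->
  (forall x (a : S) n, b ((a : S^c) *: x) n = b x (a *: n)) ->
  exists f : tens -> A,
    {morph f : s t / s + t} /\ forall x n, f (pure x n) = b x n.
Proof.
move=> bDl bDr bbal; pose F (u : seq (M * N)) := \sum_(p <- u) b p.1 p.2.
have FE u v : tens_eq u v -> F u = F v.
  rewrite /F; elim=> {u v} // [u v w _ h1 _ h2|u u' v v' _ h1 _ h2|u v|n|x x' n|x n n'|x a n].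
  - by rewrite h1.
  - by rewrite !big_cat h1 h2.
  - by rewrite !big_cat /= addrC.
  - rewrite big_seq1 big_nil /=; apply: (addrI (b 0 n)).
    by rewrite -bDl !addr0.
  - by rewrite !big_cons big_nil addr0 /= bDl addr0.
  - by rewrite !big_cons big_nil addr0 /= bDr addr0.
  - by rewrite !big_seq1 /= bbal.
exists (tens_lift F); split=> [|x n]; last by rewrite tens_liftE // /F big_seq1.
elim/tclsW=> u; elim/tclsW=> v.
by rewrite -tclsD !tens_liftE // /F big_cat.
Qed.

End Tensor.

Section TensorMap.
Variables (S : pzRingType) (M M' : lmodType S^c) (N N' : lmodType S).
Variables (f : {linear M -> M'}) (g : {linear N -> N'}).

Definition tens_map_seq (u : seq (M * N)) : seq (M' * N') :=
  [seq (f p.1, g p.2) | p <- u].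

Definition tens_map : tens M N -> tens M' N' :=
  tens_lift (fun u => tcls (tens_map_seq u)).

Lemma tens_mapE u : tens_map (tcls u) = tcls (tens_map_seq u).
Proof.
rewrite /tens_map tens_liftE // => {}u v huv; apply/tclsP.
elim: huv => {u v} [u|u v _|u v w _ h1 _|u u' v v' _ h1 _ h2|u v|n|x x' n|x n n'|x a n] /=.
- exact: te_refl.
- exact: te_sym.
- exact: te_trans.
- by rewrite /tens_map_seq !map_cat; exact: te_cat.
- by rewrite /tens_map_seq !map_cat; exact: te_comm.
- by rewrite linear0; exact: te_zero.
- by rewrite linearD; exact: te_addl.
- by rewrite linearD; exact: te_addr.
- by rewrite !linearZ; exact: te_bal.
Qed.

Lemma tens_map_pure x n : tens_map (pure x n) = pure (f x) (g n).
Proof. exact: tens_mapE. Qed.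

Lemma tens_mapD : {morph tens_map : s t / s + t}.
Proof.
elim/tclsW=> u; elim/tclsW=> v.
by rewrite -tclsD !tens_mapE /tens_map_seq map_cat tclsD.
Qed.

Lemma tens_map0 : tens_map 0 = 0.
Proof. exact: (tens_mapE [::]). Qed.

End TensorMap.

Section Corner.
Variables (R : pzRingType) (e : R).

Definition corner_pred : {pred R} := [pred x | e * x * e == x].
Fact corner_zmod_closed : zmod_closed corner_pred.
Proof.
split=> [|x y]; rewrite !inE ?mulr0 ?mul0r // => /eqP hx /eqP hy.
by rewrite mulrBr mulrBl hx hy.
Qed.
HB.instance Definition _ :=
  GRing.isZmodClosed.Build R corner_pred corner_zmod_closed.

Definition Re_pred : {pred R} := [pred x | x * e == x].
Fact Re_zmod_closed : zmod_closed Re_pred.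
Proof.
split=> [|x y]; rewrite !inE ?mul0r // => /eqP hx /eqP hy.
by rewrite mulrBl hx hy.
Qed.
HB.instance Definition _ := GRing.isZmodClosed.Build R Re_pred Re_zmod_closed.

(* For [e] idempotent, [Re] = {x | x e = x} and [eRe] = {x | e x e = x}; the
   proof [he] is a parameter of the types because the module structures need it. *)
Record Re (he : e * e = e) := MkRe { Re_val : R; ReP : Re_val \in Re_pred }.
Record corner (he : e * e = e) :=
  MkCorner { corner_val : R; cornerP : corner_val \in corner_pred }.

Variable he : e * e = e.

HB.instance Definition _ := [isSub of Re he for @Re_val he].
HB.instance Definition _ := [Choice of Re he by <:].
HB.instance Definition _ := [SubChoice_isSubZmodule of Re he by <:].

HB.instance Definition _ := [isSub of corner he for @corner_val he].
HB.instance Definition _ := [Choice of corner he by <:].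
HB.instance Definition _ := [SubChoice_isSubZmodule of corner he by <:].

Lemma Re_e (x : Re he) : Re_val x * e = Re_val x.
Proof. exact/eqP/(ReP x). Qed.
Lemma corner_ee (a : corner he) : e * corner_val a * e = corner_val a.
Proof. exact/eqP/(cornerP a). Qed.
Lemma corner_e (a : corner he) : corner_val a * e = corner_val a.
Proof. by rewrite -(corner_ee a) -mulrA he. Qed.
Lemma e_corner (a : corner he) : e * corner_val a = corner_val a.
Proof. by rewrite -(corner_ee a) !mulrA he. Qed.

Fact corner_one_subproof : e \in corner_pred.
Proof. by rewrite inE !he. Qed.
Fact corner_mul_subproof (a b : corner he) :
  corner_val a * corner_val b \in corner_pred.
Proof. by rewrite inE mulrA e_corner -mulrA corner_e. Qed.

Definition corner_one : corner he := MkCorner he corner_one_subproof.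
Definition corner_mul (a b : corner he) : corner he :=
  MkCorner he (corner_mul_subproof a b).

Fact corner_mulA : associative corner_mul.
Proof. by move=> a b c; apply: val_inj; rewrite /= mulrA. Qed.
Fact corner_mul1 : left_id corner_one corner_mul.
Proof. by move=> a; apply: val_inj; rewrite /= e_corner. Qed.
Fact corner_mulr1 : right_id corner_one corner_mul.
Proof. by move=> a; apply: val_inj; rewrite /= corner_e. Qed.
Fact corner_mulDl : left_distributive corner_mul +%R.
Proof. by move=> a b c; apply: val_inj; rewrite /= mulrDl. Qed.
Fact corner_mulDr : right_distributive corner_mul +%R.
Proof. by move=> a b c; apply: val_inj; rewrite /= mulrDr. Qed.

HB.instance Definition _ := GRing.Zmodule_isPzRing.Build (corner he)
  corner_mulA corner_mul1 corner_mulr1 corner_mulDl corner_mulDr.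

Fact Re_scale_subproof (r : R) (x : Re he) : r * Re_val x \in Re_pred.
Proof. by rewrite inE -mulrA Re_e. Qed.
Definition Re_scale (r : R) (x : Re he) : Re he :=
  MkRe he (Re_scale_subproof r x).

Fact Re_scaleA a b v : Re_scale a (Re_scale b v) = Re_scale (a * b) v.
Proof. by apply: val_inj; rewrite /= mulrA. Qed.
Fact Re_scale1 : left_id 1 Re_scale.
Proof. by move=> x; apply: val_inj; rewrite /= mul1r. Qed.
Fact Re_scaleDr : right_distributive Re_scale +%R.
Proof. by move=> a x y; apply: val_inj; rewrite /= mulrDr. Qed.
Fact Re_scaleDl v : {morph Re_scale^~ v : a b / a + b}.
Proof. by move=> a b; apply: val_inj; rewrite /= mulrDl. Qed.

HB.instance Definition _ := GRing.Zmodule_isLmodule.Build R (Re he)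
  Re_scaleA Re_scale1 Re_scaleDr Re_scaleDl.

(* An alias of [Re], because one type carries only one module structure. *)
Definition Re_right := Re he.
HB.instance Definition _ := GRing.Zmodule.on Re_right.

Fact Re_rscale_subproof (a : corner he) (x : Re he) :
  Re_val x * corner_val a \in Re_pred.
Proof. by rewrite inE -mulrA corner_e. Qed.
Definition Re_rscale (a : (corner he)^c) (x : Re_right) : Re_right :=
  MkRe he (Re_rscale_subproof a x).

Fact Re_rscaleA a b v : Re_rscale a (Re_rscale b v) = Re_rscale (a * b) v.
Proof. by apply: val_inj; rewrite /= -mulrA. Qed.
Fact Re_rscale1 : left_id 1 Re_rscale.
Proof. by move=> x; apply: val_inj; rewrite /= Re_e. Qed.
Fact Re_rscaleDr : right_distributive Re_rscale +%R.
Proof. by move=> a x y; apply: val_inj; rewrite /= mulrDl. Qed.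
Fact Re_rscaleDl v : {morph Re_rscale^~ v : a b / a + b}.
Proof. by move=> a b; apply: val_inj; rewrite /= mulrDr. Qed.

HB.instance Definition _ := GRing.Zmodule_isLmodule.Build (corner he)^c Re_right
  Re_rscaleA Re_rscale1 Re_rscaleDr Re_rscaleDl.

Fact Re_left_mul_linear (r : R) : linear (Re_scale r : Re_right -> Re_right).
Proof.
move=> a x y; apply: val_inj.
by rewrite /= mulrDr mulrA.
Qed.
Definition Re_left_mul (r : R) : {linear Re_right -> Re_right} :=
  mklinear (Re_left_mul_linear r).

Section Ilambda.
Variable N : lmodType (corner he).

Definition ilambda := tens Re_right N.
HB.instance Definition _ := GRing.Zmodule.on ilambda.

Definition ilambda_scale (r : R) (t : ilambda) : ilambda :=
  tens_map (Re_left_mul r) idfun t.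

Fact ilambda_scaleDr : right_distributive ilambda_scale +%R.
Proof. by move=> r; exact: tens_mapD. Qed.
Fact ilambda_scaleA a b v :
  ilambda_scale a (ilambda_scale b v) = ilambda_scale (a * b) v.
Proof.
elim/pureW: v => [|x n t ih]; first by rewrite /ilambda_scale !tens_map0.
rewrite !ilambda_scaleDr ih; congr (_ + _).
by rewrite /ilambda_scale !tens_map_pure /= Re_scaleA.
Qed.
Fact ilambda_scale1 : left_id 1 ilambda_scale.
Proof.
elim/pureW=> [|x n t ih]; first by rewrite /ilambda_scale !tens_map0.
rewrite ilambda_scaleDr ih; congr (_ + _).
by rewrite /ilambda_scale tens_map_pure /= Re_scale1.
Qed.
Fact ilambda_scaleDl v : {morph ilambda_scale^~ v : a b / a + b}.
Proof.
move=> a b; elim/pureW: v => [|x n t ih].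
  by rewrite /ilambda_scale !tens_map0 addr0.
rewrite !ilambda_scaleDr ih addrACA; congr (_ + _).
by rewrite /ilambda_scale !tens_map_pure /= Re_scaleDl pureDl.
Qed.

HB.instance Definition _ := GRing.Zmodule_isLmodule.Build R ilambda
  ilambda_scaleA ilambda_scale1 ilambda_scaleDr ilambda_scaleDl.

End Ilambda.

Section IlambdaMap.
Variables (N N' : lmodType (corner he)) (g : {linear N -> N'}).

Fact ilambda_map_linear :
  linear (tens_map (idfun : {linear Re_right -> Re_right}) g
          : ilambda N -> ilambda N').
Proof.
move=> r s t; rewrite tens_mapD; congr (_ + _).
elim/pureW: s => [|x n s ih]; first by rewrite scaler0 tens_map0 scaler0.
rewrite scalerDr !tens_mapD scalerDr ih; congr (_ + _).
by rewrite /GRing.scale /= /ilambda_scale !tens_map_pure.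
Qed.
Definition ilambda_map : {linear ilambda N -> ilambda N'} :=
  mklinear ilambda_map_linear.

Lemma ilambda_map_pure x n : ilambda_map (pure x n) = pure x (g n).
Proof. exact: tens_map_pure. Qed.
End IlambdaMap.

End Corner.

(* Cochain complexes are indexed by [int]. Conditions in degree n + 1 quantified
   over all n cover every degree; this indexing avoids casts along n - 1 + 1 = n. *)
Record complex (S : pzRingType) := Complex {
  cx :> int -> lmodType S;
  cd : forall n, {linear cx n -> cx (n + 1)};
  cdd : forall n x, cd (n + 1) (cd n x) = 0 }.

Record chain_map (S : pzRingType) (X Y : complex S) := ChainMap {
  cm :> forall n, {linear X n -> Y n};
  cmd : forall n x, cm (n + 1) (cd X n x) = cd Y n (cm n x) }.

Section Complexes.
Variable S : pzRingType.
Implicit Types X Y Z : complex S.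

Definition cm_id X : chain_map X X :=
  @ChainMap S X X (fun n => idfun) (fun n x => erefl).

Fact cm_comp_subproof X Y Z (g : chain_map Y Z) (f : chain_map X Y) n x :
  (g (n + 1) \o f (n + 1)) (cd X n x) = cd Z n ((g n \o f n) x).
Proof. by rewrite /= !cmd. Qed.
Definition cm_comp X Y Z (g : chain_map Y Z) (f : chain_map X Y) : chain_map X Z :=
  @ChainMap S X Z (fun n => g n \o f n) (cm_comp_subproof g f).

Definition homotopic X Y (f g : chain_map X Y) : Prop :=
  exists h : forall n, {linear X (n + 1) -> Y n}, forall n x,
    f (n + 1) x - g (n + 1) x = cd Y n (h n x) + h (n + 1) (cd X (n + 1) x).

(* H^(n+1)(X) = 0 *)
Definition acyclic_at X (n : int) : Prop :=
  forall x : X (n + 1), cd X (n + 1) x = 0 -> exists y, cd X n y = x.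

Definition bounded_above X : Prop :=
  exists b : int, forall n, b < n -> is_zero (X n).

Definition bounded X : Prop :=
  exists a b : int, forall n, n < a \/ b < n -> is_zero (X n).

Definition bounded_cohomology X : Prop :=
  exists a b : int, forall n, n + 1 < a \/ b < n + 1 -> acyclic_at X n.

(* The induced map H^(n+1)(X) -> H^(n+1)(Y) is injective and surjective. *)
Definition quasi_iso X Y (f : chain_map X Y) : Prop := forall n,
  (forall x : X (n + 1), cd X (n + 1) x = 0 ->
     (exists y, cd Y n y = f (n + 1) x) -> exists x', cd X n x' = x) /\
  (forall y : Y (n + 1), cd Y (n + 1) y = 0 ->
     exists2 x, cd X (n + 1) x = 0 & exists y', y - f (n + 1) x = cd Y n y').

(* Zigzags of quasi-isomorphisms, i.e. isomorphism in the derived category. *)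
Definition quasi_isomorphic : complex S -> complex S -> Prop :=
  clos_refl_sym_trans _ (fun X Y => exists f : chain_map X Y, quasi_iso f).

Definition perfect X : Prop := exists B : complex S,
  [/\ forall n, fg_projective (B n), bounded B & quasi_isomorphic B X].

Definition in_Kmb X : Prop :=
  [/\ forall n, fg_projective (X n), bounded_above X & bounded_cohomology X].

Section Shift.
Variable X : complex S.
Fact shift_subproof n (x : X (n + 1)) :
  (-%R \o cd X (n + 1 + 1)) ((-%R \o cd X (n + 1)) x) = 0.
Proof. by rewrite /= linearN opprK cdd. Qed.
Definition shift : complex S :=
  @Complex S (fun n => X (n + 1)) (fun n => -%R \o cd X (n + 1)) shift_subproof.
End Shift.

Fact shift_map_subproof X Y (f : chain_map X Y) n x :
  f (n + 1 + 1) (cd (shift X) n x) = cd (shift Y) n (f (n + 1) x).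
Proof. by rewrite /= linearN cmd. Qed.
Definition shift_map X Y (f : chain_map X Y) : chain_map (shift X) (shift Y) :=
  @ChainMap S (shift X) (shift Y) (fun n => f (n + 1)) (shift_map_subproof f).

Section Cone.
Variables (X Y : complex S) (f : chain_map X Y).

Definition cone_ob (n : int) : lmodType S := (X (n + 1)%R * Y n)%type.
Definition cone_fun n (p : cone_ob n) : cone_ob (n + 1) :=
  (- cd X (n + 1) p.1, f (n + 1) p.1 + cd Y n p.2).
Fact cone_fun_linear n : linear (@cone_fun n).
Proof.
move=> a p q; congr (_, _) => /=; rewrite !linearP ?opprD ?scalerN //.
by rewrite scalerDr addrACA.
Qed.
Definition cone_d n : {linear cone_ob n -> cone_ob (n + 1)} :=
  mklinear (@cone_fun_linear n).
Fact cone_dd n x : cone_d (n + 1) (cone_d n x) = 0.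
Proof.
congr (_, _) => /=; rewrite !linearN /= ?cdd ?oppr0 //.
by rewrite linearD cdd addr0 cmd addNr.
Qed.
Definition cone : complex S := @Complex S cone_ob cone_d cone_dd.

Fact cone_in_linear n : linear (fun y : Y n => (0, y) : cone n).
Proof. by move=> a x y; congr (_, _); rewrite /= scaler0 addr0. Qed.
Fact cone_in_subproof n x :
  mklinear (@cone_in_linear (n + 1)) (cd Y n x) =
  cd cone n (mklinear (@cone_in_linear n) x).
Proof. by congr (_, _); rewrite /= linear0 ?oppr0 ?add0r. Qed.
Definition cone_in : chain_map Y cone :=
  @ChainMap S Y cone (fun n => mklinear (@cone_in_linear n)) cone_in_subproof.

Fact cone_out_linear n : linear (fun p : cone n => p.1 : shift X n).
Proof. by []. Qed.
Definition cone_out : chain_map cone (shift X) :=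
  @ChainMap S cone (shift X) (fun n => mklinear (@cone_out_linear n))
    (fun n x => erefl).
End Cone.

Lemma is_zero_prod (A B : lmodType S) :
  is_zero A -> is_zero B -> is_zero (A * B)%type.
Proof. by move=> hA hB [x y]; rewrite (hA x) (hB y). Qed.

Lemma fg_projective_prod (A B : lmodType S) :
  fg_projective A -> fg_projective B -> fg_projective (A * B)%type.
Proof.
move=> [[n [g hg]] pA] [[m [k hk]] pB]; split.
  exists (n + m)%N, (fun i => match split i with
                              | inl i => (g i, 0) | inr j => (0, k j) end).
  move=> [x y]; have [c ->] := hg x; have [c' ->] := hk y.
  exists (fun i => match split i with inl i => c i | inr j => c' j end).
  rewrite big_split_ord /= [RHS]surjective_pairing; congr (_, _).
    rewrite raddfD /= !raddf_sum /= [X in _ + X]big1 ?addr0 => [|i _].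
      by apply: eq_bigr => i _; rewrite (unsplitK (inl i)).
    by rewrite (unsplitK (inr i)) /= scaler0.
  rewrite raddfD /= !raddf_sum /= [X in X + _]big1 ?add0r => [|i _].
    by apply: eq_bigr => i _; rewrite (unsplitK (inr i)).
  by rewrite (unsplitK (inl i)) /= scaler0.
move=> C D q f sq.
have lf1 : linear (fun a : A => f (a, 0)).
  move=> a x y; rewrite -linearP; congr (f (_, _)).
  by rewrite /= scaler0 addr0.
have lf2 : linear (fun b : B => f (0, b)).
  move=> a x y; rewrite -linearP; congr (f (_, _)).
  by rewrite /= scaler0 addr0.
have [h1 H1] := pA _ _ q (mklinear lf1) sq.
have [h2 H2] := pB _ _ q (mklinear lf2) sq.
have lh : linear (fun p : A * B => h1 p.1 + h2 p.2).
  by move=> a x y; rewrite /= !linearP scalerDr addrACA.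
exists (mklinear lh) => -[x y] /=.
rewrite linearD H1 H2 /= -linearD; congr (f (_, _)); by rewrite /= ?addr0 ?add0r.
Qed.

Lemma in_Kmb_shift X : in_Kmb X -> in_Kmb (shift X).
Proof.
move=> [pX [b hb] [c [d hcd]]]; split=> [n||].
- exact: pX.
- by exists b => n hn; apply: hb; lia.
- exists (c - 1), d => n hn x /= /eqP; rewrite oppr_eq0 => /eqP hx.
  have [|y hy] := hcd (n + 1) _ x hx; first by lia.
  by exists (- y); rewrite linearN opprK.
Qed.

Lemma in_Kmb_cone X Y (f : chain_map X Y) : in_Kmb X -> in_Kmb Y -> in_Kmb (cone f).
Proof.
move=> [pX [b hb] [c [d hcd]]] [pY [b' hb'] [c' [d' hcd']]]; split=> [n||].
- exact: fg_projective_prod.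
- exists (Num.max b b') => n hn.
  by apply: is_zero_prod; [apply: hb|apply: hb']; lia.
- exists (Num.min (c - 1) c'), (Num.max d d') => n hn [x y] /= [hx hy].
  move/eqP: hx; rewrite oppr_eq0 => /eqP hx.
  have [|x' hx'] := hcd (n + 1) _ x hx; first by lia.
  have [||y' hy'] := hcd' n _ (y + f (n + 1) x'); first by lia.
    by rewrite linearD -cmd hx' -[RHS]hy; exact: addrC.
  exists (- x', y'); congr (_, _) => /=; rewrite !linearN /= ?hx' ?opprK //.
  by rewrite hy' [LHS]addrC; exact: addrK.
Qed.

Lemma bij_quasi_iso X Y (f : chain_map X Y) :
  (forall n, bijective (f n)) -> quasi_iso f.
Proof.
move=> bf n; split=> [x _ [y hy]|y hy].
  have [g fK gK] := bf n; exists (g y); apply: (bij_inj (bf (n + 1))).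
  by rewrite cmd gK.
have [g fK gK] := bf (n + 1); exists (g y).
  by apply: (bij_inj (bf (n + 1 + 1))); rewrite cmd gK hy linear0.
by exists 0; rewrite gK subrr linear0.
Qed.

Lemma perfect_quasi_iso X Y (f : chain_map X Y) :
  quasi_iso f -> perfect X -> perfect Y.
Proof.
move=> qf [B [pB bB qB]]; exists B; split=> //.
by apply: rst_trans qB _; apply: rst_step; exists f.
Qed.

Lemma perfect_shift X : perfect X -> perfect (shift X).
Proof.
move=> [B [pB [a [b hab]] qB]]; exists (shift B); split.
- by move=> n; exact: pB.
- by exists (a - 1), b => n hn; apply: hab; lia.
elim: qB => {pB hab B X} [X Y [f qf]|X|X Y _|X Y Z _ h1 _ h2].
- apply: rst_step; exists (shift_map f) => n; have [qi qs] := qf (n + 1); split.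
  + move=> x /= /eqP; rewrite oppr_eq0 => /eqP hx [y hy].
    have [|x' hx'] := qi x hx; first by exists (- y); rewrite linearN.
    by exists (- x'); rewrite linearN opprK.
  + move=> y /= /eqP; rewrite oppr_eq0 => /eqP hy.
    have [x hx [y' hy']] := qs y hy; exists x; first by rewrite hx oppr0.
    by exists (- y'); rewrite linearN opprK.
- exact: rst_refl.
- exact: rst_sym.
- exact: rst_trans h1 h2.
Qed.

Lemma perfect_cone_shift X Y (f : chain_map X Y) :
  perfect (cone f) -> perfect (cone (shift_map f)).
Proof.
move/perfect_shift.
have l n : linear (fun p : shift (cone f) n => (p.1, - p.2) : cone (shift_map f) n).
  by move=> a p q; congr (_, _); rewrite /= opprD scalerN.
have s n x : mklinear (l (n + 1)) (cd (shift (cone f)) n x) =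
             cd (cone (shift_map f)) n (mklinear (l n) x).
  by congr (_, _) => /=; rewrite (linearN (cd Y (n + 1))) !opprK.
apply: (@perfect_quasi_iso _ _ (ChainMap s)); apply: bij_quasi_iso => n.
by exists (fun p => (p.1, - p.2)) => -[x y] /=; rewrite opprK.
Qed.

End Complexes.

(* Homs carry an equivalence relation [heq]; a morphism in the usual sense is an
   [heq]-class. *)
Record category := Category {
  ob :> Type;
  hom : ob -> ob -> Type;
  heq : forall X Y, hom X Y -> hom X Y -> Prop;
  idm : forall X, hom X X;
  comp : forall X Y Z, hom Y Z -> hom X Y -> hom X Z;
  heq_refl : forall X Y (f : hom X Y), heq f f;
  heq_sym : forall X Y (f g : hom X Y), heq f g -> heq g f;
  heq_trans : forall X Y (f g h : hom X Y), heq f g -> heq g h -> heq f h;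
  comp_heq : forall X Y Z (g g' : hom Y Z) (f f' : hom X Y),
    heq g g' -> heq f f' -> heq (comp g f) (comp g' f');
  comp_idl : forall X Y (f : hom X Y), heq (comp (idm Y) f) f;
  comp_idr : forall X Y (f : hom X Y), heq (comp f (idm X)) f;
  comp_assoc : forall X Y Z W (h : hom Z W) (g : hom Y Z) (f : hom X Y),
    heq (comp h (comp g f)) (comp (comp h g) f) }.

Arguments idm {_} X.
Infix "=~=" := (@heq _ _ _) (at level 70).
Infix "\oc" := (@comp _ _ _ _) (at level 40, left associativity).

Record functor (C D : category) := Functor {
  fob :> C -> D;
  fmor : forall X Y, hom X Y -> hom (fob X) (fob Y);
  fmor_heq : forall X Y (f g : hom X Y), f =~= g -> fmor f =~= fmor g;
  fmor_id : forall X, fmor (idm X) =~= idm (fob X);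
  fmor_comp : forall X Y Z (g : hom Y Z) (f : hom X Y),
    fmor (g \oc f) =~= fmor g \oc fmor f }.

Definition is_iso (C : category) (X Y : C) (f : hom X Y) : Prop :=
  exists g : hom Y X, g \oc f =~= idm X /\ f \oc g =~= idm Y.

Definition id_functor (C : category) : functor C C :=
  @Functor C C id (fun X Y f => f) (fun X Y f g h => h)
    (fun X => heq_refl _) (fun X Y Z g f => heq_refl _).

Section FunctorComp.
Variables (C D E : category) (G : functor D E) (F : functor C D).
Fact fcomp_id X : fmor G (fmor F (idm X)) =~= idm (G (F X)).
Proof. exact: heq_trans (fmor_heq G (fmor_id F X)) (fmor_id G _). Qed.
Fact fcomp_comp X Y Z (g : hom Y Z) (f : hom X Y) :
  fmor G (fmor F (g \oc f)) =~= fmor G (fmor F g) \oc fmor G (fmor F f).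
Proof. exact: heq_trans (fmor_heq G (fmor_comp F g f)) (fmor_comp G _ _). Qed.
Definition functor_comp : functor C E :=
  @Functor C E (fun X => G (F X)) (fun X Y f => fmor G (fmor F f))
    (fun X Y f g h => fmor_heq G (fmor_heq F h)) fcomp_id fcomp_comp.
End FunctorComp.

Definition nat_iso (C D : category) (F G : functor C D)
    (a : forall X, hom (F X) (G X)) : Prop :=
  (forall X, is_iso (a X)) /\
  (forall X Y (f : hom X Y), a Y \oc fmor F f =~= fmor G f \oc a X).

Definition fully_faithful (C D : category) (F : functor C D) : Prop :=
  forall X Y : C,
    (forall f g : hom X Y, fmor F f =~= fmor F g -> f =~= g) /\
    (forall k : hom (F X) (F Y), exists f : hom X Y, fmor F f =~= k).

Definition is_equivalence (C D : category) (F : functor C D) : Prop :=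
  exists G : functor D C,
    (exists a, @nat_iso C C (functor_comp G F) (id_functor C) a) /\
    (exists b, @nat_iso D D (functor_comp F G) (id_functor D) b).

Record triangle (C : category) (Sh : functor C C) := Triangle {
  tX : C; tY : C; tZ : C;
  tf : hom tX tY; tg : hom tY tZ; th : hom tZ (Sh tX) }.

Definition tri_iso (C : category) (Sh : functor C C) (T T' : triangle Sh) : Prop :=
  exists (a : hom (tX T) (tX T')) (b : hom (tY T) (tY T')) (c : hom (tZ T) (tZ T')),
    [/\ is_iso a, is_iso b & is_iso c] /\
    [/\ b \oc tf T =~= tf T' \oc a, c \oc tg T =~= tg T' \oc b
      & fmor Sh a \oc th T =~= th T' \oc c].

(* Only the data of a triangulated category, which is all that triangle functors
   refer to; no axioms are imposed. *)
Record tcategory := TCategory {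
  tcat :> category;
  Sh : functor tcat tcat;
  dist : triangle Sh -> Prop }.

Section TriangleFunctor.
Variables (C D : tcategory) (F : functor C D).
Variable eta : forall X : C, hom (F (Sh C X)) (Sh D (F X)).

Definition map_triangle (T : triangle (Sh C)) : triangle (Sh D) :=
  Triangle (fmor F (tf T)) (fmor F (tg T)) (eta (tX T) \oc fmor F (th T)).

Definition triangle_functor : Prop :=
  @nat_iso C D (functor_comp F (Sh C)) (functor_comp (Sh D) F) eta /\
  (forall T, dist T -> dist (map_triangle T)).

Definition triangle_equivalence : Prop := triangle_functor /\ is_equivalence F.
End TriangleFunctor.

(* C[S^-1]: morphisms are formal composites of morphisms of C
   and of formal inverses of elements of S, modulo the congruence generated by
   the category axioms, the relations of C and s^-1 s = 1, s s^-1 = 1. *)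
Section Localization.
Variables (C : category) (S : forall X Y : C, hom X Y -> Prop).

Inductive lhom : C -> C -> Type :=
| lof X Y (f : hom X Y) : lhom X Y
| linv X Y (s : hom X Y) (hs : S s) : lhom Y X
| lcomp X Y Z (q : lhom Y Z) (p : lhom X Y) : lhom X Z.

Inductive leq : forall X Y, lhom X Y -> lhom X Y -> Prop :=
| leq_refl X Y (p : lhom X Y) : leq p p
| leq_sym X Y (p q : lhom X Y) : leq p q -> leq q p
| leq_trans X Y (p q r : lhom X Y) : leq p q -> leq q r -> leq p r
| leq_cong X Y Z (q q' : lhom Y Z) (p p' : lhom X Y) :
    leq q q' -> leq p p' -> leq (lcomp q p) (lcomp q' p')
| leq_assoc X Y Z W (r : lhom Z W) (q : lhom Y Z) (p : lhom X Y) :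
    leq (lcomp r (lcomp q p)) (lcomp (lcomp r q) p)
| leq_idl X Y (p : lhom X Y) : leq (lcomp (lof (idm Y)) p) p
| leq_idr X Y (p : lhom X Y) : leq (lcomp p (lof (idm X))) p
| leq_of X Y (f g : hom X Y) : f =~= g -> leq (lof f) (lof g)
| leq_comp X Y Z (g : hom Y Z) (f : hom X Y) :
    leq (lof (g \oc f)) (lcomp (lof g) (lof f))
| leq_invl X Y (s : hom X Y) (hs : S s) :
    leq (lcomp (linv hs) (lof s)) (lof (idm X))
| leq_invr X Y (s : hom X Y) (hs : S s) :
    leq (lcomp (lof s) (linv hs)) (lof (idm Y)).

Definition loc : category :=
  @Category C lhom leq (fun X => lof (idm X)) lcomp
    leq_refl leq_sym leq_trans leq_cong leq_idl leq_idr leq_assoc.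

Definition loc_functor : functor C loc :=
  @Functor C loc id lof leq_of (fun X => leq_refl _) leq_comp.
End Localization.

Section LocMap.
Variables (C D : category) (F : functor C D).
Variables (S : forall X Y : C, hom X Y -> Prop).
Variables (S' : forall X Y : D, hom X Y -> Prop).
Hypothesis FS : forall X Y (s : hom X Y), S s -> S' (fmor F s).

Fixpoint lmap X Y (p : lhom S X Y) : lhom S' (F X) (F Y) :=
  match p with
  | lof _ _ f => lof S' (fmor F f)
  | linv _ _ s hs => linv (FS hs)
  | lcomp _ _ _ q p => lcomp (lmap q) (lmap p)
  end.

Fact lmap_leq X Y (p q : lhom S X Y) : leq p q -> leq (lmap p) (lmap q).
Proof.
have of_id X0 : leq (lof S' (fmor F (idm X0))) (lof S' (idm (F X0))).
  exact/leq_of/fmor_id.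
elim=> {X Y p q} /=.
- by move=> *; exact: leq_refl.
- by move=> *; exact: leq_sym.
- by move=> X Y p q r _ h1 _ h2; exact: leq_trans h1 h2.
- by move=> *; exact: leq_cong.
- by move=> *; exact: leq_assoc.
- move=> X Y p; apply: leq_trans (leq_idl _).
  by apply: leq_cong (leq_refl _); exact: of_id.
- move=> X Y p; apply: leq_trans (leq_idr _).
  by apply: leq_cong; [exact: leq_refl | exact: of_id].
- by move=> X Y f g h; apply/leq_of/fmor_heq.
- move=> X Y Z g f; apply: leq_trans (leq_comp _ _ _).
  exact/leq_of/fmor_comp.
- by move=> X Y s hs; apply: leq_trans (leq_invl _) (leq_sym (of_id _)).
- by move=> X Y s hs; apply: leq_trans (leq_invr _) (leq_sym (of_id _)).
Qed.

Definition loc_map : functor (loc S) (loc S') :=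
  @Functor (loc S) (loc S') F lmap lmap_leq
    (fun X => leq_of S' (fmor_id F X)) (fun X Y Z g f => leq_refl _).
End LocMap.

Section Singularity.
Variable S : pzRingType.

Record Kob := MkKob { kcx :> complex S; kcxP : in_Kmb kcx }.
Implicit Types X Y Z : Kob.

Lemma homotopic_refl X Y (f : chain_map X Y) : homotopic f f.
Proof.
exists (fun n => \0) => n x.
by rewrite subrr /= linear0 addr0.
Qed.
Lemma homotopic_sym X Y (f g : chain_map X Y) : homotopic f g -> homotopic g f.
Proof.
move=> [h hh]; exists (fun n => -%R \o h n) => n x.
by rewrite -opprB hh opprD /= linearN.
Qed.
Lemma homotopic_trans X Y (f g k : chain_map X Y) :
  homotopic f g -> homotopic g k -> homotopic f k.
Proof.
move=> [h hh] [h' hh']; exists (fun n => h n \+ h' n) => n x.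
by rewrite /= linearD addrACA -hh -hh' addrA subrK.
Qed.
Lemma homotopic_comp X Y Z (g g' : chain_map Y Z) (f f' : chain_map X Y) :
  homotopic g g' -> homotopic f f' -> homotopic (cm_comp g f) (cm_comp g' f').
Proof.
move=> [h hh] [k hk].
exists (fun n => (h n \o f (n + 1)) \+ (g' n \o k n)) => n x /=.
rewrite linearD addrACA cmd -hh -!cmd -linearD -hk linearB addrA subrK //.
Qed.

Definition Kcat : category :=
  @Category Kob (fun X Y => chain_map X Y) (fun X Y => @homotopic S X Y)
    (fun X => cm_id X) (fun X Y Z g f => cm_comp g f)
    homotopic_refl homotopic_sym homotopic_trans homotopic_comp
    (fun X Y f => homotopic_refl f)
    (fun X Y f => homotopic_refl f)
    (fun X Y Z W h g f => homotopic_refl _).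

Definition Kshift_ob X : Kob := MkKob (in_Kmb_shift (kcxP X)).
Definition Kcone X Y (f : chain_map X Y) : Kob :=
  MkKob (in_Kmb_cone f (kcxP X) (kcxP Y)).

Lemma Kshift_heq X Y (f g : chain_map X Y) :
  homotopic f g -> homotopic (shift_map f) (shift_map g).
Proof.
move=> [h hh]; exists (fun n => -%R \o h (n + 1)) => n x /=.
by rewrite !linearN !opprK hh.
Qed.

Definition Kshift : functor Kcat Kcat :=
  @Functor Kcat Kcat Kshift_ob (fun X Y f => shift_map f) Kshift_heq
    (fun X => @homotopic_refl (Kshift_ob X) (Kshift_ob X) _)
    (fun X Y Z g f => @homotopic_refl (Kshift_ob X) (Kshift_ob Z) _).

Definition cone_triangle X Y (f : chain_map X Y) : triangle Kshift :=
  @Triangle Kcat Kshift X Y (Kcone f) f (cone_in f) (cone_out f).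

(* K^{-,b}(proj S) *)
Definition K : tcategory :=
  @TCategory Kcat Kshift
    (fun T => exists X Y (f : chain_map X Y), tri_iso T (cone_triangle f)).

Definition perfect_cone (X Y : Kcat) (s : hom X Y) : Prop := perfect (Kcone s).

Definition Dsg_shift : functor (loc perfect_cone) (loc perfect_cone) :=
  @loc_map Kcat Kcat Kshift perfect_cone perfect_cone
    (fun X Y s hs => perfect_cone_shift hs).

Definition quot_triangle (T : triangle Kshift) : triangle Dsg_shift :=
  @Triangle (loc perfect_cone) Dsg_shift (tX T) (tY T) (tZ T)
    (lof _ (tf T)) (lof _ (tg T)) (lof _ (th T)).

(* The Verdier quotient by the perfect complexes: the morphisms with perfect
   cone are inverted, and the distinguished triangles are those isomorphic to
   images of distinguished triangles. *)
Definition Dsg : tcategory :=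
  @TCategory (loc perfect_cone) Dsg_shift
    (fun T => exists2 T0, @dist K T0 & tri_iso T (quot_triangle T0)).

End Singularity.

Section Induced.
Variables (R : pzRingType) (e : R) (he : e * e = e).

Lemma ilambda_ext (N : lmodType (corner he)) (M : lmodType R)
    (f g : {linear ilambda N -> M}) :
  (forall x n, f (pure x n) = g (pure x n)) -> forall t, f t = g t.
Proof.
move=> h; elim/pureW=> [|x n t ih]; first by rewrite !linear0.
by rewrite !linearD ih h.
Qed.

Lemma pure0r (N : lmodType (corner he)) (x : Re_right he) : pure x (0 : N) = 0.
Proof. by apply: (addrI (pure x (0 : N))); rewrite -pureDr !addr0. Qed.

Lemma pureNr (N : lmodType (corner he)) (x : Re_right he) (n : N) :
  pure x (- n) = - pure x n.
Proof. by apply: (addrI (pure x n)); rewrite -pureDr !subrr pure0r. Qed.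

Section Cx.
Variable X : complex (corner he).
Fact ilambda_cx_dd n t :
  ilambda_map (cd X (n + 1)) (ilambda_map (cd X n) t) = 0.
Proof.
apply: (ilambda_ext (f := ilambda_map (cd X (n + 1)) \o ilambda_map (cd X n))
                    (g := \0)) => x y.
by rewrite /= !tens_map_pure cdd pure0r.
Qed.
Definition ilambda_cx : complex R :=
  @Complex R (fun n => ilambda (X n)) (fun n => ilambda_map (cd X n)) ilambda_cx_dd.
End Cx.

Fact ilambda_cm_subproof X Y (f : chain_map X Y) n (t : ilambda_cx X n) :
  ilambda_map (f (n + 1)) (cd (ilambda_cx X) n t) =
  cd (ilambda_cx Y) n (ilambda_map (f n) t).
Proof.
apply: (ilambda_ext (f := ilambda_map (f (n + 1)) \o ilambda_map (cd X n))
                    (g := ilambda_map (cd Y n) \o ilambda_map (f n))) => x y.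
by rewrite /= !tens_map_pure cmd.
Qed.
Definition ilambda_cm X Y (f : chain_map X Y) :
    chain_map (ilambda_cx X) (ilambda_cx Y) :=
  @ChainMap R (ilambda_cx X) (ilambda_cx Y) (fun n => ilambda_map (f n))
    (ilambda_cm_subproof f).

Definition ilambda_preserves_Kmb : Prop :=
  forall X : complex (corner he), in_Kmb X -> in_Kmb (ilambda_cx X).

Definition ilambda_preserves_perfect : Prop :=
  forall X : complex (corner he), in_Kmb X -> perfect X -> perfect (ilambda_cx X).

Lemma perfect_cone_ilambda (X Y : complex (corner he)) (f : chain_map X Y) :
  perfect (ilambda_cx (cone f)) -> perfect (cone (ilambda_cm f)).
Proof.
pose pr1 n : {linear cone f n -> X (n + 1)} := fst.
pose pr2 n : {linear cone f n -> Y n} := snd.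
have l n : linear (fun t : ilambda_cx (cone f) n =>
    (ilambda_map (pr1 n) t, ilambda_map (pr2 n) t) : cone (ilambda_cm f) n).
  move=> a s t; congr (_, _).
    exact: (linearP (ilambda_map (pr1 n))).
  exact: (linearP (ilambda_map (pr2 n))).
have s n t : mklinear (l (n + 1)) (cd (ilambda_cx (cone f)) n t) =
             cd (cone (ilambda_cm f)) n (mklinear (l n) t).
  apply: (ilambda_ext
    (f := mklinear (l (n + 1)) \o cd (ilambda_cx (cone f)) n)
    (g := cd (cone (ilambda_cm f)) n \o mklinear (l n))) => x p.
  by congr (_, _); rewrite /= !tens_map_pure /= ?pureNr ?pureDr.
apply: (@perfect_quasi_iso _ _ _ (ChainMap s)); apply: bij_quasi_iso => n.
have l1 : linear (fun x : X (n + 1) => (x, 0) : cone f n).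
  by move=> a x y; congr (_, _); rewrite /= scaler0 addr0.
have l2 : linear (fun y : Y n => (0, y) : cone f n).
  by move=> a x y; congr (_, _); rewrite /= scaler0 addr0.
exists (fun p => ilambda_map (mklinear l1) p.1 + ilambda_map (mklinear l2) p.2).
  apply: (ilambda_ext
    (f := (ilambda_map (mklinear l1) \o ilambda_map (pr1 n)) \+
          (ilambda_map (mklinear l2) \o ilambda_map (pr2 n)))
    (g := idfun)) => x [a b].
  by rewrite /= !tens_map_pure -pureDr; congr (pure _ (_, _));
    rewrite /= ?addr0 ?add0r.
have e11 t : ilambda_map (pr1 n) (ilambda_map (mklinear l1) t) = t.
  apply: (ilambda_ext (f := ilambda_map (pr1 n) \o ilambda_map (mklinear l1))
    (g := idfun)) => x y; by rewrite /= !tens_map_pure.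
have e12 t : ilambda_map (pr1 n) (ilambda_map (mklinear l2) t) = 0.
  apply: (ilambda_ext (f := ilambda_map (pr1 n) \o ilambda_map (mklinear l2))
    (g := \0)) => x y; by rewrite /= !tens_map_pure pure0r.
have e21 t : ilambda_map (pr2 n) (ilambda_map (mklinear l1) t) = 0.
  apply: (ilambda_ext (f := ilambda_map (pr2 n) \o ilambda_map (mklinear l1))
    (g := \0)) => x y; by rewrite /= !tens_map_pure pure0r.
have e22 t : ilambda_map (pr2 n) (ilambda_map (mklinear l2) t) = t.
  apply: (ilambda_ext (f := ilambda_map (pr2 n) \o ilambda_map (mklinear l2))
    (g := idfun)) => x y; by rewrite /= !tens_map_pure.
move=> [a b]; congr (_, _).
  by rewrite (linearD (ilambda_map (pr1 n))) e11 e12 addr0.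
by rewrite (linearD (ilambda_map (pr2 n))) e21 e22 add0r.
Qed.

Hypothesis hK : ilambda_preserves_Kmb.
Hypothesis hP : ilambda_preserves_perfect.

Definition K_ilambda_ob (X : Kob (corner he)) : Kob R := MkKob (hK (kcxP X)).

Fact K_ilambda_heq (X Y : Kob (corner he)) (f g : chain_map X Y) :
  homotopic f g -> homotopic (ilambda_cm f) (ilambda_cm g).
Proof.
move=> [h hh]; exists (fun n => ilambda_map (h n)) => n t /=.
apply: (ilambda_ext
  (f := ilambda_map (f (n + 1)) \- ilambda_map (g (n + 1)))
  (g := (ilambda_map (cd Y n) \o ilambda_map (h n)) \+
        (ilambda_map (h (n + 1)) \o ilambda_map (cd X (n + 1))))) => x y.
by rewrite /= !tens_map_pure -pureNr -!pureDr hh.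
Qed.

Lemma homotopic_eq (S : pzRingType) (X Y : complex S) (f g : chain_map X Y) :
  (forall n x, f n x = g n x) -> homotopic f g.
Proof.
move=> h; exists (fun n => \0) => n x.
by rewrite h subrr /= linear0 addr0.
Qed.

Fact K_ilambda_id (X : Kob (corner he)) :
  homotopic (ilambda_cm (cm_id X)) (cm_id (ilambda_cx X)).
Proof.
apply: homotopic_eq => n; apply: ilambda_ext => x y.
by rewrite /= tens_map_pure.
Qed.

Fact K_ilambda_comp (X Y Z : Kob (corner he))
    (g : chain_map Y Z) (f : chain_map X Y) :
  homotopic (ilambda_cm (cm_comp g f)) (cm_comp (ilambda_cm g) (ilambda_cm f)).
Proof.
apply: homotopic_eq => n; apply: ilambda_ext => x y.
by rewrite /= !tens_map_pure.
Qed.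

Definition K_ilambda : functor (K (corner he)) (K R) :=
  @Functor (K (corner he)) (K R) K_ilambda_ob (fun X Y f => ilambda_cm f)
    K_ilambda_heq K_ilambda_id K_ilambda_comp.

Fact K_ilambda_perfect_cone (X Y : K (corner he)) (s : hom X Y) :
  perfect_cone s -> perfect_cone (fmor K_ilambda s).
Proof.
by move=> hs; apply/perfect_cone_ilambda/hP => //; exact: kcxP (Kcone s).
Qed.

Definition Dsg_ilambda : functor (Dsg (corner he)) (Dsg R) :=
  loc_map K_ilambda_perfect_cone.

(* Termwise the identity of i_lambda(X)^(n+1); the two differentials
   i_lambda(- d) and - i_lambda(d) agree pointwise only. *)
Section ShiftComm.
Variable X : complex (corner he).
Fact ilambda_shift_subproof n (t : ilambda (X (n + 1))) :
  idfun (cd (ilambda_cx (shift X)) n t) = cd (shift (ilambda_cx X)) n (idfun t).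
Proof.
apply: (ilambda_ext (f := ilambda_map (cd (shift X) n))
                    (g := cd (shift (ilambda_cx X)) n)) => x y.
by rewrite /= !tens_map_pure pureNr.
Qed.
Definition ilambda_shift : chain_map (ilambda_cx (shift X)) (shift (ilambda_cx X)) :=
  @ChainMap R (ilambda_cx (shift X)) (shift (ilambda_cx X)) (fun n => idfun)
    ilambda_shift_subproof.
End ShiftComm.

Definition Dsg_ilambda_shift (X : Dsg (corner he)) :
    hom (Dsg_ilambda (Sh (Dsg (corner he)) X)) (Sh (Dsg R) (Dsg_ilambda X)) :=
  @lof (K R) (@perfect_cone R)
    (K_ilambda_ob (Kshift_ob X)) (Kshift_ob (K_ilambda_ob X)) (ilambda_shift X).

End Induced.

(* Main.v *)
(* Write [eRe] for the corner ring. Two facts make the theorem explicit.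

   Low degrees decide everything. A complex in K^{-,b}(proj) is perfect if and
   only if it is contractible in all sufficiently low degrees, so a chain map has
   perfect cone if and only if it is a homotopy equivalence in low degrees. Hence
   the singularity category embeds fully faithfully into the category of germs at
   minus infinity of chain maps, modulo germs of homotopies: a germ from X to Y
   is a chain map from X to the brutal truncation of Y in degrees <= N for some N,
   and the projection from Y to this truncation has perfect cone.

   The functor [Re (x) -] is fully faithful on modules, because
   [N = e (Re (x) N)]. So it is fully faithful on germs, and therefore on
   singularity categories. Finite projective dimension of the right module [Re] is
   needed only to see that [Re (x) X] has bounded cohomology (dimension shifting
   along the syzygies of [Re]).

   For the equivalence only essential surjectivity is left. If M has a resolution
   with terms in [add Re] from some point on, then a truncation of it is [Re (x) -]
   of its corner complex, as [Re (x) eP = P] for P in [add Re]; every complex of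
   K^{-,b}(proj R) agrees in low degrees with a shifted resolution of some M.
   Conversely, let Q be a resolution of M that is isomorphic to [Re (x) X] in the
   singularity category. The isomorphism is given by a chain map g from Q to a
   truncation W of [Re (x) X] whose cone is perfect, hence quasi-isomorphic to a
   bounded complex B. The cone of the composite W -> cone g -> B is then
   quasi-isomorphic to Q[1], and its terms are those of W[1] in low degrees. *)
Require Import Defs.
From HB Require Import structures.
From mathcomp Require Import all_boot all_order all_algebra.
From mathcomp Require Import zify boolp functions.
From Stdlib Require Import Relation_Operators Setoid Morphisms.
Require Import Defs.

Set Implicit Arguments.
Unset Strict Implicit.
Unset Printing Implicit Defensive.

Import GRing.Theory.
Local Open Scope ring_scope.

(** * Modules and retracts *)

Definition submodule (S : pzRingType) (M : lmodType S) (P : M -> Prop) : Prop :=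
  [/\ P 0, forall x y, P x -> P y -> P (x + y) & forall a x, P x -> P (a *: x)].

Section Submodule.
Variables (S : pzRingType) (M : lmodType S) (P : M -> Prop).

(** The closure proof is an argument so that canonical structures can recover it from the predicate
    itself. *)
Definition subm_pred (hP : submodule P) : {pred M} := fun x => `[< P x >].

Variable hP : submodule P.

Fact subm_pred_closed : submod_closed (subm_pred hP).
Proof.
have [P0 PD PZ] := hP; split; first exact/asboolP.
by move=> a x y /asboolP hx /asboolP hy; apply/asboolP/PD => //; exact: PZ.
Qed.
HB.instance Definition _ :=
  GRing.isSubmodClosed.Build S M (subm_pred hP) subm_pred_closed.

Record subm := Subm { subm_val : M; subm_valP : subm_val \in subm_pred hP }.
HB.instance Definition _ := [isSub of subm for subm_val].
HB.instance Definition _ := [Choice of subm by <:].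
HB.instance Definition _ := [SubChoice_isSubLmodule of subm by <:].

Definition sinc : {linear subm -> M} := mklinear (linearP (val : subm -> M)).

Lemma sincP (x : subm) : P (sinc x).
Proof. by case: x => x /= /asboolP. Qed.

Lemma sinc_inj : injective sinc.
Proof. exact: val_inj. Qed.

Definition smk (x : M) (hx : P x) : subm := Subm (introT (asboolP _) hx).

Section Corestriction.
Variables (A : lmodType S) (f : {linear A -> M}) (hf : forall x, P (f x)).
Fact scor_linear : linear (fun x => smk (hf x)).
Proof. by move=> a x y; apply: sinc_inj; rewrite [LHS]/= linearP. Qed.
Definition scor : {linear A -> subm} := mklinear scor_linear.
Lemma scorE x : sinc (scor x) = f x.
Proof. by []. Qed.
End Corestriction.
End Submodule.

Section Modules.
Variable S : pzRingType.
Implicit Types A B M N P Q : lmodType S.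

Definition retract A B : Prop :=
  exists (i : {linear A -> B}) (p : {linear B -> A}), forall x, p (i x) = x.

Lemma retract_trans A B M : retract A B -> retract B M -> retract A M.
Proof.
move=> [i [p pi]] [j [q qj]]; exists (j \o i), (p \o q) => x /=.
by rewrite qj pi.
Qed.

Lemma retract_bij A B (f : {linear A -> B}) : bijective f -> retract A B.
Proof.
move=> [g fK gK]; have lg : linear g by move=> a x y; rewrite -{1}(gK x) -{1}(gK y) -linearP fK.
by exists f, (mklinear lg).
Qed.

Lemma retract_zero A B : is_zero A -> retract A B.
Proof. by move=> A0; exists \0, \0 => x; rewrite (A0 x). Qed.

Lemma retract_prod_zero A B : is_zero B -> retract (A * B)%type A.
Proof.
move=> B0.
have l1 : linear (fun x : A => (x, 0) : A * B).
  by move=> a x y; congr (_, _); rewrite /= scaler0 addr0.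
exists fst, (mklinear l1) => -[x y].
by rewrite (B0 y).
Qed.

Section Pairing.
Variables (A B M : lmodType S) (f : {linear A -> B}) (g : {linear A -> M}).
Fact lpair_linear : linear (fun x => (f x, g x) : B * M).
Proof. by move=> a x y; congr (_, _); rewrite linearP. Qed.
Definition lpair : {linear A -> (B * M)%type} := mklinear lpair_linear.
End Pairing.

Lemma projective_retract A P : retract A P -> projective P -> projective A.
Proof.
move=> [i [p pi]] pP B C g f sg.
have [h hh] := pP _ _ g (f \o p) sg.
by exists (h \o i) => x /=; rewrite hh /= pi.
Qed.

Lemma fin_gen_surj A B (f : {linear A -> B}) : surj f -> fin_gen A -> fin_gen B.
Proof.
move=> sf [n [g hg]]; exists n, (f \o g) => y.
have [x <-] := sf y; have [c ->] := hg x; exists c.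
by rewrite linear_sum; apply: eq_bigr => i _; rewrite linearZ.
Qed.

Lemma fg_projective_retract A P : retract A P -> fg_projective P -> fg_projective A.
Proof.
move=> rA [fP pP]; split; last exact: projective_retract rA pP.
have [i [p pi]] := rA; apply: (fin_gen_surj (f := p)) fP.
by move=> x; exists (i x).
Qed.

Lemma image_submodule A B (f : {linear A -> B}) : submodule (fun y => exists x, f x = y).
Proof.
split; first by exists 0; rewrite linear0.
- by move=> _ _ [x <-] [y <-]; exists (x + y); rewrite linearD.
- by move=> a _ [x <-]; exists (a *: x); rewrite linearZ.
Qed.

Lemma kernel_submodule A B (f : {linear A -> B}) : submodule (fun x => f x = 0).
Proof.
split; first by rewrite linear0.
- by move=> x y hx hy; rewrite linearD hx hy addr0.
- by move=> a x hx; rewrite linearZ /= hx scaler0.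
Qed.

Lemma fixed_submodule A (f : {linear A -> A}) : submodule (fun x => f x = x).
Proof.
split; first by rewrite linear0.
- by move=> x y hx hy; rewrite linearD hx hy.
- by move=> a x hx; rewrite linearZ /= hx.
Qed.

(** Corestricted to its image, [d] becomes surjective, and [u] lands in that image, so projectivity
    applies. *)
Lemma projective_lift P A B (d : {linear A -> B}) (u : {linear P -> B}) :
  projective P -> (forall x, exists y, d y = u x) ->
  exists h : {linear P -> A}, forall x, d (h x) = u x.
Proof.
move=> pP hu; pose I := image_submodule d.
have hd x : exists y, d y = d x by exists x.
have [|h hh] := pP _ _ (scor I hd) (scor I hu).
  move=> y; have [x hx] := sincP y.
  by exists x; apply: sinc_inj; rewrite scorE.
by exists h => x; rewrite -(scorE I hd) hh.
Qed.

Section FfunComb.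
Variables (n : nat) (M : lmodType S).
Fact ffun_comb_linear (g : 'I_n -> M) :
  linear (fun c : {ffun 'I_n -> S^o} => \sum_(i < n) (c i : S) *: g i).
Proof.
move=> a c c'; rewrite scaler_sumr -big_split /=; apply: eq_bigr => i _.
by rewrite !ffunE scalerDl scalerA.
Qed.
Definition ffun_comb g : {linear {ffun 'I_n -> S^o} -> M} := mklinear (ffun_comb_linear g).
End FfunComb.

Fact ffun_proj_linear (n : nat) (M : lmodType S) (i : 'I_n) :
  linear (fun c : {ffun 'I_n -> M} => c i).
Proof. by move=> a c c'; rewrite !ffunE. Qed.
Definition ffun_proj n M i : {linear {ffun 'I_n -> M} -> M} :=
  mklinear (@ffun_proj_linear n M i).

(** Projectivity splits the surjection from a free module given by the generators; the functionals
    [c i] are the coordinates of the section. *)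
Lemma fg_projective_dual_basis P : fg_projective P ->
  exists (n : nat) (g : 'I_n -> P) (c : 'I_n -> {linear P -> S^o}),
    forall x, x = \sum_(i < n) (c i x : S) *: g i.
Proof.
move=> [[n [g hg]] pP].
have [|h hh] := pP _ _ (ffun_comb g) idfun.
  by move=> y; have [c ->] := hg y; exists [ffun i => c i]; apply: eq_bigr => i _; rewrite ffunE.
by exists n, g, (fun i => ffun_proj _ i \o h) => x; rewrite -[LHS]hh.
Qed.

Lemma fg_projective_free n : fg_projective ({ffun 'I_n -> S^o} : lmodType S).
Proof.
split.
  exists n, (fun i => [ffun j => (i == j)%:R]) => x; exists (fun i => x i).
  apply/ffunP => j; rewrite sum_ffunE (bigD1 j) //= !ffunE eqxx big1 ?addr0.
    by rewrite /GRing.scale /= mulr1.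
  by move=> i /negbTE ij; rewrite !ffunE ij scaler0.
move=> A B q f sq.
have /choice[g hg] i := sq (f [ffun j => (i == j)%:R]).
exists (ffun_comb g) => x; rewrite linear_sum /=.
have {2}-> : x = \sum_i (x i : S) *: ([ffun j => (i == j)%:R] : {ffun 'I_n -> S^o}).
  apply/ffunP => j; rewrite sum_ffunE (bigD1 j) //= !ffunE eqxx big1 ?addr0.
    by rewrite /GRing.scale /= mulr1.
  by move=> i /negbTE ij; rewrite !ffunE ij scaler0.
by rewrite linear_sum; apply: eq_bigr => i _; rewrite !linearZ /= hg.
Qed.

(** Retracts compose more easily than direct sum decompositions. Conversely, the complement of a
    retract is the kernel of its retraction. *)
Lemma in_addP Q M :
  in_add Q M <-> exists n, retract M ({ffun 'I_n -> Q} : lmodType S).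
Proof.
split=> [[n [N [f bf]]]|[n [i [p pi]]]].
  exists n; apply: retract_trans (retract_bij bf).
  have l : linear (fun x : M => (x, 0) : M * N).
    by move=> a x y; congr (_, _); rewrite /= scaler0 addr0.
  by exists (mklinear l), fst.
exists n, (subm (kernel_submodule p)).
pose s := sinc (kernel_submodule p).
have lf : linear (fun z : M * subm (kernel_submodule p) => i z.1 + s z.2).
  by move=> a x y; rewrite /= !linearP scalerDr addrACA.
exists (mklinear lf).
have hk y : p (y - i (p y)) = 0 by rewrite linearB /= pi subrr.
exists (fun y => (p y, smk (kernel_submodule p) (hk y))) => [[x z]|y] /=.
  have pz := sincP z.
  have e1 : p (i x + s z) = x by rewrite linearD /= pi pz addr0.
  congr (_, _) => //; apply: sinc_inj => /=.
  by rewrite e1 addrC addKr.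
by rewrite addrC subrK.
Qed.

End Modules.

(** * Null homotopies and quasi-isomorphisms *)

Section IntFamilies.

(* Families over [int] are built by descending recursion from the bound [b]
   without casts: the recursion on [k] carries a proof of [n = b + 1 - k]. *)
Lemma int_descend (T : int -> Type) (Q : forall n, T n -> T (n + 1) -> Prop)
    (b : int) (z : forall n, b < n -> T n) :
  (forall n (h : b < n) (h' : b < n + 1), Q n (z n h) (z (n + 1) h')) ->
  (forall n (t' : T (n + 1)), exists t, Q n t t') ->
  exists f : forall n, T n, forall n, Q n (f n) (f (n + 1)).
Proof.
move=> hz hs.
pose s n t' := sval (cid (hs n t')).
have hsP n t' : Q n (s n t') t' by rewrite /s; case: (cid _).
have lt0 n (e : n = b + 1 - 0%:Z) : b < n by lia.
have ltS k n (e : n = b + 1 - k.+1%:Z) : n + 1 = b + 1 - k%:Z by lia.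
pose G := fix G (k : nat) : forall n, n = b + 1 - k%:Z -> T n :=
  match k with
  | 0 => fun n e => z n (lt0 n e)
  | k'.+1 => fun n e => s n (G k' (n + 1) (ltS k' n e))
  end.
have len (n : int) (h : ~ b < n) : n = b + 1 - (absz (b + 1 - n)%R)%:Z by lia.
pose f n : T n := match pselect (b < n) with
  | left h => z n h
  | right h => G _ n (len n h)
  end.
have fE1 n h : f n = z n h.
  by rewrite /f; case: pselect => // h'; rewrite (Prop_irrelevance h' h).
have fE2 n k h : f n = G k.+1 n h.
  rewrite /f; case: pselect => h'; first by lia.
  have ek : absz (b + 1 - n)%R = k.+1 by lia.
  by move: (len n h'); rewrite ek => h''; rewrite (Prop_irrelevance h'' h).
exists f => n; case: (boolP (b < n)) => hn.
  have hn1 : b < n + 1 by lia.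
  by rewrite (fE1 n hn) (fE1 (n + 1) hn1); exact: hz.
have hk : n = b + 1 - (absz (b - n)%R).+1%:Z by lia.
rewrite (fE2 n _ hk) [G _ n hk]/=.
have -> : f (n + 1) = G _ (n + 1) (ltS _ n hk).
  by case: (absz _) (ltS _ n hk) => [|k] h; [exact: fE1|exact: fE2].
exact: hsP.
Qed.

Lemma int_succ_ind (Q : int -> Prop) : (forall n, Q (n + 1)) -> forall n, Q n.
Proof. by move=> h n; rewrite -(subrK 1 n). Qed.

(** Null homotopies of maps into cones yield components in degrees n + 1 only; this reindexes them
    over all degrees and keeps the cast inside the witness. *)
Lemma int_pred_family (T : int -> Type) (f : forall n, T (n + 1)) :
  exists f' : forall n, T n, forall n, f' (n + 1) = f n.
Proof.
exists (fun n => ecast m (T m) (subrK 1 n) (f (n - 1))) => n.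
have castE m (e : m + 1 = n + 1) : m = n -> ecast k (T k) e (f m) = f n.
  by move=> emn; subst m; rewrite (Prop_irrelevance e erefl).
exact/castE/addrK.
Qed.

Lemma int_update (T : int -> Type) (z : forall n, T n) (a : int) (t : T a) :
  exists f : forall n, T n, f a = t /\ forall n, n != a -> f n = z n.
Proof.
exists (fun n => match @eqP _ a n with
  | ReflectT e => ecast m (T m) e t | ReflectF _ => z n end); split.
  by case: eqP => // e; rewrite (Prop_irrelevance e erefl).
by move=> n; case: eqP => // e /eqP ne; case: ne.
Qed.

End IntFamilies.

Section QuasiIso.
Variable S : pzRingType.
Implicit Types X Y Z P A : complex S.

(** Descending recursion from the bound of P. The invariant [I], that f = d h on cycles, makes f - h
    d take values in cycles one degree lower, where acyclicity of A and projectivity of P give the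
    next h. The upward closed set [D] allows A to be acyclic in high degrees only. *)
Lemma null_homotopy P A (f : chain_map P A) (D : int -> Prop) :
  (forall n, projective (P n)) -> bounded_above P ->
  (forall n, D n -> D (n + 1)) -> (forall n, D n -> acyclic_at A n) ->
  exists h : forall n, {linear P (n + 1) -> A n}, forall n, D n ->
    forall x, f (n + 1) x = cd A n (h n x) + h (n + 1) (cd P (n + 1) x).
Proof.
move=> pP [b hb] hD hA.
pose I n (h : {linear P (n + 1) -> A n}) := D n ->
  forall x, cd P (n + 1) x = 0 -> f (n + 1) x = cd A n (h x).
have z0 n : b < n -> I n \0.
  by move=> hn _ x _; rewrite (hb (n + 1) _ x) ?linear0 //; lia.
have [||h hh] := @int_descend (fun n => {h : {linear P (n + 1) -> A n} | I n h})
  (fun n h h' => D n -> forall x,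
     f (n + 1) x = cd A n (sval h x) + sval h' (cd P (n + 1) x)) b
  (fun n hn => exist (I n) \0 (z0 n hn)).
- move=> n h h' hm x /=.
  by rewrite (hb (n + 1) _ x) ?linear0 ?addr0 //; lia.
- move=> n [h' Ih'] /=.
  have [hm|hm] := pselect (D n); last first.
    have I0 : I n \0 by [].
    by exists (exist (I n) \0 I0).
  have [||h hh] := @projective_lift _ (P (n + 1)) _ _ (cd A n)
    (f (n + 1) \- (h' \o cd P (n + 1))).
  + exact: pP.
  + move=> x /=; apply: hA => //.
    rewrite linearB -cmd /= Ih' ?subrr //; first exact: hD.
    exact: cdd.
  have Ih : I n h by move=> _ x hx; rewrite hh /= hx linear0 subr0.
  by exists (exist _ h Ih) => _ x /=; rewrite hh /= subrK.
by exists (fun n => sval (h n)).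
Qed.

Lemma hom_sym X Y (f g : chain_map X Y) : homotopic f g -> homotopic g f.
Proof.
move=> [h hh]; exists (fun n => -%R \o h n) => n x.
by rewrite -opprB hh opprD /= linearN.
Qed.

Lemma acyclic_cone X Y (q : chain_map X Y) n : quasi_iso q -> acyclic_at (cone q) n.
Proof.
move=> qq [x y] [/= /eqP hx hy]; move: hx; rewrite oppr_eq0 => /eqP hx.
have [qi _] := qq (n + 1); have [_ qs] := qq n.
have [|x' hx'] := qi x hx; first by exists (- y); rewrite linearN; apply: addr0_eq; rewrite -[RHS]hy; exact: addrC.
have hc : cd Y (n + 1) (y + q (n + 1) x') = 0 by rewrite linearD -cmd hx' -[RHS]hy; exact: addrC.
have [u hu [z hz]] := qs _ hc.
exists (u - x', z); congr (_, _) => /=.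
  by rewrite linearB hu hx' sub0r opprK.
rewrite -hz linearB.
have e (V : zmodType) (a b c : V) : a - b + (c + b - a) = c by rewrite addrC addrA subrK addrK.
exact: e.
Qed.

(** The composite of f with Y -> cone q is null homotopic, because the cone is acyclic. The first
    component of the homotopy is the lift g, and the second, up to sign, is the homotopy between q g
    and f. *)
Lemma lift_quasi_iso P X Y (q : chain_map X Y) (f : chain_map P Y) :
  (forall n, projective (P n)) -> bounded_above P -> quasi_iso q ->
  exists g : chain_map P X, homotopic (cm_comp q g) f.
Proof.
move=> pP bP qq.
have [//||h hh] := @null_homotopy P (cone q) (cm_comp (cone_in q) f) (fun _ => True) pP bP.
  by move=> n _; exact: acyclic_cone.
have {}hh n x := hh n I x.
have [g hg] := @int_pred_family (fun n => {linear P n -> X n}) (fun n => fst \o h n).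
have gd : forall n x, g (n + 1) (cd P n x) = cd X n (g n x).
  apply: int_succ_ind => n x.
  by have /(congr1 fst) /= /esym/addr0_eq := hh n x; rewrite !hg /= opprK.
exists (ChainMap gd), (fun n => -%R \o (snd \o h n)) => n x /=.
have /(congr1 snd) /= -> := hh n x.
by rewrite hg /= linearN -addrA opprD addrA subrr sub0r opprD.
Qed.


Lemma hom_trans X Y (f g k : chain_map X Y) :
  homotopic f g -> homotopic g k -> homotopic f k.
Proof.
move=> [h hh] [h' hh']; exists (fun n => h n \+ h' n) => n x.
by rewrite /= linearD addrACA -hh -hh' addrA subrK.
Qed.

Lemma hom_compl X Y Z (g : chain_map Y Z) (f f' : chain_map X Y) :
  homotopic f f' -> homotopic (cm_comp g f) (cm_comp g f').
Proof.
move=> [h hh]; exists (fun n => g n \o h n) => n x /=.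
by rewrite -linearB hh linearD cmd.
Qed.

Lemma hom_compr X Y Z (g g' : chain_map Y Z) (f : chain_map X Y) :
  homotopic g g' -> homotopic (cm_comp g f) (cm_comp g' f).
Proof.
move=> [h hh]; exists (fun n => h n \o f (n + 1)) => n x /=.
by rewrite hh cmd.
Qed.

Lemma quasi_iso_id X : quasi_iso (cm_id X).
Proof. by apply: bij_quasi_iso => n; exists id. Qed.

Lemma quasi_iso_comp X Y Z (g : chain_map Y Z) (f : chain_map X Y) :
  quasi_iso f -> quasi_iso g -> quasi_iso (cm_comp g f).
Proof.
move=> qf qg n; have [fi fs] := qf n; have [gi gs] := qg n; split=> [x hx hgf|z hz] /=.
  by apply: (fi x hx); apply: gi hgf; rewrite -cmd hx linear0.
have [y hy [z' hz']] := gs z hz; have [x hx [y' hy']] := fs y hy.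
exists x => //; exists (z' + g n y').
by rewrite linearD -hz' -cmd -hy' linearB addrA subrK.
Qed.

Lemma quasi_iso_homotopic X Y (f g : chain_map X Y) :
  homotopic f g -> quasi_iso f -> quasi_iso g.
Proof.
move=> [h hh] qf n; have [fi fs] := qf n.
have e x : cd X (n + 1) x = 0 -> f (n + 1) x = g (n + 1) x + cd Y n (h n x).
  by move=> hx; have := hh n x; rewrite hx linear0 addr0 => /(canRL (subrK _)) ->; exact: addrC.
split=> [x hx [y hy]|y hy].
  by apply: (fi x hx); exists (y + h n x); rewrite linearD hy -e.
have [x hx [y' hy']] := fs y hy; exists x => //; exists (y' + h n x).
by rewrite linearD -hy' e // opprD addrA subrK.
Qed.

Lemma quasi_iso_cancel X Y Z (g : chain_map Y Z) (f : chain_map X Y) :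
  quasi_iso g -> quasi_iso (cm_comp g f) -> quasi_iso f.
Proof.
move=> qg qgf n; have [hi hs] := qgf n; have [gi gs] := qg n; split=> [x hx [y hy]|y hy].
  by apply: (hi x hx); exists (g n y); rewrite -cmd hy.
have [|x hx [z hz]] := hs (g (n + 1) y); first by rewrite -cmd hy linear0.
exists x => //; have [||y' hy'] := gi (y - f (n + 1) x).
- by rewrite linearB hy -cmd hx linear0 subr0.
- by exists z; rewrite -hz linearB.
by exists y'.
Qed.

(** Along a quasi-isomorphism X -> Y, maps from P compose forwards and lift backwards up to
    homotopy; two-out-of-three keeps them quasi-isomorphisms. A zigzag starting at P thus collapses
    to one map. *)
Lemma zigzag_quasi_iso P X Y : (forall n, projective (P n)) -> bounded_above P ->
  quasi_isomorphic X Y ->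
  (exists f : chain_map P X, quasi_iso f) <-> (exists f : chain_map P Y, quasi_iso f).
Proof.
move=> pP bP; elim=> {X Y} [X Y [q qq]|X|X Y _ ->|X Y Z _ -> _ ->] //; split=> [[f qf]|[f qf]].
  by exists (cm_comp q f); exact: quasi_iso_comp.
have [g hg] := lift_quasi_iso f pP bP qq; exists g.
by apply: (quasi_iso_cancel qq); apply: quasi_iso_homotopic qf; exact: hom_sym.
Qed.

(** A right homotopy inverse g of f exists by lifting the identity. It is again a quasi-isomorphism,
    so it has a right inverse f' of its own, and f' is homotopic to f. *)
Lemma quasi_iso_equiv X Y (f : chain_map X Y) :
  (forall n, projective (X n)) -> bounded_above X ->
  (forall n, projective (Y n)) -> bounded_above Y -> quasi_iso f ->
  exists g : chain_map Y X,
    homotopic (cm_comp g f) (cm_id X) /\ homotopic (cm_comp f g) (cm_id Y).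
Proof.
move=> pX bX pY bY qf.
have [g hg] := lift_quasi_iso (cm_id Y) pY bY qf.
have qg : quasi_iso g.
  apply: (quasi_iso_cancel qf); apply: quasi_iso_homotopic (hom_sym hg) _.
  exact: quasi_iso_id.
have [f' hf'] := lift_quasi_iso (cm_id X) pX bX qg.
exists g; split=> //; apply: (hom_trans _ hf'); apply: hom_compl.
(* [f ~ f g f' ~ f'], hence [g f ~ g f' ~ 1]. *)
apply: hom_trans (hom_compr f' hg).
by apply: hom_sym; exact: (hom_compl f hf').
Qed.

Lemma quasi_isomorphic_equiv X Y :
  (forall n, projective (X n)) -> bounded_above X ->
  (forall n, projective (Y n)) -> bounded_above Y -> quasi_isomorphic X Y ->
  exists (f : chain_map X Y) (g : chain_map Y X),
    homotopic (cm_comp g f) (cm_id X) /\ homotopic (cm_comp f g) (cm_id Y).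
Proof.
move=> pX bX pY bY qXY.
have [h _] := zigzag_quasi_iso pX bX qXY; have [|f qf] := h.
  by exists (cm_id X); exact: quasi_iso_id.
by exists f; exact: quasi_iso_equiv.
Qed.

End QuasiIso.

(** * Truncations *)

(* Reflection for identities of abelian groups: [ring] needs a commutative ring,
   so it does not apply to elements of modules. *)
Inductive zexp := ZVar of nat | ZZero | ZAdd of zexp & zexp | ZOpp of zexp.

Section Zexp.
Variable V : zmodType.

Fixpoint zeval (env : seq V) (t : zexp) : V :=
  match t with
  | ZVar i => env`_i
  | ZZero => 0
  | ZAdd t u => zeval env t + zeval env u
  | ZOpp t => - zeval env t
  end.

Fixpoint zcoef (t : zexp) (i : nat) : int :=
  match t with
  | ZVar j => (i == j)%:Z
  | ZZero => 0
  | ZAdd t u => zcoef t i + zcoef u i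
  | ZOpp t => - zcoef t i
  end.

Lemma zevalE n env t : size env = n ->
  zeval env t = \sum_(i < n) env`_i *~ zcoef t i.
Proof.
move=> sn; elim: t => [j||t iht u ihu|t iht] /=.
- have [jn|jn] := ltnP j n.
    rewrite (bigD1 (Ordinal jn)) //= eqxx big1 ?addr0 // => i /negbTE.
    by rewrite -val_eqE /= => ->; rewrite mulr0z.
  rewrite nth_default ?sn // big1 // => i _.
  by rewrite ltn_eqF ?mulr0z // (ssrnat.leq_trans _ jn).
- by rewrite big1 // => i _; rewrite mulr0z.
- by rewrite iht ihu -big_split; apply: eq_bigr => i _; rewrite mulrzDr.
- by rewrite iht -sumrN; apply: eq_bigr => i _; rewrite mulrNz.
Qed.

Lemma zeval_eq n env t u : size env = n ->
  all (fun i => zcoef t i == zcoef u i) (iota 0 n) -> zeval env t = zeval env u.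
Proof.
move=> sn /allP h; rewrite !(zevalE _ sn); apply: eq_bigr => i _.
by congr (_ *~ _); apply/eqP/h; rewrite mem_iota /=.
Qed.
End Zexp.

(* Atoms are compared up to unification only below linear maps, where the
   canonical structures inferred for the two occurrences may differ. *)
Ltac zmod_same x y :=
  match constr:((x, y)) with
  | (?a, ?a) => idtac
  | (GRing.Linear.sort ?f ?a, GRing.Linear.sort ?g ?b) => unify f g; zmod_same a b
  | (fst ?a, fst ?b) => zmod_same a b
  | (snd ?a, snd ?b) => zmod_same a b
  | (pair ?a ?c, pair ?b ?d) => zmod_same a b; zmod_same c d
  | ((?a + ?c)%R, (?b + ?d)%R) => zmod_same a b; zmod_same c d
  | ((- ?a)%R, (- ?b)%R) => zmod_same a b
  | (0%R, 0%R) => idtac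
  end.
Ltac zmod_lookup x env k :=
  match env with
  | ?y :: _ => let _ := match goal with _ => zmod_same x y end in k
  | _ :: ?env' => zmod_lookup x env' (S k)
  end.
Ltac zmod_atoms t env :=
  match t with
  | (?a + ?b)%R => let env' := zmod_atoms a env in zmod_atoms b env'
  | (- ?a)%R => zmod_atoms a env
  | 0%R => env
  | _ => match env with
         | _ => let k := zmod_lookup t env O in env
         | _ => constr:(t :: env)
         end
  end.
Ltac zmod_reify t env :=
  match t with
  | (?a + ?b)%R => let a' := zmod_reify a env in let b' := zmod_reify b env in
                   constr:(ZAdd a' b')
  | (- ?a)%R => let a' := zmod_reify a env in constr:(ZOpp a')
  | 0%R => constr:(ZZero)
  | _ => let k := zmod_lookup t env O in constr:(ZVar k)
  end.
Ltac zmod :=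
  match goal with
  | |- ?l = ?r =>
    let V := type of l in
    let env := zmod_atoms l (@nil V) in
    let env := zmod_atoms r env in
    let l' := zmod_reify l env in
    let r' := zmod_reify r env in
    let n := eval lazy in (size env) in
    apply: (@zeval_eq _ n env l' r' erefl); vm_compute; reflexivity
  end.


(** Reduces a goal to a known equation: what remains is an identity of abelian groups, to be closed
    by [zmod]. *)
Lemma eq_modulo (V : zmodType) (a b c d : V) : c = d -> a - b = c - d -> a = b.
Proof. by move=> ->; rewrite subrr => /subr0_eq. Qed.

(** * Complexes cut out by degreewise idempotents; brutal truncation *)

Section RetractComplex.
Variable S : pzRingType.

Section Build.
Variables (X : complex S) (p : forall n, {linear X n -> X n}).
Hypothesis pK : forall n x, p n (p n x) = p n x.
Hypothesis pd : forall n x,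
  p (n + 1 + 1) (cd X (n + 1) (p (n + 1) (cd X n (p n x)))) = 0.

Definition rc_ob n : lmodType S := subm (fixed_submodule (p n)).
Definition rc_inc n : {linear rc_ob n -> X n} := sinc (fixed_submodule (p n)).
Definition rc_ret n : {linear X n -> rc_ob n} := scor (fixed_submodule (p n)) (@pK n).

Lemma rc_incP n x : p n (rc_inc n x) = rc_inc n x.
Proof. exact: (sincP (hP := fixed_submodule (p n))). Qed.
Lemma rc_retE n x : rc_inc n (rc_ret n x) = p n x.
Proof. by []. Qed.
Lemma rc_inc_inj n : injective (rc_inc n).
Proof. exact: sinc_inj. Qed.
Lemma rc_incK n x : rc_ret n (rc_inc n x) = x.
Proof. by apply: rc_inc_inj; rewrite rc_retE rc_incP. Qed.

Fact rc_dd n x : (rc_ret (n + 1 + 1) \o cd X (n + 1) \o rc_inc (n + 1))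
   ((rc_ret (n + 1) \o cd X n \o rc_inc n) x) = 0.
Proof.
by apply: rc_inc_inj; rewrite linear0 -[RHS](pd (rc_inc n x)) rc_incP.
Qed.
(** The images of the idempotents p with differential p d. The family p need not commute with d:
    [pd] suffices for a complex, while p d p = p d makes the projection a chain map and p d p = d p
    the inclusion. *)
Definition rc : complex S :=
  @Complex S rc_ob (fun n => rc_ret (n + 1) \o cd X n \o rc_inc n) rc_dd.

Lemma rc_dE n (x : rc n) : rc_inc (n + 1) (cd rc n x) = p (n + 1) (cd X n (rc_inc n x)).
Proof. by []. Qed.

Lemma rc_zero n : (forall x, p n x = 0) -> is_zero (rc n).
Proof. by move=> p0 x; apply: rc_inc_inj; rewrite -rc_incP p0 linear0. Qed.

Lemma rc_retract n : retract (rc n) (X n).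
Proof. by exists (rc_inc n), (rc_ret n); exact: rc_incK. Qed.

Lemma rc_ret_chain : (forall n x, p (n + 1) (cd X n (p n x)) = p (n + 1) (cd X n x)) ->
  forall n x, rc_ret (n + 1) (cd X n x) = cd rc n (rc_ret n x).
Proof. by move=> h n x; apply: rc_inc_inj; rewrite rc_dE !rc_retE h. Qed.

Lemma rc_inc_chain : (forall n x, p (n + 1) (cd X n (p n x)) = cd X n (p n x)) ->
  forall n x, rc_inc (n + 1) (cd rc n x) = cd X n (rc_inc n x).
Proof. by move=> h n x; rewrite rc_dE -(rc_incP x) h. Qed.
End Build.

Section Truncation.
Variables (N : int) (X : complex S).

Definition tpi n : {linear X n -> X n} :=
  if n <= N then (idfun : {linear X n -> X n}) else (\0 : {linear X n -> X n}).
Lemma tpiK n x : tpi n (tpi n x) = tpi n x.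
Proof. by rewrite /tpi; case: ifP. Qed.
Lemma tpi_id n x : n <= N -> tpi n x = x.
Proof. by rewrite /tpi => ->. Qed.
Lemma tpi_zero n x : N < n -> tpi n x = 0.
Proof. by rewrite /tpi; case: ifP => //; lia. Qed.
Lemma tpi_d n x : tpi (n + 1) (cd X n (tpi n x)) = tpi (n + 1) (cd X n x).
Proof.
have [h|h] := boolP (n + 1 <= N); last by rewrite !tpi_zero //; lia.
by rewrite (tpi_id x) //; lia.
Qed.
Fact tpi_dd n x :
  tpi (n + 1 + 1) (cd X (n + 1) (tpi (n + 1) (cd X n (tpi n x)))) = 0.
Proof. by rewrite tpi_d cdd linear0. Qed.

(** The brutal truncation in degrees <= N. It is a quotient of X: the projection is a chain map,
    whereas the inclusion commutes with d only where the target degree is at most N. *)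
Definition trunc : complex S := rc (@tpiK) (@tpi_dd).
Definition trunc_inc n : {linear trunc n -> X n} := rc_inc tpi n.
Definition trunc_ret : chain_map X trunc :=
  @ChainMap S X trunc (rc_ret (@tpiK)) (rc_ret_chain (@tpiK) (@tpi_dd) (@tpi_d)).

Lemma trunc_retE n x : trunc_inc n (trunc_ret n x) = tpi n x.
Proof. by []. Qed.

Lemma trunc_incK n x : trunc_ret n (trunc_inc n x) = x.
Proof. exact: rc_incK. Qed.
Lemma trunc_zero n : N < n -> is_zero (trunc n).
Proof. by move=> h; apply: rc_zero => x; exact: tpi_zero. Qed.
Lemma trunc_retK n x : n <= N -> trunc_inc n (trunc_ret n x) = x.
Proof. by move=> h; rewrite trunc_retE tpi_id. Qed.
Lemma trunc_retract n : retract (trunc n) (X n).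
Proof. exact: rc_retract. Qed.
Lemma trunc_dE n (x : trunc n) : n + 1 <= N ->
  trunc_inc (n + 1) (cd trunc n x) = cd X n (trunc_inc n x).
Proof. by move=> h; rewrite /trunc_inc rc_dE tpi_id. Qed.

Lemma trunc_bounded_above : bounded_above trunc.
Proof. by exists N => n; exact: trunc_zero. Qed.

(** Degree N itself is excluded, since there the cohomology of the truncation is a cokernel. *)
Lemma trunc_acyclic n : n + 1 < N -> acyclic_at X n -> acyclic_at trunc n.
Proof.
move=> hn aX x hx; have [|y hy] := aX (trunc_inc (n + 1) x).
  by rewrite -trunc_dE ?hx ?linear0 //; lia.
by exists (trunc_ret n y); rewrite -cmd hy trunc_incK.
Qed.

Lemma in_Kmb_trunc : in_Kmb X -> in_Kmb trunc.
Proof.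
move=> [pX bX [a [b hab]]]; split.
- by move=> n; exact: fg_projective_retract (trunc_retract n) (pX n).
- exact: trunc_bounded_above.
exists (Num.min a N), N => n [hn|hn].
  by apply: trunc_acyclic; [lia|apply: hab; lia].
by move=> x _; exists 0; rewrite linear0 (trunc_zero _ x) //; lia.
Qed.
End Truncation.

Definition Ktrunc N (X : Kob S) : Kob S := MkKob (in_Kmb_trunc N (kcxP X)).
Definition Kret N (X : Kob S) : chain_map X (Ktrunc N X) := trunc_ret N X.

End RetractComplex.

(** * Germs of chain maps *)

Section Germs.
Variable S : pzRingType.
Implicit Types X Y Z : Kob S.

(* The localization at the maps with perfect cone only sees a complex in very
   negative degrees. A germ commutes with the differentials below some degree, and
   germs are compared up to homotopies that are valid below some degree. *)
Record germ X Y := Germ {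
  gm :> forall n, {linear X n -> Y n};
  gmP : exists N : int, forall n, n < N -> forall x,
    gm (n + 1) (cd X n x) = cd Y n (gm n x) }.

Definition germ_eq X Y (f g : germ X Y) : Prop :=
  exists (N : int) (h : forall n, {linear X (n + 1) -> Y n}),
  forall n, n < N -> forall x,
    f (n + 1) x - g (n + 1) x = cd Y n (h n x) + h (n + 1) (cd X (n + 1) x).

Lemma germ_eq_ptw X Y (f g : germ X Y) (N : int) :
  (forall n, n < N -> forall x, f n x = g n x) -> germ_eq f g.
Proof.
move=> h; exists (N - 1), (fun n => \0) => n hn x.
by rewrite h ?subrr /= ?linear0 ?addr0 //; lia.
Qed.

Lemma germ_eq_refl X Y (f : germ X Y) : germ_eq f f.
Proof. exact: (@germ_eq_ptw _ _ f f 0). Qed.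
Lemma germ_eq_sym X Y (f g : germ X Y) : germ_eq f g -> germ_eq g f.
Proof.
move=> [N [h hh]]; exists N, (fun n => -%R \o h n) => n hn x.
by rewrite -opprB hh // opprD /= linearN.
Qed.
Lemma germ_eq_trans X Y (f g k : germ X Y) : germ_eq f g -> germ_eq g k -> germ_eq f k.
Proof.
move=> [N [h hh]] [N' [h' hh']]; exists (Num.min N N'), (fun n => h n \+ h' n) => n hn x.
rewrite /= linearD addrACA -hh -?hh'; [|lia|lia].
by rewrite addrA subrK.
Qed.

Fact germ_id_subproof X : exists N : int, forall n, n < N -> forall x : X n,
  (idfun (cd X n x)) = cd X n (idfun x).
Proof. by exists 0. Qed.
Definition germ_id X : germ X X := @Germ X X (fun n => idfun) (germ_id_subproof X).

Fact germ_comp_subproof X Y Z (g : germ Y Z) (f : germ X Y) :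
  exists N : int, forall n, n < N -> forall x,
    (g (n + 1) \o f (n + 1)) (cd X n x) = cd Z n ((g n \o f n) x).
Proof.
have [[N hN] [N' hN']] := (gmP g, gmP f).
exists (Num.min N N') => n hn x /=.
by rewrite hN' ?hN //; lia.
Qed.
Definition germ_comp X Y Z (g : germ Y Z) (f : germ X Y) : germ X Z :=
  @Germ X Z (fun n => g n \o f n) (germ_comp_subproof g f).

Lemma germ_eq_comp X Y Z (g g' : germ Y Z) (f f' : germ X Y) :
  germ_eq g g' -> germ_eq f f' -> germ_eq (germ_comp g f) (germ_comp g' f').
Proof.
move=> [N [h hh]] [N' [k hk]].
have [[M hM] [M' hM']] := (gmP f, gmP g').
exists (Num.min (Num.min N N') (Num.min (M - 1) M')).
exists (fun n => (h n \o f (n + 1)) \+ (g' n \o k n)) => n hn x /=.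
have -> : g (n + 1) (f (n + 1) x) =
    g' (n + 1) (f (n + 1) x) + (cd Z n (h n (f (n + 1) x)) + h (n + 1) (cd Y (n + 1) (f (n + 1) x))).
  rewrite -hh; last by lia.
  zmod.
have -> : g' (n + 1) (f (n + 1) x) =
    g' (n + 1) (f' (n + 1) x) + (g' (n + 1) (cd Y n (k n x)) + g' (n + 1) (k (n + 1) (cd X (n + 1) x))).
  rewrite -linearD -hk; last by lia.
  by rewrite linearB; zmod.
rewrite linearD hM'; last by lia.
rewrite hM; last by lia.
zmod.
Qed.

Definition gcat : category :=
  @Category (Kob S) germ germ_eq germ_id germ_comp germ_eq_refl germ_eq_sym germ_eq_trans germ_eq_comp
    (fun X Y f => germ_eq_refl f) (fun X Y f => germ_eq_refl f)
    (fun X Y Z W h g f => germ_eq_refl _).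

Fact germ_of_subproof X Y (f : chain_map X Y) : exists N : int, forall n, n < N -> forall x,
    f (n + 1) (cd X n x) = cd Y n (f n x).
Proof. by exists 0 => n _ x; exact: cmd. Qed.
Definition germ_of X Y (f : chain_map X Y) : germ X Y :=
  @Germ X Y (fun n => f n) (germ_of_subproof f).

Fact germ_of_eq X Y (f g : chain_map X Y) : homotopic f g -> germ_eq (germ_of f) (germ_of g).
Proof. by move=> [h hh]; exists 0, h => n _ x; exact: hh. Qed.

Definition gfun : functor (Kcat S) gcat :=
  @Functor (Kcat S) gcat id germ_of germ_of_eq
    (fun X => germ_eq_refl _) (fun X Y Z g f => germ_eq_refl _).

(** Contractibility near minus infinity. For complexes in K^{-,b}(proj) it is equivalent to
    perfectness, by [perfect_gcontr] and [gcontr_perfect]. *)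
Definition gcontr (X : complex S) : Prop :=
  exists (N : int) (h : forall n, {linear X (n + 1) -> X n}),
  forall n, n < N -> forall x, x = cd X n (h n x) + h (n + 1) (cd X (n + 1) x).

(** Read a contraction of the cone as a 2 by 2 matrix. The entry from Y to X is the inverse germ
    [t]; the entry from X to X gives the homotopy [a] from t s to the identity, and minus the entry
    from Y to Y gives the homotopy [k] from s t to the identity. *)
Lemma gcontr_cone_iso X Y (s : chain_map X Y) :
  gcontr (cone s) -> @is_iso gcat X Y (germ_of s).
Proof.
move=> [N [h hh]].
have l1 n : linear (fun x : X (n + 1) => (x, 0) : cone s n).
  by move=> a x y; congr (_, _); rewrite /= scaler0 addr0.
pose in1 n : {linear X (n + 1) -> cone s n} := mklinear (l1 n).
pose in2 n : {linear Y n -> cone s n} := cone_in s n.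
have h1 n : n < N -> forall x, (x, 0) = cd (cone s) n (h n (x, 0)) +
    (h (n + 1) (- cd X (n + 1 + 1) x, 0) + h (n + 1) (0, s (n + 1 + 1) x)).
  move=> hn x; rewrite -linearD [LHS]hh //.
  apply: (congr1 (fun u => cd (cone s) n _ + h (n + 1) u)); congr (_, _) => /=; first by zmod.
  by rewrite linear0; zmod.
have h2 n : n < N -> forall y, (0, y) = cd (cone s) n (h n (0, y)) + h (n + 1) (0, cd Y (n + 1) y).
  move=> hn y; rewrite [LHS]hh //.
  apply: (congr1 (fun u => cd (cone s) n _ + h (n + 1) u)); congr (_, _) => /=; rewrite linear0; zmod.
have [t ht] := @int_pred_family (fun n => {linear Y n -> X n}) (fun n => fst \o (h n \o in2 (n + 1))).
have [a ha] := @int_pred_family (fun n => {linear X (n + 1) -> X n}) (fun n => fst \o (h n \o in1 (n + 1))).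
pose k n : {linear Y (n + 1) -> Y n} := -%R \o (snd \o (h n \o in2 (n + 1))).
have tc : exists M : int, forall n, n < M -> forall y, t (n + 1) (cd Y n y) = cd X n (t n y).
  exists (N + 1); apply: int_succ_ind => n hn y; rewrite !ht /=.
  have /(congr1 fst) /= /esym/addr0_eq := h2 n ltac:(lia) y.
  by rewrite opprK.
exists (Germ tc); split.
- exists (N + 1), a; apply: int_succ_ind => n hn x.
  have /(congr1 fst) /= e := h1 n ltac:(lia) x.
  rewrite /= !ht !ha /= [in X in _ - X]e.
  have -> : (h (n + 1) (- cd X (n + 1 + 1) x, 0)).1 = - (h (n + 1) (cd X (n + 1 + 1) x, 0)).1.
    apply: (congr1 fst (etrans _ (linearN (h (n + 1)) _))).
    by apply: (congr1 (h (n + 1))); congr (_, _); rewrite /= oppr0.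
  zmod.
- exists N, k => n hn y.
  have /(congr1 snd) /= e := h2 n hn y.
  rewrite /= !ht /= [in X in _ - X]e linearN.
  by zmod.
Qed.

Lemma iso_gcontr_cone X Y (s : chain_map X Y) :
  @is_iso gcat X Y (germ_of s) -> gcontr (cone s).
Proof.
move=> [t [[N [a ha]] [M [k hk]]]]; have [L hL] := gmP t.
rewrite /= in ha hk.
exists (Num.min (Num.min (N - 1) (M - 1)) (L - 1)).
(* The obvious homotopy [h0 (x, y) = (a x + t y, - k y)] satisfies
   [d h0 + h0 d = 1 + phi] with [phi] (extended by zero) of square zero and
   commuting with [d], so [(1 - phi) h0] is a contraction. *)
pose phi n : {linear X (n + 1) -> Y n} := (s n \o a n) \- (k n \o s (n + 1)).
pose p1 n : {linear cone s n -> X (n + 1)} := fst.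
pose p2 n : {linear cone s n -> Y n} := snd.
pose u n : {linear cone s (n + 1) -> X (n + 1)} :=
  (a (n + 1) \o p1 (n + 1)) \+ (t (n + 1) \o p2 (n + 1)).
pose v n : {linear cone s (n + 1) -> Y n} :=
  (-%R \o (k n \o p2 (n + 1))) \- (phi n \o u n).
exists (fun n => lpair (u n) (v n)) => n hn [x y].
(* Both s a and k s are null homotopies of s t s - s, so their difference anticommutes with d. *)
have phid z : cd Y n (phi n z) = - phi (n + 1) (cd X (n + 1) z).
  have e1 : s (n + 1) (t (n + 1) (s (n + 1) z) - z) = s (n + 1) (cd X n (a n z) + a (n + 1) (cd X (n + 1) z)).
    by rewrite -ha //; lia.
  have := hk n ltac:(lia) (s (n + 1) z); move: e1.
  rewrite /= !linearB !linearD /= !cmd => e1 e2.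
  by apply: (eq_modulo e2); apply: (eq_modulo (esym e1)); zmod.
pose w : X (n + 1) := u n (x, y).
have hu : u (n + 1) (cd (cone s) (n + 1) (x, y)) = x + cd X (n + 1) w.
  have e := ha (n + 1) ltac:(lia) x.
  rewrite /w /= !linearN !linearD /= -hL; last by lia.
  by apply: (eq_modulo e); zmod.
congr (_, _).
  change (x = - cd X (n + 1) w + u (n + 1) (cd (cone s) (n + 1) (x, y))).
  by rewrite hu; zmod.
have e := hk n ltac:(lia) y.
have hphi : phi (n + 1) x = s (n + 1) (a (n + 1) x) - k (n + 1) (s (n + 1 + 1) x) by [].
have hw : s (n + 1) w = s (n + 1) (a (n + 1) x) + s (n + 1) (t (n + 1) y).
  by rewrite /w /= linearD.
change (y = s (n + 1) w + cd Y n (- k n y - phi n w)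
  + (- k (n + 1) (s (n + 1 + 1) x + cd Y (n + 1) y)
     - phi (n + 1) (u (n + 1) (cd (cone s) (n + 1) (x, y))))).
rewrite hu hw linearB (phid w); clearbody phi w.
rewrite (linearN (cd Y n)) (linearD (k (n + 1))) (linearD (phi (n + 1))) hphi; apply: (eq_modulo (esym e)); zmod.
Qed.

(** The zigzag to the bounded complex B becomes a homotopy equivalence. Where B vanishes, the
    composite X -> B -> X is zero, and its homotopy to the identity is a contraction up to sign. *)
Lemma perfect_gcontr (X : Kob S) : perfect X -> gcontr X.
Proof.
move=> [B [pB [a [b hab]] qB]]; have [pX bX _] := kcxP X.
have bB : bounded_above B by exists b => n hn; apply: hab; right.
have [f [g [_ [h hh]]]] := quasi_isomorphic_equiv (fun n => (pB n).2) bB (fun n => (pX n).2) bX qB.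
exists (a - 1), (fun n => -%R \o h n) => n hn x.
have := hh n x; rewrite /= (hab (n + 1) _ (g (n + 1) x)); last by lia.
by rewrite linear0 sub0r linearN => e; apply: (eq_modulo (esym e)); zmod.
Qed.

(* The bounded complex is the image of the idempotent chain map that is the
   identity in large degrees, [h d] in one degree and zero below. *)
Lemma gcontr_retract (X : complex S) : in_Kmb X -> gcontr X ->
  exists (B : complex S) (r : chain_map X B),
    [/\ forall n, fg_projective (B n), bounded B & quasi_iso r].
Proof.
move=> [pX [b hb] _] [N [h hh]]; pose n0 := N - 1.
pose p n : {linear X n -> X n} :=
  if n0 < n then (idfun : {linear X n -> X n})
  else if n == n0 then (h n \o cd X n : {linear X n -> X n})
  else (\0 : {linear X n -> X n}).
have p1 n x : n0 < n -> p n x = x by rewrite /p => ->.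
have p2 n x : n = n0 -> p n x = h n (cd X n x).
  by move=> e; rewrite /p; case: ifP; [lia|move=> _; case: eqP].
have p3 n x : n < n0 -> p n x = 0.
  by move=> hn; rewrite /p; case: ifP; [lia|move=> _; case: eqP => //; lia].
(* On boundaries the contraction reduces to d h = 1; hence h d is idempotent in degree [n0]. *)
have dhd n x : n < N -> cd X n (h n (cd X n x)) = cd X n x.
  by move=> hn; have := hh n hn (cd X n x); rewrite cdd linear0 addr0.
have tri n : [\/ n0 < n, n = n0 | n < n0].
  have [h1|h1] := boolP (n0 < n); first exact: Or31.
  by have [h2|h2] := eqVneq n n0; [exact: Or32|apply: Or33; lia].
have pK n x : p n (p n x) = p n x.
  case: (tri n) => hn; [by rewrite !p1| |by rewrite !p3].
  by rewrite !(p2 n) // dhd //; lia.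
have pc n x : p (n + 1) (cd X n (p n x)) = cd X n (p n x).
  case: (tri n) => hn; first by rewrite p1 //; lia.
    by rewrite (p2 n) // p1 //; lia.
  by rewrite (p3 n) // !linear0.
have pd n x : p (n + 1 + 1) (cd X (n + 1) (p (n + 1) (cd X n (p n x)))) = 0.
  by rewrite !pc cdd.
have pr n x : p (n + 1) (cd X n (p n x)) = p (n + 1) (cd X n x).
  case: (tri n) => hn; first by rewrite (p1 n).
    by rewrite (p2 n) // dhd //; lia.
  rewrite (p3 n) // !linear0; case: (tri (n + 1)) => hn1; first by lia.
    by rewrite p2 // cdd linear0.
  by rewrite p3.
exists (rc pK pd), (@ChainMap S X (rc pK pd) (rc_ret pK) (rc_ret_chain pK pd pr)); split.
- by move=> n; exact: fg_projective_retract (rc_retract pK pd n) (pX n).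
- exists n0, b => n [hn|hn]; apply: rc_zero => x; first exact: p3.
  by rewrite (hb n _ x) ?linear0 //; lia.
move=> n; split=> [x hx [y hy]|y hy].
  suff [z hz] : exists z, x - p (n + 1) x = cd X n z.
    exists (z + rc_inc p n y); rewrite linearD -hz -(rc_inc_chain pc) hy.
    exact: subrK.
  have [hn|hn] := boolP (n0 < n + 1).
    by exists 0; rewrite p1 // subrr linear0.
  exists (h n x); have hnN : n < N by lia.
  have -> : p (n + 1) x = 0.
    by case: (tri (n + 1)) => h1; [lia|rewrite p2 // hx linear0|rewrite p3].
  by have := hh n hnN x; rewrite hx linear0 addr0 => <-; rewrite subr0.
exists (rc_inc p (n + 1) y); first by rewrite -(rc_inc_chain pc) hy linear0.
by exists 0; rewrite linear0; apply/eqP; rewrite subr_eq0 eq_sym; apply/eqP; exact: rc_incK.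
Qed.

Lemma gcontr_perfect (X : complex S) : in_Kmb X -> gcontr X -> perfect X.
Proof.
move=> kX cX; have [B [r [pB bB qr]]] := gcontr_retract kX cX.
by exists B; split=> //; apply: rst_sym; apply: rst_step; exists r.
Qed.

(** The maps inverted in the singularity category are thus exactly those that become invertible as
    germs. *)
Lemma perfect_cone_iff X Y (s : chain_map X Y) :
  perfect (cone s) <-> @is_iso gcat X Y (germ_of s).
Proof.
split=> [pc|/iso_gcontr_cone]; first exact/gcontr_cone_iso/(perfect_gcontr (X := Kcone s)).
exact/gcontr_perfect/(kcxP (Kcone s)).
Qed.

Fact trunc_germ_subproof N X : exists M : int, forall n, n < M -> forall x : trunc N X n,
  trunc_inc N X (n + 1) (cd (trunc N X) n x) = cd X n (trunc_inc N X n x).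
Proof. by exists N => n hn x; rewrite trunc_dE //; lia. Qed.
(** The inclusion of a truncation is a germ although it need not be a chain map; it inverts the
    projection. *)
Definition trunc_germ N X : germ (Ktrunc N X) X :=
  @Germ (Ktrunc N X) X (trunc_inc N X) (trunc_germ_subproof N X).

Lemma trunc_germK N X : germ_eq (germ_comp (germ_of (Kret N X)) (trunc_germ N X)) (germ_id (Ktrunc N X)).
Proof. by apply: (@germ_eq_ptw _ _ _ _ 0) => n _ x; exact: trunc_incK. Qed.
Lemma trunc_germKV N X : germ_eq (germ_comp (trunc_germ N X) (germ_of (Kret N X))) (germ_id X).
Proof. by apply: (@germ_eq_ptw _ _ _ _ N) => n hn x; apply: trunc_retK; lia. Qed.

Lemma trunc_perfect_cone N X : @perfect_cone S X (Ktrunc N X) (Kret N X).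
Proof.
apply/perfect_cone_iff; exists (trunc_germ N X); split; first exact: trunc_germKV.
exact: trunc_germK.
Qed.

(* Truncating the target makes a germ an honest chain map. *)
Lemma germ_real X Y (g : germ X Y) :
  exists N (f : chain_map X (Ktrunc N Y)),
    germ_eq (germ_of f) (germ_comp (germ_of (Kret N Y)) g).
Proof.
have [N hN] := gmP g; exists N.
have fd n x : trunc_ret N Y (n + 1) (g (n + 1) (cd X n x)) =
    cd (trunc N Y) n (trunc_ret N Y n (g n x)).
  have [hn|hn] := boolP (n < N); first by rewrite hN // cmd.
  rewrite [LHS](trunc_zero _); first by rewrite [RHS](trunc_zero _) //; lia.
  by lia.
exists (@ChainMap S X (Ktrunc N Y) (fun n => trunc_ret N Y n \o g n) fd).
exact: germ_eq_refl.
Qed.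

(** Truncating Y at the degree up to which the germ homotopy is valid makes the homotopy identity
    trivial above that degree. *)
Lemma germ_coin X Y (f g : chain_map X Y) : germ_eq (germ_of f) (germ_of g) ->
  exists N, homotopic (cm_comp (Kret N Y) f) (cm_comp (Kret N Y) g).
Proof.
move=> [N [h hh]]; exists N, (fun n => trunc_ret N Y n \o h n) => n x.
have [hn|hn] := boolP (n < N).
  have := congr1 (trunc_ret N Y (n + 1)) (hh n hn x).
  by rewrite linearB linearD cmd.
by rewrite [LHS](trunc_zero _) ?[RHS](trunc_zero _) //; lia.
Qed.
End Germs.

(** * Calculus of fractions *)

#[global] Instance heq_equivalence (C : category) (X Y : C) : Equivalence (@heq C X Y).
Proof.
split; first exact: heq_refl.
- exact: heq_sym.
- exact: heq_trans.
Qed.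

#[global] Instance comp_proper (C : category) (X Y Z : C) :
  Proper (@heq C Y Z ==> @heq C X Y ==> @heq C X Z) (@comp C X Y Z).
Proof. by move=> g g' hg f f' hf; exact: comp_heq. Qed.

#[global] Instance fmor_proper (C D : category) (F : functor C D) (X Y : C) :
  Proper (@heq C X Y ==> @heq D (F X) (F Y)) (@fmor C D F X Y).
Proof. by move=> f f' hf; exact: fmor_heq. Qed.

#[local] Hint Resolve heq_refl : core.

Section Isos.
Variable C : category.
Implicit Types X Y Z : C.

Lemma is_iso_id X : is_iso (idm X).
Proof. by exists (idm X); split; exact: comp_idl. Qed.

Lemma is_iso_comp X Y Z (g : hom Y Z) (f : hom X Y) :
  is_iso g -> is_iso f -> is_iso (g \oc f).
Proof.
move=> [g' [g'g gg']] [f' [f'f ff']]; exists (f' \oc g'); split.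
  by rewrite comp_assoc -(comp_assoc f' g' g) g'g comp_idr f'f.
by rewrite comp_assoc -(comp_assoc g f f') ff' comp_idr gg'.
Qed.

Lemma is_iso_heq X Y (f g : hom X Y) : f =~= g -> is_iso f -> is_iso g.
Proof. by move=> fg [f' [h1 h2]]; exists f'; rewrite -fg; split. Qed.

Lemma iso_cancel X Y Z (s : hom Y Z) (f g : hom X Y) :
  is_iso s -> s \oc f =~= s \oc g -> f =~= g.
Proof.
move=> [t [ts _]] e; rewrite -(comp_idl f) -(comp_idl g) -ts.
by rewrite -!comp_assoc e.
Qed.

Lemma iso_cancelr X Y Z (s : hom X Y) (f g : hom Y Z) :
  is_iso s -> f \oc s =~= g \oc s -> f =~= g.
Proof.
move=> [t [_ st]] e; rewrite -(comp_idr f) -(comp_idr g) -st.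
by rewrite !comp_assoc e.
Qed.

End Isos.

Lemma fmor_iso (C D : category) (F : functor C D) (X Y : C) (f : hom X Y) :
  is_iso f -> is_iso (fmor F f).
Proof.
by move=> [g [gf fg]]; exists (fmor F g); split; rewrite -fmor_comp ?gf ?fg fmor_id.
Qed.

Section LocExt.
Variables (C D : category) (G : functor C D) (S : forall X Y : C, hom X Y -> Prop).
Hypothesis GS : forall X Y (s : hom X Y), S s -> is_iso (fmor G s).

Definition loc_inv X Y (s : hom X Y) (hs : S s) : hom (G Y) (G X) := sval (cid (GS hs)).
Lemma loc_invl X Y (s : hom X Y) (hs : S s) : loc_inv hs \oc fmor G s =~= idm (G X).
Proof. by rewrite /loc_inv; case: (cid _) => t []. Qed.
Lemma loc_invr X Y (s : hom X Y) (hs : S s) : fmor G s \oc loc_inv hs =~= idm (G Y).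
Proof. by rewrite /loc_inv; case: (cid _) => t []. Qed.

Fixpoint loc_ext_mor X Y (p : lhom S X Y) : hom (G X) (G Y) :=
  match p with
  | lof _ _ f => fmor G f
  | linv _ _ s hs => loc_inv hs
  | lcomp _ _ _ q p => loc_ext_mor q \oc loc_ext_mor p
  end.

Fact loc_ext_leq X Y (p q : lhom S X Y) : leq p q -> loc_ext_mor p =~= loc_ext_mor q.
Proof.
elim=> {X Y p q} /= [X Y p|X Y p q _ h|X Y p q r _ h1 _ h2|X Y Z q q' p p' _ h1 _ h2|
  X Y Z W r q p|X Y p|X Y p|X Y f g h|X Y Z g f|X Y s hs|X Y s hs].
- reflexivity.
- by rewrite h.
- by rewrite h1.
- by rewrite h1 h2.
- exact: comp_assoc.
- by rewrite fmor_id comp_idl.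
- by rewrite fmor_id comp_idr.
- exact: fmor_heq.
- exact: fmor_comp.
- by rewrite fmor_id; exact: loc_invl.
- by rewrite fmor_id; exact: loc_invr.
Qed.

Definition loc_ext : functor (loc S) D :=
  @Functor (loc S) D G loc_ext_mor loc_ext_leq
    (fun X => fmor_id G X) (fun X Y Z g f => heq_refl _).

Lemma loc_iso X Y (s : hom X Y) : S s -> @is_iso (loc S) X Y (lof S s).
Proof. by move=> hs; exists (linv hs); split; [exact: leq_invl|exact: leq_invr]. Qed.

Hypothesis S_iso : forall X Y (s : hom X Y), is_iso (fmor G s) -> S s.
Hypothesis G_roof : forall X Y (g : hom (G X) (G Y)), exists Z (t : hom Y Z) (f : hom X Z),
  S t /\ fmor G f =~= fmor G t \oc g.
Hypothesis G_coin : forall X Y (f g : hom X Y), fmor G f =~= fmor G g ->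
  exists Z (t : hom Y Z), S t /\ t \oc f =~= t \oc g.

Lemma calc_comp X Y Z (g : hom Y Z) (f : hom X Y) : S g -> S f -> S (g \oc f).
Proof.
move=> hg hf; apply: S_iso; apply: is_iso_heq (heq_sym (fmor_comp G g f)) _.
by apply: is_iso_comp; exact: GS.
Qed.

(** [G_roof] realizes f s^-1, formed in D, by a fraction. The resulting square commutes only after
    G, and [G_coin] repairs this by one more map of S. *)
Lemma calc_ore X Y Z (s : hom X Y) (f : hom X Z) : S s ->
  exists W (t : hom Z W) (f' : hom Y W), S t /\ f' \oc s =~= t \oc f.
Proof.
move=> hs.
have [W [t [f' [ht e]]]] := G_roof (fmor G f \oc loc_inv hs).
have [|V [u [hu eu]]] := @G_coin X W (f' \oc s) (t \oc f).
  by rewrite !fmor_comp e -!comp_assoc loc_invl comp_idr.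
exists V, (u \oc t), (u \oc f'); split; first exact: calc_comp.
by rewrite -!comp_assoc.
Qed.

Local Notation L := (loc S).

Lemma lof_comp (X Y Z : C) (g : hom Y Z) (f : hom X Y) :
  (lof S (g \oc f) : @hom L X Z) =~= @comp L X Y Z (lof S g) (lof S f).
Proof. exact: leq_comp. Qed.

(** Every formal composite is a left fraction s^-1 f: induction on the composite, with the Ore
    condition moving inverses to the left. *)
Lemma loc_roof (X Y : C) (p : @hom L X Y) :
  exists (Z : C) (s : @hom C Y Z) (f : @hom C X Z),
  S s /\ @comp L X Y Z (lof S s) p =~= (lof S f : @hom L X Z).
Proof.
elim: p => {X Y} [X Y f|X Y t ht|X Y Z q [Z' [s [f [hs e]]]] p [Y' [s' [g [hs' e']]]]].
- exists Y, (idm Y), f; split; last exact: leq_idl.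
  apply: S_iso; apply: is_iso_heq (heq_sym (fmor_id G Y)) _; exact: is_iso_id.
- have [W [u [f' [hu e]]]] := calc_ore (idm X) ht.
  exists W, u, f'; split=> //.
  apply: (@iso_cancelr L _ _ _ (lof S t)); first exact: loc_iso.
  apply: leq_trans (leq_sym (leq_assoc _ _ _)) _.
  apply: leq_trans (leq_cong (leq_refl _) (leq_invl ht)) _.
  apply: leq_trans (leq_idr _) _; apply: leq_trans (leq_comp S f' t).
  by apply: leq_of; rewrite e comp_idr.
- have [W [t [f' [ht eo]]]] := calc_ore f hs'.
  exists W, (t \oc s), (f' \oc g); split; first exact: calc_comp.
  change (@comp L X Z W (lof S (t \oc s)) (@comp L X Y Z q p) =~= (lof S (f' \oc g) : @hom L X W)).
  have e3 : @comp L Y Y' W (lof S f') (lof S s') =~= @comp L Y Z' W (lof S t) (lof S f).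
    apply: leq_trans (leq_sym (leq_comp S _ _)) _.
    by apply: leq_trans (leq_comp S _ _); exact: leq_of.
  rewrite !lof_comp -e' comp_assoc -(@comp_assoc L _ _ _ _ (lof S t)) e.
  by rewrite comp_assoc e3.
Qed.

(** For faithfulness, write both morphisms as fractions over a common denominator; their numerators
    agree under G, hence after one further map of S. Fullness is [G_roof]. *)
Lemma loc_ext_ff : fully_faithful loc_ext.
Proof.
move=> X Y; split=> [p q epq|g].
  have [Z [s [f [hs e]]]] := loc_roof p; have [Z' [s' [f' [hs' e']]]] := loc_roof q.
  have [W [t [t' [ht eo]]]] := calc_ore s' hs.
  have et : (lof S (t' \oc s) : @hom L Y W) =~= lof S (t \oc s') by exact: leq_of.
  have e1 : @comp L X Y W (lof S (t' \oc s)) p =~= lof S (t' \oc f).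
    rewrite lof_comp lof_comp -e.
    by rewrite (comp_assoc (c := L)).
  have e2 : @comp L X Y W (lof S (t \oc s')) q =~= lof S (t \oc f').
    rewrite lof_comp lof_comp -e'.
    by rewrite (comp_assoc (c := L)).
  have eG : fmor G (t' \oc f) =~= fmor G (t \oc f').
    have g1 := loc_ext_leq e1; have g2 := loc_ext_leq e2; move: g1 g2 => /= <- <-.
    by rewrite (epq : loc_ext_mor p =~= loc_ext_mor q) eo.
  have [V [u [hu eu]]] := G_coin eG.
  have hts : S (u \oc (t \oc s')) by do !apply: calc_comp.
  apply: (@iso_cancel L _ _ _ (lof S (u \oc (t \oc s')))); first exact: loc_iso.
  rewrite lof_comp -!(comp_assoc (c := L)) -{1}et e1 e2.
  rewrite -lof_comp -lof_comp.
  exact: leq_of.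
have [Z [t [f [ht e]]]] := G_roof g.
exists (lcomp (linv ht) (lof S f)) => /=.
by rewrite e comp_assoc loc_invl comp_idl.
Qed.
End LocExt.

(** * Modules over the corner ring *)

Section CornerModules.
Variables (R : pzRingType) (e : R) (he : e * e = e).
Local Notation C := (corner he).
Implicit Types N : lmodType C.

Fact ecut_subproof (x : Re he) : e * Re_val x \in corner_pred e.
Proof. by rewrite inE mulrA he -mulrA Re_e. Qed.
Definition ecut (x : Re he) : C := MkCorner he (ecut_subproof x).

Fact Re_unit_subproof : e \in Re_pred e.
Proof. by rewrite inE he. Qed.
Definition Re_unit : Re_right he := MkRe he Re_unit_subproof.

Lemma ecut_unit : ecut Re_unit = 1.
Proof. by apply: val_inj; rewrite /= he. Qed.

Lemma scale_pure N (r : R) (x : Re_right he) (n : N) :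
  r *: (pure x n : ilambda N) = pure (Re_scale r x : Re_right he) n.
Proof. exact: tens_map_pure. Qed.

(** The copy e (x) N of N generates Re (x) N over R, because x = x e for x in Re. *)
Lemma pureE N (x : Re_right he) (n : N) :
  pure x n = Re_val x *: (pure Re_unit n : ilambda N).
Proof. by rewrite scale_pure; congr (pure _ _); apply: val_inj; rewrite /= Re_e. Qed.

Lemma pure_cornerE N (a : C) (n : N) :
  pure Re_unit (a *: n) = corner_val a *: (pure Re_unit n : ilambda N).
Proof.
rewrite -pure_bal scale_pure; congr (pure _ _); apply: val_inj => /=.
by rewrite corner_e e_corner.
Qed.

(** The map x (x) n -> (e x) n. By [mu_unit] and [pure_mu] it identifies e (Re (x) N) with N, with
    inverse n -> e (x) n. *)
Fact mu_subproof N : exists f : tens (Re_right he) N -> N,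
  {morph f : s t / s + t} /\ forall x n, f (pure x n) = ecut x *: n.
Proof.
apply: tens_universal => [x x' n|x n n'|x a n].
- by rewrite -scalerDl; congr (_ *: _); apply: val_inj; rewrite /= mulrDr.
- exact: scalerDr.
- by rewrite scalerA; congr (_ *: _); apply: val_inj; rewrite /= mulrA.
Qed.
Definition mu N : ilambda N -> N := sval (cid (mu_subproof N)).
Lemma muD N : {morph @mu N : s t / s + t}.
Proof. by rewrite /mu; case: (cid _) => f []. Qed.
Lemma mu_pure N x (n : N) : mu (pure x n) = ecut x *: n.
Proof. by rewrite /mu; case: (cid _) => f []. Qed.
Lemma mu0 N : mu (0 : ilambda N) = 0.
Proof. by apply: (addrI (mu (0 : ilambda N))); rewrite -muD !addr0. Qed.

Lemma mu_unit N (n : N) : mu (pure Re_unit n) = n.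
Proof. by rewrite mu_pure ecut_unit scale1r. Qed.

Lemma mu_scale N (a : C) (t : ilambda N) : mu (corner_val a *: t) = a *: mu t.
Proof.
elim/pureW: t => [|x n t ih]; first by rewrite scaler0 mu0 scaler0.
rewrite scalerDr !muD scalerDr ih scale_pure !mu_pure scalerA; congr (_ *: _ + _).
by apply: val_inj; rewrite /= !mulrA e_corner corner_e.
Qed.

Lemma pure_mu N (t : ilambda N) : e *: t = pure Re_unit (mu t).
Proof.
elim/pureW: t => [|x n t ih]; first by rewrite scaler0 mu0 pure0r.
rewrite scalerDr ih muD pureDr scale_pure mu_pure; congr (_ + _).
rewrite -pure_bal; congr (pure _ _); apply: val_inj => /=.
by rewrite mulrA he.
Qed.

Section Descend.
Variables (N N' : lmodType C) (f : {linear ilambda N -> ilambda N'}).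
Fact descend_linear : linear (fun n => mu (f (pure Re_unit n))).
Proof.
move=> a x y; rewrite pureDr pure_cornerE linearD linearZ /=.
by rewrite muD mu_scale.
Qed.
(** By R-linearity f carries e (x) N into e (Re (x) N'), which [mu] identifies with N'. This is the
    fullness of Re (x) - on modules. *)
Definition descend : {linear N -> N'} := mklinear descend_linear.
Lemma descendE t : ilambda_map descend t = f t.
Proof.
apply: ilambda_ext t => x n.
rewrite ilambda_map_pure [LHS]pureE [descend n]/=.
apply: etrans (congr1 (fun u : ilambda N' => Re_val x *: u) (esym (pure_mu _))) _.
by rewrite scalerA Re_e -linearZ; congr (f _); rewrite -[LHS]pureE.
Qed.
End Descend.

Section Emod.
Variable M : lmodType R.
Fact emod_closed : zmod_closed [pred m : M | e *: m == m].
Proof.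
split=> [|x y]; rewrite !inE ?scaler0 // => /eqP hx /eqP hy.
by rewrite scalerBr hx hy.
Qed.
Definition emod_pred : {pred M} := [pred m : M | e *: m == m].
HB.instance Definition _ := GRing.isZmodClosed.Build M emod_pred emod_closed.
(** The eRe-module eM. The functor M -> eM is right adjoint to Re (x) -, and [eps] below is the
    counit x (x) m -> x m. *)
Record emod := MkEmod { emod_val : M; emodP : emod_val \in emod_pred }.
HB.instance Definition _ := [isSub of emod for emod_val].
HB.instance Definition _ := [Choice of emod by <:].
HB.instance Definition _ := [SubChoice_isSubZmodule of emod by <:].

Lemma emod_e (m : emod) : e *: emod_val m = emod_val m.
Proof. exact/eqP/emodP. Qed.

Fact emod_scale_subproof (a : C) (m : emod) : corner_val a *: emod_val m \in emod_pred.
Proof. by rewrite inE scalerA e_corner. Qed.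
Definition emod_scale (a : C) (m : emod) : emod := MkEmod (emod_scale_subproof a m).
Fact emod_scaleA a b v : emod_scale a (emod_scale b v) = emod_scale (a * b) v.
Proof. by apply: val_inj; rewrite /= scalerA. Qed.
Fact emod_scale1 : left_id 1 emod_scale.
Proof. by move=> x; apply: val_inj; rewrite /= emod_e. Qed.
Fact emod_scaleDr : right_distributive emod_scale +%R.
Proof. by move=> a x y; apply: val_inj; rewrite /= scalerDr. Qed.
Fact emod_scaleDl v : {morph emod_scale^~ v : a b / a + b}.
Proof. by move=> a b; apply: val_inj; rewrite /= scalerDl. Qed.
HB.instance Definition _ := GRing.Zmodule_isLmodule.Build C emod
  emod_scaleA emod_scale1 emod_scaleDr emod_scaleDl.

Fact ecorner_subproof (m : M) : e *: m \in emod_pred.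
Proof. by rewrite inE scalerA he. Qed.
Definition ecorner (m : M) : emod := MkEmod (ecorner_subproof m).

Fact eps_subproof : exists f : tens (Re_right he) emod -> M,
  {morph f : s t / s + t} /\ forall x n, f (pure x n) = Re_val x *: emod_val n.
Proof.
apply: tens_universal => [x x' n|x n n'|x a n].
- exact: scalerDl.
- exact: scalerDr.
- by rewrite /= scalerA.
Qed.
Definition eps_fun : ilambda emod -> M := sval (cid eps_subproof).
Lemma eps_funD : {morph eps_fun : s t / s + t}.
Proof. by rewrite /eps_fun; case: (cid _) => f []. Qed.
Lemma eps_fun_pure x n : eps_fun (pure x n) = Re_val x *: emod_val n.
Proof. by rewrite /eps_fun; case: (cid _) => f []. Qed.
Fact eps_linear : linear eps_fun.
Proof.
move=> r s t; rewrite eps_funD; congr (_ + _).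
have e0 : eps_fun 0 = 0 by apply: (addrI (eps_fun 0)); rewrite -eps_funD !addr0.
elim/pureW: s => [|x n s ih]; first by rewrite scaler0 e0 scaler0.
by rewrite scalerDr !eps_funD scalerDr ih scale_pure !eps_fun_pure scalerA.
Qed.
Definition eps : {linear ilambda emod -> M} := mklinear eps_linear.

End Emod.

Section EmodMap.
Variables (M M' : lmodType R) (f : {linear M -> M'}).
Fact emod_map_subproof (m : emod M) : f (emod_val m) \in emod_pred (M := M').
Proof. by rewrite inE -linearZ /= emod_e. Qed.
Fact emod_map_linear : linear (fun m => MkEmod (emod_map_subproof m)).
Proof. by move=> a x y; apply: val_inj; rewrite [LHS]/= linearD linearZ. Qed.
Definition emod_map : {linear emod M -> emod M'} := mklinear emod_map_linear.

End EmodMap.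

Lemma eps_natural (M M' : lmodType R) (f : {linear M -> M'}) t :
  eps M' (ilambda_map (emod_map f) t) = f (eps M t).
Proof.
apply: (ilambda_ext (f := eps M' \o ilambda_map (emod_map f)) (g := f \o eps M)) => x n.
by rewrite [LHS]/= tens_map_pure eps_fun_pure [RHS]/= eps_fun_pure linearZ.
Qed.

(** Transposition along the adjunction: f corresponds to a map N -> eB, and eA -> eB remains
    surjective because e can be applied to a preimage. *)
Lemma projective_ilambda N : projective N -> projective (ilambda N).
Proof.
move=> pN A B g f sg.
have l : linear (fun n => ecorner (f (pure Re_unit n))).
  move=> a x y; apply: val_inj => /=.
  rewrite pureDr linearD pure_cornerE linearZ /= scalerDr; congr (_ + _).
  by rewrite scalerA e_corner [RHS]scalerA corner_e.
have [|h hh] := pN _ _ (emod_map g) (mklinear l).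
  move=> b; have [a ha] := sg (emod_val b).
  exists (ecorner a); apply: val_inj; rewrite /= linearZ /= ha; exact: emod_e.
exists (eps A \o ilambda_map h).
apply: (ilambda_ext (f := g \o (eps A \o ilambda_map h)) (g := f)) => x n.
rewrite /= tens_map_pure eps_fun_pure linearZ /=.
have /(congr1 val) /= -> := hh n; rewrite scalerA Re_e -linearZ /=; congr (f _).
by rewrite [RHS]pureE.
Qed.

Lemma fin_gen_ilambda N : fin_gen N -> fin_gen (ilambda N).
Proof.
move=> [n [g hg]]; exists n, (fun i => pure Re_unit (g i)).
elim/pureW=> [|x m t [c hc]].
  by exists (fun _ => 0); rewrite big1 // => i _; rewrite scale0r.
have [c' hc'] := hg m; exists (fun i => Re_val x * corner_val (c' i) + c i).
rewrite hc pureE hc'; under [RHS]eq_bigr do rewrite scalerDl.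
rewrite big_split /=; congr (_ + _).
rewrite (big_morph (fun m => pure Re_unit m) (id1 := 0) (op1 := +%R)).
- by rewrite scaler_sumr; apply: eq_bigr => i _; rewrite pure_cornerE scalerA.
- exact: pureDr.
- exact: pure0r.
Qed.

Lemma fg_projective_ilambda N : fg_projective N -> fg_projective (ilambda N).
Proof. by move=> [fN pN]; split; [exact: fin_gen_ilambda|exact: projective_ilambda]. Qed.

End CornerModules.

(** * Tensor products and acyclicity *)

Section FreeModule.
Variables (Q : pzRingType) (P : lmodType Q).
Local Notation F := (P -> Q^o).

(** The free module on the underlying set of P, realized inside all functions on P. *)
Definition fin_supp (f : F) : Prop := exists s : seq P, forall i, i \notin s -> f i = 0.

Fact fin_supp_submodule : submodule fin_supp.
Proof.
split; first by exists [::].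
- move=> f g [s hs] [s' hs']; exists (s ++ s') => i.
  rewrite mem_cat negb_or => /andP[h h'].
  by rewrite -[(f + g) i]/(f i + g i) hs // hs' // addr0.
- move=> a f [s hs]; exists s => i h.
  by rewrite -[(a *: f) i]/(a *: f i) hs // scaler0.
Qed.

Lemma big_supp (f : F) (s s' : seq P) : uniq s -> uniq s' ->
  (forall i, i \notin s -> f i = 0) -> (forall i, i \notin s' -> f i = 0) ->
  \sum_(i <- s) (f i : Q) *: i = \sum_(i <- s') (f i : Q) *: i.
Proof.
move=> us us' hs hs'.
have red r : \sum_(i <- r) (f i : Q) *: i = \sum_(i <- [seq i <- r | f i != 0]) (f i : Q) *: i.
  rewrite big_filter [LHS](bigID (fun i => f i != 0)) /= [X in _ + X]big1 ?addr0 //.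
  by move=> i /negPn/eqP ->; rewrite scale0r.
rewrite red [RHS]red; apply: perm_big; apply: uniq_perm; rewrite ?filter_uniq // => i.
rewrite !mem_filter; case: eqP => //= fi.
by apply/idP/idP => _; [have := hs' i|have := hs i]; case: (i \in _) => // h; case: fi; apply: h.
Qed.

Local Notation free := (subm fin_supp_submodule).
Local Notation inc := (sinc fin_supp_submodule).

Definition supp (f : free) : seq P := undup (sval (cid (sincP f))).
Lemma suppP (f : free) i : i \notin supp f -> inc f i = 0.
Proof. by rewrite /supp mem_undup; case: (cid _) => s /= hs; exact: hs. Qed.

Definition free_sum (f : free) : P := \sum_(i <- supp f) (inc f i : Q) *: i.
Lemma free_sumE (f : free) (s : seq P) : uniq s -> {subset supp f <= s} ->
  free_sum f = \sum_(i <- s) (inc f i : Q) *: i.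
Proof.
move=> us hs; apply: big_supp => //; first exact: undup_uniq.
  exact: suppP.
by move=> i hi; apply: suppP; apply: contra hi; exact: hs.
Qed.

Fact free_sum_linear : linear free_sum.
Proof.
move=> a f g; pose s := undup (supp (a *: f + g) ++ (supp f ++ supp g)).
have us : uniq s by exact: undup_uniq.
rewrite !(@free_sumE _ s) //; try by move=> i hi; rewrite mem_undup !mem_cat hi ?orbT.
rewrite scaler_sumr -big_split; apply: eq_bigr => i _ /=.
by rewrite scalerA -scalerDl.
Qed.

(** The dual basis lemma without finite generation. The sum is finite for each p, and is stated for
    every duplicate-free list containing a suitable support, so that several elements can share one
    index list. *)
Lemma projective_dual_basis : projective P ->
  exists c : P -> {linear P -> Q^o}, forall p, exists s0 : seq P,
    forall s, uniq s -> {subset s0 <= s} -> p = \sum_(i <- s) (c i p : Q) *: i.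
Proof.
move=> pP; have [|h hh] := pP _ _ (mklinear free_sum_linear) idfun.
  move=> p; have fp : fin_supp (fun i => (i == p)%:R : Q^o).
    by exists [:: p] => i; rewrite inE => /negbTE ->.
  exists (smk fin_supp_submodule fp) => /=.
  have us : uniq (undup (p :: supp (smk fin_supp_submodule fp))) by exact: undup_uniq.
  rewrite (free_sumE us); last by move=> i hi; rewrite mem_undup inE hi orbT.
  rewrite (bigD1_seq p) ?mem_undup ?mem_head //= eqxx scale1r big1 ?addr0 //.
  by move=> i /negbTE ->; rewrite scale0r.
have le i : linear (fun p => inc (h p) i : Q^o).
  by move=> a x y; rewrite !linearP.
exists (fun i => mklinear (le i)) => p; exists (supp (h p)) => s us hs.
by rewrite -[LHS]hh /= (free_sumE us hs).
Qed.
End FreeModule.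

Section TensorMaps.
Variables (S : pzRingType).
Implicit Types (M K P : lmodType S^c) (N : lmodType S).

Lemma tens_ext M N (A : zmodType) (f g : tens M N -> A) :
  {morph f : s t / s + t} -> {morph g : s t / s + t} ->
  (forall x n, f (pure x n) = g (pure x n)) -> forall t, f t = g t.
Proof.
move=> fD gD h.
have z (k : tens M N -> A) : {morph k : s t / s + t} -> k 0 = 0.
  by move=> kD; apply: (addrI (k 0)); rewrite -kD !addr0.
elim/pureW=> [|x n t ih]; first by rewrite !z.
by rewrite fD gD h ih.
Qed.

Section LeftContraction.
Variables (M : lmodType S^c) (c : {linear M -> (S^c)^o}).
(** Contraction against a functional on the left factor. With a dual basis, the contractions serve
    as coordinates on M (x) N and replace a direct sum decomposition; [rctr] does the same on the
    right. *)
Fact lctr_subproof N : exists f : tens M N -> N,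
  {morph f : s t / s + t} /\ forall x n, f (pure x n) = (c x : S) *: n.
Proof.
apply: tens_universal => [x x' n|x n n'|x a n].
- by rewrite linearD scalerDl.
- exact: scalerDr.
- by rewrite linearZ scalerA.
Qed.
Definition lctr N : tens M N -> N := sval (cid (lctr_subproof N)).
Lemma lctrD N : {morph @lctr N : s t / s + t}.
Proof. by rewrite /lctr; case: (cid _) => f []. Qed.
Lemma lctr_pure N x (n : N) : lctr (pure x n) = (c x : S) *: n.
Proof. by rewrite /lctr; case: (cid _) => f []. Qed.
Lemma lctr0 N : lctr (0 : tens M N) = 0.
Proof. by apply: (addrI (lctr (0 : tens M N))); rewrite -lctrD !addr0. Qed.
Lemma lctr_map N N' (g : {linear N -> N'}) (t : tens M N) :
  lctr (tens_map (idfun : {linear M -> M}) g t) = g (lctr t).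
Proof.
apply: (tens_ext (f := fun t => lctr (tens_map _ g t)) (g := fun t => g (lctr t))).
- by move=> u v; rewrite tens_mapD lctrD.
- by move=> u v; rewrite lctrD linearD.
- by move=> x n; rewrite tens_map_pure !lctr_pure linearZ.
Qed.
End LeftContraction.

Section RightContraction.
Variables (N : lmodType S) (c : {linear N -> S^o}).
Fact rctr_subproof M : exists f : tens M N -> M,
  {morph f : s t / s + t} /\ forall x n, f (pure x n) = (c n : S^c) *: x.
Proof.
apply: tens_universal => [x x' n|x n n'|x a n].
- exact: scalerDr.
- by rewrite linearD scalerDl.
- by rewrite linearZ scalerA.
Qed.
Definition rctr M : tens M N -> M := sval (cid (rctr_subproof M)).
Lemma rctrD M : {morph @rctr M : s t / s + t}.
Proof. by rewrite /rctr; case: (cid _) => f []. Qed.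
Lemma rctr_pure M x (n : N) : rctr (pure (x : M) n) = (c n : S^c) *: x.
Proof. by rewrite /rctr; case: (cid _) => f []. Qed.
Lemma rctr0 M : rctr (0 : tens M N) = 0.
Proof. by apply: (addrI (rctr (0 : tens M N))); rewrite -rctrD !addr0. Qed.
Lemma rctr_map M M' (g : {linear M -> M'}) (t : tens M N) :
  rctr (tens_map g (idfun : {linear N -> N}) t) = g (rctr t).
Proof.
apply: (tens_ext (f := fun t => rctr (tens_map g _ t)) (g := fun t => g (rctr t))).
- by move=> u v; rewrite tens_mapD rctrD.
- by move=> u v; rewrite rctrD linearD.
- by move=> x n; rewrite tens_map_pure !rctr_pure linearZ.
Qed.
End RightContraction.

Lemma pure_sumr M N I (r : seq I) (x : M) (F : I -> N) :
  pure x (\sum_(i <- r) F i) = \sum_(i <- r) pure x (F i).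
Proof.
apply: (big_morph (fun n => pure x n)); first exact: pureDr.
by apply: (addrI (pure x (0 : N))); rewrite -pureDr !addr0.
Qed.

Lemma pure_suml M N I (r : seq I) (F : I -> M) (n : N) :
  pure (\sum_(i <- r) F i) n = \sum_(i <- r) pure (F i) n.
Proof.
apply: (big_morph (fun x => pure x n)); first by move=> x y; exact: pureDl.
by apply: (addrI (pure (0 : M) n)); rewrite -pureDl !addr0.
Qed.

Lemma tens_map_sum M M' N N' (f : {linear M -> M'}) (g : {linear N -> N'})
    I (r : seq I) (F : I -> tens M N) :
  tens_map f g (\sum_(i <- r) F i) = \sum_(i <- r) tens_map f g (F i).
Proof. apply: (big_morph (tens_map f g)); [exact: tens_mapD|exact: tens_map0]. Qed.

Lemma projective_tens_expand P N (pP : projective P) :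
  exists c : P -> {linear P -> (S^c)^o}, forall t : tens P N, exists s0 : seq P,
    forall s, uniq s -> {subset s0 <= s} -> t = \sum_(i <- s) pure i (lctr (c i) t).
Proof.
have [c hc] := projective_dual_basis pP; exists c.
elim/pureW=> [|p n t [s0 ih]].
  exists [::] => s _ _; rewrite big1 // => i _; rewrite lctr0.
  by apply: (addrI (pure i (0 : N))); rewrite -pureDr !addr0.
have [s1 h1] := hc p; exists (s1 ++ s0) => s us hs.
under eq_bigr do rewrite lctrD pureDr.
rewrite big_split /= -ih //; last by move=> i hi; apply: hs; rewrite mem_cat hi orbT.
congr (_ + _); rewrite {1}(h1 s us); last by move=> i hi; apply: hs; rewrite mem_cat hi.
rewrite pure_suml; apply: eq_bigr => i _.
by rewrite lctr_pure -pure_bal.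
Qed.

(** Projective modules are flat: contract t with each coordinate functional of P, lift the results
    through f, and reassemble. *)
Lemma projective_tens_exact P (N1 N2 N3 : lmodType S)
    (f : {linear N1 -> N2}) (g : {linear N2 -> N3}) : projective P ->
  (forall x, g x = 0 -> exists y, f y = x) ->
  forall t, tens_map (idfun : {linear P -> P}) g t = 0 ->
    exists u, tens_map (idfun : {linear P -> P}) f u = t.
Proof.
move=> pP fg t ht.
have [c hc] := projective_tens_expand N2 pP; have [s0 hs0] := hc t.
have hk i : exists y, f y = lctr (c i) t.
  by apply: fg; rewrite -lctr_map ht lctr0.
pose a i := sval (cid (hk i)).
have ha i : f (a i) = lctr (c i) t by rewrite /a; case: (cid _).
exists (\sum_(i <- undup s0) pure i (a i)).
rewrite tens_map_sum [RHS](hs0 (undup s0)) ?undup_uniq //; last by move=> i; rewrite mem_undup.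
by apply: eq_bigr => i _; rewrite tens_map_pure ha.
Qed.

Lemma fg_projective_tens_expand N : fg_projective N ->
  exists (n : nat) (g : 'I_n -> N) (c : 'I_n -> {linear N -> S^o}),
    forall M (t : tens M N), t = \sum_(i < n) pure (rctr (c i) t) (g i).
Proof.
move=> /fg_projective_dual_basis[n [g [c hc]]]; exists n, g, c => M.
apply: (tens_ext (f := id) (g := fun t => \sum_(i < n) pure (rctr (c i) t) (g i))) => //.
  by move=> s t; rewrite -big_split; apply: eq_bigr => i _; rewrite rctrD pureDl.
move=> x y; rewrite {1}(hc y) pure_sumr; apply: eq_bigr => i _.
by rewrite rctr_pure pure_bal.
Qed.

Section ShortExact.
Variables (K P M : lmodType S^c) (i : {linear K -> P}) (p : {linear P -> M}).
Hypothesis i_inj : injective i.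
Hypothesis p_surj : surj p.
Hypothesis exact_ip : forall x, p x = 0 <-> exists y, i y = x.

Lemma tens_map_surj N (t : tens M N) : exists u, tens_map p (idfun : {linear N -> N}) u = t.
Proof.
elim/pureW: t => [|x n t [u hu]]; first by exists 0; rewrite tens_map0.
have [y hy] := p_surj x; exists (pure y n + u).
by rewrite tens_mapD hu tens_map_pure hy.
Qed.

Variables (N : lmodType S) (fN : fg_projective N).

(** Contraction against the coordinates of N commutes with i, so injectivity is tested on K. The
    same argument gives [tens_map_exact]. *)
Lemma tens_map_inj (t : tens K N) : tens_map i (idfun : {linear N -> N}) t = 0 -> t = 0.
Proof.
move=> ht; have [n [g [c hc]]] := fg_projective_tens_expand fN.
rewrite (hc _ t) big1 // => j _.
have -> : rctr (c j) t = 0 by apply: i_inj; rewrite -rctr_map ht rctr0 linear0.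
by apply: (addrI (pure (0 : K) (g j))); rewrite -pureDl !addr0.
Qed.

Lemma tens_map_exact (t : tens P N) : tens_map p (idfun : {linear N -> N}) t = 0 ->
  exists u, tens_map i (idfun : {linear N -> N}) u = t.
Proof.
move=> ht; have [n [g [c hc]]] := fg_projective_tens_expand fN.
have hk j : exists y, i y = rctr (c j) t.
  by apply/exact_ip; rewrite -rctr_map ht rctr0.
pose a j := sval (cid (hk j)).
have ha j : i (a j) = rctr (c j) t by rewrite /a; case: (cid _).
exists (\sum_(j < n) pure (a j) (g j)).
rewrite tens_map_sum [RHS]hc; apply: eq_bigr => j _.
by rewrite tens_map_pure ha.
Qed.
End ShortExact.

Definition tacyclic_at M (X : complex S) (n : int) : Prop :=
  forall t, tens_map (idfun : {linear M -> M}) (cd X (n + 1)) t = 0 ->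
  exists u, tens_map (idfun : {linear M -> M}) (cd X n) u = t.

Lemma tens_mapC M M' N N' (f : {linear M -> M'}) (g : {linear N -> N'}) t :
  tens_map f (idfun : {linear N' -> N'}) (tens_map (idfun : {linear M -> M}) g t) =
  tens_map (idfun : {linear M' -> M'}) g (tens_map f (idfun : {linear N -> N}) t).
Proof.
apply: (tens_ext (f := fun t => tens_map f _ (tens_map _ g t))
                 (g := fun t => tens_map _ g (tens_map f _ t))).
- by move=> u v; rewrite !tens_mapD.
- by move=> u v; rewrite !tens_mapD.
- by move=> x y; rewrite !tens_map_pure.
Qed.

Lemma tens_cdd M (X : complex S) n t :
  tens_map (idfun : {linear M -> M}) (cd X (n + 1))
    (tens_map (idfun : {linear M -> M}) (cd X n) t) = 0.
Proof.
apply: (tens_ext (f := fun t => tens_map _ (cd X (n + 1)) (tens_map _ (cd X n) t))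
                 (g := fun _ => 0)).
- by move=> u v; rewrite !tens_mapD.
- by move=> u v; rewrite addr0.
- move=> x y; rewrite !tens_map_pure cdd.
  by apply: (addrI (pure x (0 : X (n + 1 + 1)))); rewrite -pureDr !addr0.
Qed.

Lemma tens_mapB M M' N N' (f : {linear M -> M'}) (g : {linear N -> N'}) s t :
  tens_map f g (s - t) = tens_map f g s - tens_map f g t.
Proof. by apply: (addIr (tens_map f g t)); rewrite -tens_mapD !subrK. Qed.

(** The part H^(n+1)(P (x) X) -> H^(n+1)(M (x) X) -> H^(n+2)(K (x) X) of the long exact sequence,
    chased by hand. The short sequence of complexes is exact because the terms of X are
    projective. *)
Lemma tacyclic_step (K P M : lmodType S^c) (i : {linear K -> P}) (p : {linear P -> M})
    (X : complex S) n :
  injective i -> surj p -> (forall x, p x = 0 <-> exists y, i y = x) ->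
  (forall k, fg_projective (X k)) ->
  tacyclic_at P X n -> tacyclic_at K X (n + 1) -> tacyclic_at M X n.
Proof.
move=> ii sp ip pX aP aK t ht.
have [u hu] := tens_map_surj sp t.
have [|v hv] := tens_map_exact ip (pX _) (t := tens_map (idfun : {linear P -> P}) (cd X (n + 1)) u).
  by rewrite tens_mapC hu.
have [|w hw] := aK v.
  apply: (tens_map_inj ii (pX _)).
  by rewrite tens_mapC hv tens_cdd.
have [|z hz] := aP (u - tens_map i (idfun : {linear X (n + 1) -> X (n + 1)}) w).
  by rewrite tens_mapB -tens_mapC hw hv subrr.
exists (tens_map p (idfun : {linear X n -> X n}) z).
rewrite -tens_mapC hz tens_mapB hu.
have -> : tens_map p (idfun : {linear X (n + 1) -> X (n + 1)})
    (tens_map i (idfun : {linear X (n + 1) -> X (n + 1)}) w) = 0; last by rewrite subr0.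
apply: (tens_ext (f := fun w => tens_map p _ (tens_map i _ w)) (g := fun _ => 0)).
- by move=> a b; rewrite !tens_mapD.
- by move=> a b; rewrite addr0.
- move=> x y; rewrite !tens_map_pure.
  have -> : p (i x) = 0 by apply/ip; exists x.
  by apply: (addrI (pure (0 : M) (idfun y))); rewrite -pureDl !addr0.
Qed.

Lemma tacyclic_projective P (X : complex S) n :
  projective P -> acyclic_at X n -> tacyclic_at P X n.
Proof. by move=> pP aX; exact: projective_tens_exact. Qed.

(** Dimension shifting: each syzygy costs one degree, and after finitely many syzygies the module is
    zero. The shift d depends on M alone, not on the range of acyclicity of X. *)
Lemma tacyclic_finite_pd M (X : complex S) : finite_proj_dim M ->
  (forall k, fg_projective (X k)) ->
  exists d : int, forall a, (forall n, n < a -> acyclic_at X n) ->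
    forall n, n < a - d -> tacyclic_at M X n.
Proof.
move=> [P [m hm]] pX; exists m.+2%:Z => a aX.
pose sub j := image_submodule (pr_d P j).
pose Z j := subm (sub j).
(* [Z j] lies in P_j, so it vanishes for j = m + 1. The m + 1 steps down to [Z 0] and one more to M
   account for the shift m + 2. *)
have hZ : forall k j : nat, (k + j = m.+1)%N -> forall n, n + k%:Z < a -> tacyclic_at (Z j) X n.
  elim=> [|k ih] j hj n hn.
    move=> t _; exists 0; rewrite tens_map0.
    apply: (tens_ext (f := fun _ => 0) (g := id)) => [u v|//|x y]; first by rewrite addr0.
    have -> : x = 0.
      by apply: sinc_inj; rewrite linear0; apply: (hm j); rewrite -hj.
    by apply: (addrI (pure (0 : Z j) y)); rewrite -pureDl !addr0.
  have hd x : exists y, pr_d P j y = pr_d P j x by exists x.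
  apply: (@tacyclic_step (Z j.+1) _ _ (sinc (sub j.+1)) (scor (sub j) hd)) => //.
  - by move=> y; have [x hx] := sincP y; exists x; apply: sinc_inj.
  - move=> x; split=> [/(congr1 (sinc (sub j)))|[y <-]].
      rewrite scorE linear0 => /pr_exact hx.
      by exists (smk (sub j.+1) hx).
    by apply: sinc_inj; rewrite scorE linear0; apply/pr_exact; exact: (sincP y).
  - by apply: tacyclic_projective; [exact: pr_projective|apply: aX; lia].
  - by apply: ih; [rewrite addnS -addSn|lia].
move=> n hn; apply: (@tacyclic_step (Z 0) _ _ (sinc (sub 0)) (pr_aug P)) => //.
- exact: pr_aug_surj.
- move=> x; split=> [/pr_exact0 hx|[y <-]]; first by exists (smk (sub 0) hx).
  by apply/pr_exact0; exact: (sincP y).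
- by apply: tacyclic_projective; [exact: pr_projective|apply: aX; lia].
- by apply: (hZ m.+1); [rewrite addn0|lia].
Qed.
End TensorMaps.

(** * Full faithfulness *)

Section Singularity.
Variable S : pzRingType.

Lemma gfun_perfect (X Y : Kcat S) (s : hom X Y) : perfect_cone s -> is_iso (fmor (gfun S) s).
Proof. by move/(perfect_cone_iff (s : chain_map X Y)). Qed.

Definition Dsg_germ : functor (loc (@perfect_cone S)) (gcat S) := loc_ext (@gfun_perfect).

Lemma gfun_perfect_inv (X Y : Kcat S) (s : hom X Y) : is_iso (fmor (gfun S) s) -> perfect_cone s.
Proof. by move=> h; apply/(perfect_cone_iff (s : chain_map X Y)). Qed.

Lemma gfun_roof (X Y : Kcat S) (g : hom (gfun S X) (gfun S Y)) :
  exists (Z : Kcat S) (t : hom Y Z) (f : hom X Z),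
    perfect_cone t /\ fmor (gfun S) f =~= fmor (gfun S) t \oc g.
Proof.
have [N [f hf]] := @germ_real S X Y g.
by exists (Ktrunc N Y), (Kret N Y), f; split; first exact: trunc_perfect_cone.
Qed.

Lemma gfun_coin (X Y : Kcat S) (f g : hom X Y) : fmor (gfun S) f =~= fmor (gfun S) g ->
  exists (Z : Kcat S) (t : hom Y Z), perfect_cone t /\ t \oc f =~= t \oc g.
Proof.
move=> h; have [N hN] := @germ_coin S X Y f g h.
by exists (Ktrunc N Y), (Kret N Y); split; first exact: trunc_perfect_cone.
Qed.

(** Brutal truncations provide both the denominators and the equalizing maps required by the
    calculus of fractions. *)
Lemma Dsg_germ_ff : fully_faithful Dsg_germ.
Proof. exact: (@loc_ext_ff _ _ _ _ (@gfun_perfect) (@gfun_perfect_inv) (@gfun_roof) (@gfun_coin)). Qed.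
End Singularity.

Section Ilambda.
Variables (R : pzRingType) (e : R) (he : e * e = e).
Local Notation C := (corner he).

Lemma ilambda_zero (N : lmodType C) : is_zero N -> is_zero (ilambda N).
Proof. by move=> N0; elim/pureW=> [//|x n t ->]; rewrite (N0 n) pure0r addr0. Qed.

Lemma ilambda_Kmb : finite_proj_dim (Re_right he : lmodType C^c) -> ilambda_preserves_Kmb he.
Proof.
move=> pd X [pX [b hb] [c [c' hc]]]; split.
- by move=> n; exact: fg_projective_ilambda.
- by exists b => n hn; apply: ilambda_zero; exact: hb.
have [d hd] := tacyclic_finite_pd pd pX.
exists (c - d), b => n [hn|hn].
  (* [acyclic_at] in index n concerns degree n + 1, hence the bound c - 1. *)
  by apply: (hd (c - 1)); [move=> m hm; apply: hc; lia|lia].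
move=> x _; exists 0; rewrite linear0.
by rewrite (ilambda_zero (hb (n + 1) hn) x).
Qed.

Lemma ilambda_gcontr (X : complex C) : gcontr X -> gcontr (ilambda_cx X).
Proof.
move=> [N [h hh]]; exists N, (fun n => ilambda_map (h n)) => n hn.
apply: (ilambda_ext (f := idfun)
  (g := (ilambda_map (cd X n) \o ilambda_map (h n)) \+
        (ilambda_map (h (n + 1)) \o ilambda_map (cd X (n + 1))))) => x y.
by rewrite /= !tens_map_pure -pureDr -hh.
Qed.

(** Perfectness amounts to contractibility in low degrees, and applying the functor to the
    contraction preserves it. *)
Lemma ilambda_perfect : ilambda_preserves_Kmb he -> ilambda_preserves_perfect he.
Proof.
move=> hK X kX pX; apply: gcontr_perfect; first exact: hK.
exact/ilambda_gcontr/(@perfect_gcontr _ (MkKob kX)).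
Qed.

Hypothesis hK : ilambda_preserves_Kmb he.
Hypothesis hP : ilambda_preserves_perfect he.

Lemma pure_unit_inj (N : lmodType C) : injective (fun n : N => pure (Re_unit he) n).
Proof. by move=> x y /= /(congr1 (@mu _ _ _ N)); rewrite !mu_unit. Qed.

Section GermMap.
Variables (X Y : Kob C).
Fact germ_map_subproof (g : germ X Y) : exists N : int, forall n, n < N ->
  forall t : ilambda_cx X n,
  ilambda_map (g (n + 1)) (cd (ilambda_cx X) n t) = cd (ilambda_cx Y) n (ilambda_map (g n) t).
Proof.
have [N hN] := gmP g; exists N => n hn.
apply: (ilambda_ext (f := ilambda_map (g (n + 1)) \o ilambda_map (cd X n))
                    (g := ilambda_map (cd Y n) \o ilambda_map (g n))) => x y.
by rewrite /= !tens_map_pure hN.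
Qed.
Definition germ_map (g : germ X Y) : germ (K_ilambda_ob hK X) (K_ilambda_ob hK Y) :=
  @Germ R (K_ilambda_ob hK X) (K_ilambda_ob hK Y) (fun n => ilambda_map (g n))
    (germ_map_subproof g).

Lemma germ_map_eq (f g : germ X Y) : germ_eq f g -> germ_eq (germ_map f) (germ_map g).
Proof.
move=> [N [h hh]]; exists N, (fun n => ilambda_map (h n)) => n hn t /=.
apply: (ilambda_ext
  (f := ilambda_map (f (n + 1)) \- ilambda_map (g (n + 1)))
  (g := (ilambda_map (cd Y n) \o ilambda_map (h n)) \+
        (ilambda_map (h (n + 1)) \o ilambda_map (cd X (n + 1))))) => x y.
by rewrite /= !tens_map_pure -pureNr -!pureDr hh.
Qed.

(** The homotopy descends termwise by full faithfulness on modules, and its identity is read off on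
    the elements e (x) x. Germs themselves descend in the same way in [germ_map_full]. *)
Lemma germ_map_inj (f g : germ X Y) : germ_eq (germ_map f) (germ_map g) -> germ_eq f g.
Proof.
move=> [N [h hh]]; exists N, (fun n => descend (h n)) => n hn x.
have := hh n hn (pure (Re_unit he) x).
rewrite -!(descendE (h _)) /= !tens_map_pure -pureNr -!pureDr.
exact: pure_unit_inj.
Qed.

Lemma germ_map_full (k : germ (K_ilambda_ob hK X) (K_ilambda_ob hK Y)) :
  exists g : germ X Y, germ_eq (germ_map g) k.
Proof.
have [N hN] := gmP k.
have dP : exists N : int, forall n, n < N -> forall x,
    descend (k (n + 1)) (cd X n x) = cd Y n (descend (k n) x).
  exists N => n hn x; apply: (@pure_unit_inj (Y (n + 1))).
  have := hN n hn (pure (Re_unit he) x).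
  by rewrite -(descendE (k (n + 1))) -(descendE (k n)) /= !tens_map_pure.
exists (Germ dP); apply: (@germ_eq_ptw _ _ _ _ _ 0) => n _ t; exact: descendE.
Qed.
End GermMap.

Lemma germ_map_id (X : Kob C) : germ_eq (germ_map (germ_id X)) (germ_id (K_ilambda_ob hK X)).
Proof.
apply: (@germ_eq_ptw _ _ _ _ _ 0) => n _ t.
apply: (ilambda_ext (f := ilambda_map (idfun : {linear X n -> X n})) (g := idfun)) => x y.
by rewrite /= tens_map_pure.
Qed.

Lemma germ_map_comp (X Y Z : Kob C) (g : germ Y Z) (f : germ X Y) :
  germ_eq (germ_map (germ_comp g f)) (germ_comp (germ_map g) (germ_map f)).
Proof.
apply: (@germ_eq_ptw _ _ _ _ _ 0) => n _ t.
apply: (ilambda_ext (f := ilambda_map (g n \o f n)) (g := ilambda_map (g n) \o ilambda_map (f n))) => x y.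
by rewrite /= !tens_map_pure.
Qed.

Definition germ_ilambda : functor (gcat C) (gcat R) :=
  @Functor (gcat C) (gcat R) (K_ilambda_ob hK) germ_map germ_map_eq germ_map_id germ_map_comp.

Local Notation F := (Dsg_ilambda hK hP).

(** Both composites have the same objects, so they can be compared by equations. For a formal
    inverse of s, the comparison is made after composing with the invertible image of s. *)
Lemma Dsg_germ_ilambda (X Y : Dsg C) (p : hom X Y) :
  fmor (Dsg_germ R) (fmor F p) =~= fmor germ_ilambda (fmor (Dsg_germ C) p).
Proof.
elim: p => {X Y} [X Y f|X Y s hs|X Y Z q ihq p ihp].
- by apply: (@germ_eq_ptw _ _ _ _ _ 0).
- have e0 : fmor germ_ilambda (fmor (gfun C) s) =~= fmor (gfun R) (fmor (K_ilambda hK) s).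
    by apply: (@germ_eq_ptw _ _ _ _ _ 0).
  have iT : is_iso (fmor germ_ilambda (fmor (gfun C) s)).
    exact/fmor_iso/gfun_perfect.
  apply: (iso_cancelr iT).
  rewrite -(fmor_comp germ_ilambda) (loc_invl _ hs) (fmor_id germ_ilambda).
  apply: heq_trans (comp_heq (heq_refl _) e0) _.
  exact: (loc_invl (@gfun_perfect R) (K_ilambda_perfect_cone hK hP hs)).
- rewrite (fmor_comp germ_ilambda); exact: comp_heq.
Qed.

(** In the square of [Dsg_germ_ilambda], the two comparison functors to germs and the functor
    between germs are fully faithful, which forces the same for the remaining side. *)
Lemma Dsg_ilambda_ff : fully_faithful F.
Proof.
move=> X Y; split=> [f g hfg|k].
  apply: (Dsg_germ_ff X Y).1; apply: germ_map_inj.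
  apply: germ_eq_trans (germ_eq_sym (Dsg_germ_ilambda f)) _.
  apply: germ_eq_trans _ (Dsg_germ_ilambda g).
  exact: (fmor_heq (Dsg_germ R) hfg).
have [g hg] := germ_map_full (fmor (Dsg_germ R) k).
have [f hf] := (Dsg_germ_ff X Y).2 g.
exists f; apply: (Dsg_germ_ff _ _).1.
apply: germ_eq_trans (Dsg_germ_ilambda f) _; apply: germ_eq_trans _ hg.
exact: germ_map_eq.
Qed.
End Ilambda.

(** * Triangles and equivalences *)

Section Equivalence.
Variables (C D : category) (F : functor C D).
Hypothesis ff : fully_faithful F.

Lemma ff_reflects_iso (X Y : C) (f : hom X Y) : is_iso (fmor F f) -> is_iso f.
Proof.
move=> [g [gf fg]]; have [k hk] := (ff Y X).2 g.
exists k; split; apply: (ff _ _).1; rewrite fmor_comp hk fmor_id //.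
Qed.

Hypothesis es : forall d : D, exists (X : C) (b : hom (F X) d), is_iso b.

Lemma ff_equivalence : is_equivalence F.
Proof.
pose G (d : D) : C := sval (cid (es d)).
have hb (d : D) : exists b : hom (F (G d)) d, is_iso b by rewrite /G; case: (cid _).
pose b d := sval (cid (hb d)).
have bi d : is_iso (b d) by rewrite /b; case: (cid _).
pose b' d := sval (cid (bi d)).
have b'b d : b' d \oc b d =~= idm (F (G d)) by rewrite /b'; case: (cid _) => ? [].
have bb' d : b d \oc b' d =~= idm d by rewrite /b'; case: (cid _) => ? [].
have hG (d d' : D) (f : hom d d') : exists g : hom (G d) (G d'), fmor F g =~= b' d' \oc f \oc b d.
  exact: (ff _ _).2.
pose Gm d d' f := sval (cid (hG d d' f)).
have GmP d d' f : fmor F (Gm d d' f) =~= b' d' \oc f \oc b d by rewrite /Gm; case: (cid _).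
have nat d d' f : b d' \oc fmor F (Gm d d' f) =~= f \oc b d.
  by rewrite GmP !comp_assoc bb' comp_idl.
have Gheq d d' (f g : hom d d') : f =~= g -> Gm d d' f =~= Gm d d' g.
  by move=> fg; apply: (ff _ _).1; rewrite !GmP fg.
have Gid d : Gm d d (idm d) =~= idm (G d).
  by apply: (ff _ _).1; rewrite GmP comp_idr b'b fmor_id.
have Gcomp d1 d2 d3 (g : hom d2 d3) (f : hom d1 d2) :
    Gm d1 d3 (g \oc f) =~= Gm d2 d3 g \oc Gm d1 d2 f.
  apply: (ff _ _).1; apply: (iso_cancel (bi d3)).
  by rewrite nat fmor_comp comp_assoc nat -!comp_assoc nat.
pose GF := @Functor D C G Gm Gheq Gid Gcomp.
exists GF; split; last by exists b; split; [exact: bi|exact: nat].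
have ha (X : C) : exists a : hom (G (F X)) X, fmor F a =~= b (F X) by exact: (ff _ _).2.
pose a X := sval (cid (ha X)).
have aP X : fmor F (a X) =~= b (F X) by rewrite /a; case: (cid _).
exists a; split=> [X|X Y f].
  by apply: ff_reflects_iso; apply: is_iso_heq (heq_sym (aP X)) (bi _).
apply: (ff _ _).1; rewrite !fmor_comp !aP; exact: nat.
Qed.

Lemma equivalence_ess_surj : is_equivalence F -> forall d : D, exists (X : C) (b : hom (F X) d), is_iso b.
Proof. by move=> [G [_ [b [bi _]]]] d; exists (G d), (b d); exact: bi. Qed.
End Equivalence.

Section Triangles.
Lemma tri_iso_trans (C : category) (Sh : functor C C) (T1 T2 T3 : triangle Sh) :
  tri_iso T1 T2 -> tri_iso T2 T3 -> tri_iso T1 T3.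
Proof.
move=> [a [b [c [[ia ib ic] [h1 h2 h3]]]]] [a' [b' [c' [[ia' ib' ic'] [h1' h2' h3']]]]].
exists (a' \oc a), (b' \oc b), (c' \oc c); split; first by split; exact: is_iso_comp.
split.
- by rewrite -comp_assoc h1 comp_assoc h1' comp_assoc.
- by rewrite -comp_assoc h2 comp_assoc h2' comp_assoc.
- by rewrite fmor_comp -comp_assoc h3 comp_assoc h3' comp_assoc.
Qed.

Lemma tri_iso_refl (C : category) (Sh : functor C C) (T : triangle Sh) : tri_iso T T.
Proof.
exists (idm _), (idm _), (idm _); split; first by split; exact: is_iso_id.
by split; rewrite ?fmor_id comp_idl comp_idr.
Qed.

Lemma map_tri_iso (C D : tcategory) (F : functor C D)
    (eta : forall X : C, hom (F (Sh C X)) (Sh D (F X))) (T T' : triangle (Sh C)) :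
  (forall (X Y : C) (f : hom X Y),
     eta Y \oc fmor F (fmor (Sh C) f) =~= fmor (Sh D) (fmor F f) \oc eta X) ->
  tri_iso T T' -> tri_iso (map_triangle eta T) (map_triangle eta T').
Proof.
move=> nat [a [b [c [[ia ib ic] [h1 h2 h3]]]]].
exists (fmor F a), (fmor F b), (fmor F c); split; first by split; exact: fmor_iso.
split; rewrite /=; [by rewrite -!fmor_comp h1|by rewrite -!fmor_comp h2|].
by rewrite comp_assoc -nat -!comp_assoc -!fmor_comp h3.
Qed.

Lemma quot_tri_iso (S : pzRingType) (T T' : triangle (Kshift S)) :
  tri_iso T T' -> tri_iso (quot_triangle T) (quot_triangle T').
Proof.
move=> [a [b [c [[ia ib ic] [h1 h2 h3]]]]].
pose L := loc_functor (@perfect_cone S).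
exists (fmor L a), (fmor L b), (fmor L c); split.
  by split; [exact: (fmor_iso L ia)|exact: (fmor_iso L ib)|exact: (fmor_iso L ic)].
have e (X Y Z W : Kcat S) (g : hom Y Z) (f : hom X Y) (g' : hom W Z) (f' : hom X W) :
    g \oc f =~= g' \oc f' -> fmor L g \oc fmor L f =~= fmor L g' \oc fmor L f'.
  by move=> h; rewrite -!fmor_comp h.
by split; exact: e.
Qed.
End Triangles.

Section IlambdaTriangle.
Variables (R : pzRingType) (e : R) (he : e * e = e).
Local Notation C := (corner he).
Hypothesis hK : ilambda_preserves_Kmb he.
Hypothesis hP : ilambda_preserves_perfect he.
Local Notation F := (Dsg_ilambda hK hP).
Local Notation eta := (Dsg_ilambda_shift hK hP).

Lemma chain_iso (S : pzRingType) (X Y : Kcat S) (f : chain_map X Y) (g : forall n, Y n -> X n) :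
  (forall n, cancel (f n) (g n)) -> (forall n, cancel (g n) (f n)) -> @is_iso (Kcat S) X Y f.
Proof.
move=> fK gK.
have lg n : linear (g n).
  by move=> a x y; rewrite -{1}(gK n x) -{1}(gK n y) -linearP fK.
have gd n x : mklinear (lg (n + 1)) (cd Y n x) = cd X n (mklinear (lg n) x).
  by rewrite -[RHS]fK cmd /= gK.
exists (ChainMap gd); split; apply: homotopic_eq => n x; [exact: fK|exact: gK].
Qed.

Lemma eta_iso (X : Dsg C) : is_iso (eta X).
Proof.
apply: (fmor_iso (loc_functor (@perfect_cone R))
  (X := K_ilambda_ob hK (Kshift_ob X)) (Y := Kshift_ob (K_ilambda_ob hK X))
  (f := ilambda_shift X)).
exact: (@chain_iso R (K_ilambda_ob hK (Kshift_ob X)) (Kshift_ob (K_ilambda_ob hK X))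
  (ilambda_shift X) (fun n => id)).
Qed.

Lemma eta_natural_K (X Y : K C) (f : hom X Y) :
  homotopic (cm_comp (ilambda_shift Y) (ilambda_cm (shift_map f)))
            (cm_comp (shift_map (ilambda_cm f)) (ilambda_shift X)).
Proof. by apply: homotopic_eq. Qed.

(** Induction on formal composites. For a formal inverse of s, composing on both sides with the
    invertible images of s reduces the claim to naturality at s. *)
Lemma eta_natural (X Y : Dsg C) (f : hom X Y) :
  eta Y \oc fmor F (fmor (Sh (Dsg C)) f) =~= fmor (Sh (Dsg R)) (fmor F f) \oc eta X.
Proof.
pose L := loc_functor (@perfect_cone R).
have lofE (X0 Y0 : K C) (s : @hom (K C) X0 Y0) :
    eta Y0 \oc fmor F (fmor (Sh (Dsg C)) (lof _ s)) =~= fmor (Sh (Dsg R)) (fmor F (lof _ s)) \oc eta X0.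
  apply: leq_trans (leq_sym (leq_comp _ _ _)) _; apply: leq_trans (leq_comp _ _ _).
  by apply: leq_of; exact: eta_natural_K.
elim: f => {X Y} [X Y f|X Y s hs|X Y Z q ihq p ihp]; first exact: lofE.
  have ls := lofE _ _ s.
  have i1 : @is_iso (Dsg C) X Y (lof _ s) by exact: (loc_iso hs).
  have i2 : is_iso (fmor (Sh (Dsg R)) (fmor F (lof _ s : @hom (Dsg C) X Y))) by do 2 apply: fmor_iso.
  have i3 : is_iso (fmor F (fmor (Sh (Dsg C)) (lof _ s : @hom (Dsg C) X Y))) by do 2 apply: fmor_iso.
  apply: (iso_cancel i2); apply: (iso_cancelr i3).
  have e1 : @comp (Dsg C) _ _ _ (linv hs : @hom (Dsg C) Y X) (lof _ s) =~= @idm (Dsg C) X by exact: leq_invl.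
  have e2 : @comp (Dsg C) _ _ _ (lof _ s) (linv hs : @hom (Dsg C) Y X) =~= @idm (Dsg C) Y by exact: leq_invr.
  rewrite -!comp_assoc -(fmor_comp F) -(fmor_comp (Sh (Dsg C))) e1 !fmor_id comp_idr.
  rewrite -ls comp_assoc comp_assoc -(fmor_comp (Sh (Dsg R))) -(fmor_comp F) e2 !fmor_id.
  by rewrite comp_idl.
change (lcomp q p) with (@comp (Dsg C) X Y Z q p).
by rewrite !fmor_comp comp_assoc ihq -!comp_assoc ihp.
Qed.

Section Cone.
Variables (X Y : complex C) (f : chain_map X Y).
Let pr1 n : {linear cone f n -> X (n + 1)} := fst.
Let pr2 n : {linear cone f n -> Y n} := snd.
Fact ilambda_cone_subproof n (t : ilambda_cx (cone f) n) :
  lpair (ilambda_map (pr1 (n + 1))) (ilambda_map (pr2 (n + 1))) (cd (ilambda_cx (cone f)) n t) =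
  cd (cone (ilambda_cm f)) n (lpair (ilambda_map (pr1 n)) (ilambda_map (pr2 n)) t).
Proof.
apply: (ilambda_ext
  (f := lpair (ilambda_map (pr1 (n + 1))) (ilambda_map (pr2 (n + 1))) \o cd (ilambda_cx (cone f)) n)
  (g := cd (cone (ilambda_cm f)) n \o lpair (ilambda_map (pr1 n)) (ilambda_map (pr2 n)))) => x p.
by congr (_, _); rewrite /= !tens_map_pure /= ?pureNr ?pureDr.
Qed.
Definition ilambda_cone : chain_map (ilambda_cx (cone f)) (cone (ilambda_cm f)) :=
  @ChainMap R (ilambda_cx (cone f)) (cone (ilambda_cm f))
    (fun n => lpair (ilambda_map (pr1 n)) (ilambda_map (pr2 n))) ilambda_cone_subproof.

Lemma ilambda_cone_bij : exists g : forall n, cone (ilambda_cm f) n -> ilambda_cx (cone f) n,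
  (forall n, cancel (ilambda_cone n) (g n)) /\ (forall n, cancel (g n) (ilambda_cone n)).
Proof.
have l1 n : linear (fun x : X (n + 1) => (x, 0) : cone f n).
  by move=> a x y; congr (_, _); rewrite /= scaler0 addr0.
have l2 n : linear (fun y : Y n => (0, y) : cone f n).
  by move=> a x y; congr (_, _); rewrite /= scaler0 addr0.
exists (fun n p => ilambda_map (mklinear (l1 n)) p.1 + ilambda_map (mklinear (l2 n)) p.2).
split=> n.
  apply: (ilambda_ext
    (f := (ilambda_map (mklinear (l1 n)) \o ilambda_map (pr1 n)) \+
          (ilambda_map (mklinear (l2 n)) \o ilambda_map (pr2 n)))
    (g := idfun)) => x [a b].
  by rewrite /= !tens_map_pure -pureDr; congr (pure _ (_, _));
    rewrite /= ?addr0 ?add0r.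
have e11 t : ilambda_map (pr1 n) (ilambda_map (mklinear (l1 n)) t) = t.
  apply: (ilambda_ext (f := ilambda_map (pr1 n) \o ilambda_map (mklinear (l1 n)))
    (g := idfun)) => x y; by rewrite /= !tens_map_pure.
have e12 t : ilambda_map (pr1 n) (ilambda_map (mklinear (l2 n)) t) = 0.
  apply: (ilambda_ext (f := ilambda_map (pr1 n) \o ilambda_map (mklinear (l2 n)))
    (g := \0)) => x y; by rewrite /= !tens_map_pure pure0r.
have e21 t : ilambda_map (pr2 n) (ilambda_map (mklinear (l1 n)) t) = 0.
  apply: (ilambda_ext (f := ilambda_map (pr2 n) \o ilambda_map (mklinear (l1 n)))
    (g := \0)) => x y; by rewrite /= !tens_map_pure pure0r.
have e22 t : ilambda_map (pr2 n) (ilambda_map (mklinear (l2 n)) t) = t.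
  apply: (ilambda_ext (f := ilambda_map (pr2 n) \o ilambda_map (mklinear (l2 n)))
    (g := idfun)) => x y; by rewrite /= !tens_map_pure.
move=> [a b]; congr (_, _).
  by rewrite (linearD (ilambda_map (pr1 n))) e11 e12 addr0.
by rewrite (linearD (ilambda_map (pr2 n))) e21 e22 add0r.
Qed.
End Cone.

(** The isomorphism is the identity on the first two vertices and [ilambda_cone] on the third; the
    squares commute already at the level of complexes. *)
Lemma ilambda_cone_triangle (X Y : Kob C) (f : chain_map X Y) :
  tri_iso (map_triangle eta (quot_triangle (cone_triangle f)))
    (quot_triangle (@cone_triangle R (K_ilambda_ob hK X) (K_ilambda_ob hK Y) (ilambda_cm f))).
Proof.
pose L := loc_functor (@perfect_cone R).
have [g [gK Kg]] := ilambda_cone_bij f.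
pose Z := @Kcone R (K_ilambda_ob hK X) (K_ilambda_ob hK Y) (ilambda_cm f).
have ic := @chain_iso R (K_ilambda_ob hK (Kcone f)) Z (ilambda_cone f) g gK Kg.
exists (idm _), (idm _), (lof (@perfect_cone R)
  (ilambda_cone f : @hom (Kcat R) (K_ilambda_ob hK (Kcone f)) Z)).
split; first by split; [exact: is_iso_id|exact: is_iso_id|exact: (fmor_iso L ic)].
split.
- exact: leq_trans (leq_idl _) (leq_sym (leq_idr _)).
- apply: leq_trans (leq_sym (leq_idr _)).
  apply: leq_trans (leq_sym (leq_comp _ _ _)) _; apply: leq_of.
  apply: homotopic_eq => n t.
  apply: (ilambda_ext (f := ilambda_cone f n \o ilambda_map (cone_in f n))
            (g := cone_in (ilambda_cm f) n)) => x y.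
  by congr (_, _); rewrite /= !tens_map_pure /= ?pure0r.
- apply: heq_trans (comp_heq (fmor_id (Sh (Dsg R)) _) (heq_refl _)) _.
  apply: leq_trans (leq_idl _) _.
  apply: leq_trans (leq_sym (leq_comp _ _ _)) _; apply: leq_trans (leq_comp _ _ _); apply: leq_of.
  by apply: homotopic_eq => n t.
Qed.

Lemma ilambda_triangle_functor : triangle_functor eta.
Proof.
split; first by split; [exact: eta_iso|exact: eta_natural].
move=> T [T0 [X [Y [f h0]]] h].
exists (@cone_triangle R (K_ilambda_ob hK X) (K_ilambda_ob hK Y) (ilambda_cm f)).
  by do 3 eexists; exact: tri_iso_refl.
apply: tri_iso_trans (ilambda_cone_triangle f).
apply: map_tri_iso; first exact: eta_natural.
by apply: tri_iso_trans h _; exact: quot_tri_iso.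
Qed.
End IlambdaTriangle.

(** * Complexes with terms in add Re *)

Section Isomorphic.
Variable C : category.
Definition isomorphic (X Y : C) : Prop := exists f : hom X Y, is_iso f.
Lemma isomorphic_sym X Y : isomorphic X Y -> isomorphic Y X.
Proof. by move=> [f [g [gf fg]]]; exists g, f. Qed.
Lemma isomorphic_trans X Y Z : isomorphic X Y -> isomorphic Y Z -> isomorphic X Z.
Proof. by move=> [f hf] [g hg]; exists (g \oc f); exact: is_iso_comp. Qed.
End Isomorphic.

(** * Resolutions as complexes *)

Section ResolutionComplex.
Variable S : pzRingType.

Section Raw.
Variables (P : nat -> lmodType S) (d : forall i, {linear P i.+1 -> P i}).

(** The differential with both indices free, zero unless they are consecutive. It spares casts when
    the indices are absolute values of integers. *)
Definition hd i j : {linear P i -> P j} :=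
  match @eqP _ i j.+1 with
  | ReflectT e => ecast k {linear P k -> P j} (esym e) (d j)
  | ReflectF _ => (\0 : {linear P i -> P j})
  end.

Lemma hdE j : hd j.+1 j = d j.
Proof. by rewrite /hd; case: eqP => // e; rewrite (Prop_irrelevance e erefl). Qed.
Lemma hd_neq i j x : i <> j.+1 -> hd i j x = 0.
Proof. by rewrite /hd; case: eqP. Qed.

Hypothesis dd : forall i x, d i (d i.+1 x) = 0.
Lemma hd_hd i j k x : hd j k (hd i j x) = 0.
Proof.
have [ej|ej] := eqVneq j k.+1; last by rewrite hd_neq //; exact/eqP.
have [ei|ei] := eqVneq i j.+1; last by rewrite [hd i j x]hd_neq ?linear0 //; exact/eqP.
by subst i j; rewrite !hdE.
Qed.

(** Degree a - i contains P_i. Above a the absolute value repeats the terms in mirror image with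
    zero differentials; truncation at a removes them. *)
Definition raw_cx (a : int) : complex S :=
  @Complex S (fun n => P (absz (a - n)%R)) (fun n => hd _ _) (fun n x => hd_hd _ _ x).
End Raw.

Section Concentrated.
Variables (M : lmodType S) (a : int).
Let base : complex S := @Complex S (fun n => M) (fun n => \0) (fun n x => erefl).
Definition conc_pi (n : int) : {linear base n -> base n} :=
  if n == a then (idfun : {linear M -> M}) else (\0 : {linear M -> M}).
Fact conc_pi_idem n (x : base n) : conc_pi n (conc_pi n x) = conc_pi n x.
Proof. by rewrite /conc_pi; case: eqP. Qed.
Fact conc_pi_d n (x : base n) :
  conc_pi (n + 1 + 1) (cd base (n + 1) (conc_pi (n + 1) (cd base n (conc_pi n x)))) = 0.
Proof. by rewrite /= linear0. Qed.
(** M in degree a alone, cut out of the constant complex with zero differential so that no type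
    depends on deciding n = a. *)
Definition conc : complex S := rc conc_pi_idem conc_pi_d.
Definition conc_inc n : {linear conc n -> M} := rc_inc conc_pi n.
Definition conc_ret n : {linear M -> conc n} := rc_ret conc_pi_idem n.
Lemma conc_d n (x : conc n) : cd conc n x = 0.
Proof. by apply: rc_inc_inj; rewrite rc_dE !linear0. Qed.
Lemma conc_zero n : n != a -> is_zero (conc n).
Proof. by move=> h; apply: rc_zero => x; rewrite /conc_pi (negbTE h). Qed.
Lemma conc_retK n x : n = a -> conc_inc n (conc_ret n x) = x.
Proof. by move=> h; rewrite /conc_inc rc_retE /conc_pi h eqxx. Qed.
Lemma conc_inc_inj n : injective (conc_inc n).
Proof. exact: rc_inc_inj. Qed.

End Concentrated.

(** The map c presents M as the cokernel of d in degree m, and X is exact in degrees <= m, so the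
    truncation at m + 1 resolves M. *)
Lemma conc_quasi_iso (X : complex S) (m : int) (M : lmodType S) (c : {linear X (m + 1) -> M}) :
  surj c -> (forall x, c x = 0 <-> exists y, cd X m y = x) ->
  (forall n, n < m -> acyclic_at X n) ->
  exists f : chain_map (trunc (m + 1) X) (conc M (m + 1)), quasi_iso f.
Proof.
move=> sc kc aX.
(* A graded map equal to c in degree m + 1 and to zero elsewhere. *)
have [c' [c'E c'0]] := @int_update (fun n => {linear X n -> M}) (fun n => \0) (m + 1) c.
have fd n (x : trunc (m + 1) X n) :
  (conc_ret M (m + 1) (n + 1) \o c' (n + 1) \o trunc_inc (m + 1) X (n + 1)) (cd (trunc (m + 1) X) n x) =
  cd (conc M (m + 1)) n ((conc_ret M (m + 1) n \o c' n \o trunc_inc (m + 1) X n) x).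
  rewrite conc_d; have [e|e] := eqVneq n m; last first.
    by apply: conc_zero; apply/eqP => h; case/eqP: e; lia.
  subst n.
  change (conc_ret M (m + 1) (m + 1) (c' (m + 1) (trunc_inc (m + 1) X (m + 1) (cd (trunc (m + 1) X) m x))) = 0).
  rewrite c'E trunc_dE // (_ : c _ = 0) ?linear0 //.
  by apply/kc; exists (trunc_inc (m + 1) X m x).
pose f := @ChainMap S (trunc (m + 1) X) (conc M (m + 1))
  (fun n => conc_ret M (m + 1) n \o c' n \o trunc_inc (m + 1) X n) fd.
have fE x : conc_inc M (m + 1) (m + 1) (f (m + 1) x) = c (trunc_inc (m + 1) X (m + 1) x).
  by rewrite -c'E; exact: conc_retK.
exists f => n; split=> [x hx [y]|y _].
  rewrite conc_d => hf.
  have [hn|hn] := boolP (m < n).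
    by exists 0; rewrite linear0 (trunc_zero _ x) //; lia.
  have [e|e] := eqVneq n m.
    subst n; have /kc[z hz] : c (trunc_inc (m + 1) X (m + 1) x) = 0 by rewrite -fE -hf linear0.
    by exists (trunc_ret (m + 1) X m z); rewrite -cmd hz trunc_incK.
  have [||z hz] := aX n _ (trunc_inc (m + 1) X (n + 1) x).
  - by move/eqP: e; lia.
  - by rewrite -trunc_dE ?hx ?linear0 //; move/eqP: e; lia.
  by exists (trunc_ret (m + 1) X n z); rewrite -cmd hz trunc_incK.
have [e|e] := eqVneq n m.
  subst n; have [z hz] := sc (conc_inc M (m + 1) (m + 1) y).
  exists (trunc_ret (m + 1) X (m + 1) z); first by apply: trunc_zero; lia.
  exists 0; rewrite linear0; apply/eqP; rewrite subr_eq0; apply/eqP.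
  apply: (rc_inc_inj (p := conc_pi M (m + 1))); apply: etrans (esym (fE _)).
  by rewrite trunc_retK // hz.
have z0 : is_zero (conc M (m + 1) (n + 1)).
  by apply: conc_zero; apply/eqP => h; case/eqP: e; lia.
by exists 0; [rewrite linear0|exists 0; exact: etrans (z0 _) (esym (z0 _))].
Qed.

Section Resolution.
Variables (M : lmodType S) (P : proj_resolution M) (m : int).
Let a := m + 1.
Fact pr_dd i x : pr_d P i (pr_d P i.+1 x) = 0.
Proof. by apply/pr_exact; exists x. Qed.
Definition res_raw : complex S := raw_cx pr_dd a.

Lemma hd_exact i j k x : k = i.+1 -> i = j.+1 -> hd (pr_d P) i j x = 0 ->
  exists y, hd (pr_d P) k i y = x.
Proof. by move=> ? ?; subst k i; rewrite !hdE => /pr_exact. Qed.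

(** The augmentation with a variable index, since the index of the term in degree a is only provably
    equal to 0. *)
Definition haug i : {linear pr_ob P i -> M} :=
  match i with 0 => pr_aug P | _ => \0 end.

Lemma res_acyclic n : n < m -> acyclic_at res_raw n.
Proof.
move=> hn x hx; apply: hd_exact hx; rewrite /a; lia.
Qed.

Lemma res_quasi_iso : exists f : chain_map (trunc a res_raw) (conc M a), quasi_iso f.
Proof.
have c0 i : i = 0 -> surj (haug i) by move=> ->; exact: pr_aug_surj.
have k0 i k x : i = 0 -> k = 1 -> haug i x = 0 <-> exists y, hd (pr_d P) k i y = x.
  by move=> ? ?; subst i k; rewrite hdE; exact: pr_exact0.
apply: (@conc_quasi_iso res_raw m M (haug (absz (a - (m + 1))%R))).
- by apply: c0; rewrite /a; lia.
- by move=> x; apply: k0; rewrite /a; lia.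
- exact: res_acyclic.
Qed.

Lemma res_in_Kmb : (forall i, fin_gen (pr_ob P i)) -> in_Kmb (trunc a res_raw).
Proof.
move=> fP; split.
- move=> n; apply: fg_projective_retract (trunc_retract a res_raw n) _.
  by split; [exact: fP|exact: pr_projective].
- exact: trunc_bounded_above.
exists a, a => n [hn|hn].
  by apply: trunc_acyclic => //; apply: res_acyclic; rewrite /a in hn; lia.
by move=> x _; exists 0; rewrite linear0 (trunc_zero _ x).
Qed.
End Resolution.

Lemma Kob_equiv (X Y : Kob S) : quasi_isomorphic X Y -> @isomorphic (Kcat S) X Y.
Proof.
move=> q; have [pX bX _] := kcxP X; have [pY bY _] := kcxP Y.
have [f [g [h1 h2]]] := quasi_isomorphic_equiv (fun n => (pX n).2) bX (fun n => (pY n).2) bY q.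
by exists f, g.
Qed.

Lemma Dsg_of_K (X Y : Kob S) : @isomorphic (Kcat S) X Y -> @isomorphic (Dsg S) X Y.
Proof.
move=> [f hf]; exists (lof _ f); exact: (fmor_iso (loc_functor (@perfect_cone S)) hf).
Qed.

Lemma Dsg_trunc N (X : Kob S) : @isomorphic (Dsg S) X (Ktrunc N X).
Proof.
exists (lof (@perfect_cone S) (Kret N X : @hom (Kcat S) X (Ktrunc N X))).
by apply: (@loc_iso (Kcat S) (@perfect_cone S)); exact: trunc_perfect_cone.
Qed.
End ResolutionComplex.

Section Emod.
Variables (R : pzRingType) (e : R) (he : e * e = e).
Local Notation C := (corner he).
Local Notation Rn k := ({ffun 'I_k -> Re he} : lmodType R).

Lemma emod_map_retract (M N : lmodType R) : retract M N -> retract (emod e M : lmodType C) (emod e N).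
Proof.
move=> [i [p pi]]; exists (emod_map he i), (emod_map he p) => x.
by apply: val_inj; rewrite /= pi.
Qed.

Fact corner_Re_subproof (c : C) : corner_val c \in Re_pred e.
Proof. by rewrite inE corner_e. Qed.
Definition corner_Re (c : C) : Re he := MkRe he (corner_Re_subproof c).

Lemma emod_Rn_retract k : retract (emod e (Rn k) : lmodType C) ({ffun 'I_k -> C^o} : lmodType C).
Proof.
have l1 : linear (fun m : emod e (Rn k) => [ffun j => ecut (emod_val m j)] : {ffun 'I_k -> C^o}).
  move=> a x y; apply/ffunP => j; apply: val_inj; rewrite !ffunE /=.
  by rewrite mulrDr !mulrA e_corner corner_e.
have f2 (c : {ffun 'I_k -> C^o}) : ([ffun j => corner_Re (c j)] : Rn k) \in emod_pred e (M := Rn k).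
  rewrite inE; apply/eqP/ffunP => j; apply: val_inj; rewrite !ffunE /= e_corner //.
have l2 : linear (fun c => MkEmod (f2 c)).
  by move=> a x y; apply: val_inj; apply/ffunP => j; apply: val_inj; rewrite /= !ffunE /=.
exists (mklinear l1), (mklinear l2) => m; apply: val_inj; apply/ffunP => j; apply: val_inj.
rewrite /= !ffunE /= -[in RHS](emod_e m) ffunE //.
Qed.

Lemma fg_projective_emod M : in_add (Re he : lmodType R) M -> fg_projective (emod e M : lmodType C).
Proof.
move=> /in_addP[k /emod_map_retract rM].
apply: fg_projective_retract (retract_trans rM (emod_Rn_retract k)) _.
exact: fg_projective_free.
Qed.

(** The inverse of the counit sends v to the sum of the v_j (x) e_j, where e_j has entry e in place
    j and zero elsewhere. *)
Lemma eps_Rn_bij k : exists g : Rn k -> ilambda (emod e (Rn k)),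
  cancel (eps he (Rn k)) g /\ cancel g (eps he (Rn k)).
Proof.
pose del (j : 'I_k) : Rn k := [ffun i => if i == j then (Re_unit he : Re he) else 0].
have fd j : del j \in emod_pred e (M := Rn k).
  rewrite inE; apply/eqP/ffunP => i; rewrite !ffunE; case: eqP => _; last by rewrite scaler0.
  by apply: val_inj; rewrite /= he.
pose D j := MkEmod (fd j).
exists (fun v : Rn k => \sum_j (pure (v j : Re_right he) (D j) : ilambda (emod e (Rn k)))); split.
  have lg : linear (fun v : Rn k => \sum_j (pure (v j : Re_right he) (D j) : ilambda (emod e (Rn k)))).
    move=> a x y; rewrite scaler_sumr -big_split; apply: eq_bigr => j _ /=.
    by rewrite !ffunE scale_pure -pureDl.
  apply: (ilambda_ext (f := mklinear lg \o eps he (Rn k)) (g := idfun)) => x v.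
  have hv : v = \sum_j ecut (emod_val v j) *: (D j : emod e (Rn k)).
    apply: val_inj; rewrite raddf_sum; apply/ffunP => i; rewrite sum_ffunE.
    rewrite (bigD1 i) //= big1 ?addr0 => [|j /negbTE ji]; last first.
      by rewrite !ffunE eq_sym ji scaler0.
    rewrite !ffunE eqxx -[in LHS](emod_e v) ffunE; apply: val_inj => /=.
    by rewrite -mulrA Re_e.
  rewrite /= eps_fun_pure [in RHS]hv pure_sumr; apply: eq_bigr => j _.
  rewrite -pure_bal; congr (pure _ _); apply: val_inj; rewrite ffunE /=.
  by rewrite mulrA Re_e.
move=> v; rewrite linear_sum; apply/ffunP => i; rewrite sum_ffunE.
rewrite (bigD1 i) //= big1 ?addr0 => [|j /negbTE ji]; last first.
  by rewrite eps_fun_pure !ffunE eq_sym ji scaler0.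
by rewrite eps_fun_pure !ffunE eqxx; apply: val_inj; rewrite /= Re_e.
Qed.

(** Naturality of the counit carries bijectivity from (Re)^k to its retracts. *)
Lemma eps_bij M : in_add (Re he : lmodType R) M ->
  exists g : M -> ilambda (emod e M : lmodType C), cancel (eps he M) g /\ cancel g (eps he M).
Proof.
move=> /in_addP[k [i [p pi]]]; have [g [gK Kg]] := eps_Rn_bij k.
exists (fun m => ilambda_map (emod_map he p) (g (i m))); split=> [t|m].
  rewrite -eps_natural gK.
  apply: (ilambda_ext (f := ilambda_map (emod_map he p) \o ilambda_map (emod_map he i)) (g := idfun)) => x v.
  rewrite /= !tens_map_pure; congr (pure _ _); apply: val_inj.
  by rewrite /= pi.
by rewrite eps_natural Kg pi.
Qed.

Section EmodComplex.
Variable X : complex R.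
Fact emod_cx_dd n (x : emod e (X n)) : emod_map he (cd X (n + 1)) (emod_map he (cd X n) x) = 0.
Proof. by apply: val_inj; rewrite /= cdd. Qed.
Definition emod_cx : complex C :=
  @Complex C (fun n => emod e (X n)) (fun n => emod_map he (cd X n)) emod_cx_dd.

(** The functor M -> eM is exact: multiply a preimage by e. *)
Lemma emod_acyclic n : acyclic_at X n -> acyclic_at emod_cx n.
Proof.
move=> aX x hx; have [|y hy] := aX (emod_val x); first exact: (congr1 (@emod_val _ _ _) hx).
by exists (ecorner he y); apply: val_inj; rewrite /= linearZ /= hy emod_e.
Qed.

Hypothesis addX : forall n, in_add (Re he : lmodType R) (X n).

Lemma emod_in_Kmb : in_Kmb X -> in_Kmb emod_cx.
Proof.
move=> [_ [b hb] [c [d hcd]]]; split.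
- by move=> n; apply: fg_projective_emod.
- by exists b => n hn x; apply: val_inj; exact: hb.
- by exists c, d => n hn; apply: emod_acyclic; exact: hcd.
Qed.

Fact eps_cx_subproof n (t : ilambda_cx emod_cx n) :
  eps he (X (n + 1)) (cd (ilambda_cx emod_cx) n t) = cd X n (eps he (X n) t).
Proof. exact: eps_natural. Qed.
Definition eps_cx : chain_map (ilambda_cx emod_cx) X :=
  @ChainMap R (ilambda_cx emod_cx) X (fun n => eps he (X n)) eps_cx_subproof.
End EmodComplex.

Hypothesis hK : ilambda_preserves_Kmb he.
Hypothesis hP : ilambda_preserves_perfect he.

Lemma add_complex_ess_image (X : Kob R) :
  (forall n, in_add (Re he : lmodType R) (X n)) ->
  exists Z : Kob C, @isomorphic (Kcat R) (K_ilambda_ob hK Z) X.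
Proof.
move=> addX; exists (MkKob (emod_in_Kmb addX (kcxP X))), (eps_cx X).
pose g n := sval (cid (eps_bij (addX n))).
have gK n : cancel (eps he (X n)) (g n) by rewrite /g; case: (cid _) => ? [].
have Kg n : cancel (g n) (eps he (X n)) by rewrite /g; case: (cid _) => ? [].
exact: (@chain_iso R (K_ilambda_ob hK (MkKob (emod_in_Kmb addX (kcxP X)))) X (eps_cx X) g gK Kg).
Qed.

(** Below its cohomology, Y resolves the image of a differential. The given resolution of that image
    agrees with a truncation of Y up to homotopy, and a further truncation of it has all terms in
    add Re. *)
Lemma add_resolution_ess_surj :
  (forall M : lmodType R, fin_gen M ->
   exists (l : int) (P : proj_resolution M),
     (forall i, fin_gen (pr_ob P i)) /\
     (forall i : nat, l <= i%:Z -> in_add (Re he : lmodType R) (pr_ob P i))) ->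
  forall Y : Dsg R, exists (X : Dsg C) (b : hom (Dsg_ilambda hK hP X) Y), is_iso b.
Proof.
(* With m = c - 2 the complex Y is exact in all degrees up to m + 1, so the image of d in degree m +
   1 is the cokernel of d in degree m. *)
move=> hres Y; have [pY bY [c [c' hc]]] := kcxP Y; pose m := c - 2.
pose I := image_submodule (cd (Y : Kob R) (m + 1)).
have hI x : exists y, cd (Y : Kob R) (m + 1) y = cd (Y : Kob R) (m + 1) x by exists x.
have fI : fin_gen (subm I).
  apply: (fin_gen_surj (f := scor I hI)) (pY (m + 1)).1.
  by move=> y; have [x hx] := sincP y; exists x; apply: sinc_inj.
have [l [P [fP addP]]] := hres (subm I) fI.
have [f qf] := res_quasi_iso P m.
have [|||g qg] := @conc_quasi_iso R (Y : Kob R) m (subm I) (scor I hI).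
- by move=> y; have [x hx] := sincP y; exists x; apply: sinc_inj.
- move=> x; split=> [/(congr1 (sinc I))|[y <-]].
    by rewrite scorE linear0 => hx; apply: hc hx; lia.
  by apply: sinc_inj; rewrite scorE linear0 cdd.
- by move=> n hn; apply: hc; lia.
pose Q := MkKob (res_in_Kmb m fP).
have iQY : @isomorphic (Kcat R) Q (Ktrunc (m + 1) Y).
  apply: Kob_equiv; apply: rst_trans (rst_step _ _ _ _ (ex_intro _ f qf)) _.
  by apply: rst_sym; apply: rst_step; exists g.
(* In degrees n <= N the resolution index m + 1 - n is at least l. *)
pose N := m + 1 - `|l|.
have addQ n : in_add (Re he : lmodType R) (Ktrunc N Q n).
  have [hn|hn] := boolP (N < n).
    by apply/in_addP; exists 0; apply: retract_zero; exact: trunc_zero.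
  have /in_addP[k rk] := addP (absz (m + 1 - n)%R) ltac:(lia).
  apply/in_addP; exists k; apply: retract_trans rk.
  apply: retract_trans (trunc_retract _ _ _) _.
  exact: trunc_retract.
have [Z iZ] := add_complex_ess_image addQ; exists Z.
apply: (@isomorphic_trans (Dsg R) (K_ilambda_ob hK Z) (Ktrunc N Q) Y); first exact: Dsg_of_K.
apply: (@isomorphic_trans (Dsg R) (Ktrunc N Q) Q Y).
  by apply: isomorphic_sym; exact: Dsg_trunc.
apply: (@isomorphic_trans (Dsg R) Q (Ktrunc (m + 1) Y) Y); first exact: Dsg_of_K.
by apply: isomorphic_sym; exact: Dsg_trunc.
Qed.
End Emod.

(** * Resolutions over noetherian rings *)

Section Noetherian.
Variable R : pzRingType.
Hypothesis noethR : left_noetherian R.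

(** Induction on the number of generators. The coefficients of the first generator in elements of I
    form a left ideal; lifting its finitely many generators to elements [y j] of I and subtracting a
    combination of them leaves elements of I spanned by the remaining generators. *)
Lemma span_submodule (M : lmodType R) (n : nat) (g : 'I_n -> M) (I : M -> Prop) :
  submodule I -> (forall x, I x -> exists c : 'I_n -> R, x = \sum_(i < n) c i *: g i) ->
  exists (m : nat) (h : 'I_m -> M), (forall i, I (h i)) /\
    forall x, I x -> exists c : 'I_m -> R, x = \sum_(i < m) c i *: h i.
Proof.
elim: n g I => [|n ih] g I hI hg.
  exists 0, (fun _ => 0); split; first by case.
  by move=> x /hg[c ->]; exists (fun _ => 0); rewrite !big_ord0.
have [I0 ID IZ] := hI.
have IB x y : I x -> I y -> I (x - y).
  by move=> hx hy; apply: ID => //; rewrite -scaleN1r; exact: IZ.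
pose G (c : 'I_n -> R) := \sum_(i < n) c i *: g (lift ord0 i).
have GD c c' : G c + G c' = G (fun i => c i + c' i).
  by rewrite /G -big_split; apply: eq_bigr => i _; rewrite scalerDl.
have GZ a c : a *: G c = G (fun i => a * c i).
  by rewrite /G scaler_sumr; apply: eq_bigr => i _; rewrite scalerA.
have G0 : G (fun _ => 0) = 0 by rewrite /G big1 // => i _; rewrite scale0r.
pose J (r : R) := exists c, I (r *: g ord0 + G c).
have hJ : left_ideal J.
  split.
  - by exists (fun _ => 0); rewrite scale0r G0 addr0.
  - move=> r s [c hc] [c' hc']; exists (fun i => c i + c' i).
    by rewrite -GD scalerDl addrACA; exact: ID.
  - move=> a r [c hc]; exists (fun i => a * c i).
    by rewrite -GZ -scalerA -scalerDr; exact: IZ.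
have [k [r hr]] := noethR hJ.
have Jr j : J (r j).
  apply/hr; exists (fun i => (i == j)%:R).
  rewrite (bigD1 j) //= eqxx mul1r big1 ?addr0 // => i /negbTE ->.
  by rewrite mul0r.
pose c j := sval (cid (Jr j)).
pose y j := r j *: g ord0 + G (c j).
have Iy j : I (y j) by rewrite /y /c; case: (cid _).
have hI' : submodule (fun x => I x /\ exists c, x = G c).
  split; first by split=> //; exists (fun _ => 0); rewrite G0.
  - move=> x x' [hx [d e1]] [hx' [d' e2]]; split; first exact: ID.
    by exists (fun i => d i + d' i); rewrite -GD e1 e2.
  - move=> a x [hx [d e1]]; split; first exact: IZ.
    by exists (fun i => a * d i); rewrite -GZ e1.
have [|m [h [Ih hh]]] := ih (fun i => g (lift ord0 i)) _ hI'; first by move=> x [_].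
exists (k + m)%N, (fun i => match fintype.split i with inl j => y j | inr j => h j end); split.
  by move=> i; case: (fintype.split i) => j; [exact: Iy|exact: (Ih j).1].
move=> x hx; have [a ha] := hg x hx.
have {}ha : x = a ord0 *: g ord0 + G (fun i => a (lift ord0 i)) by rewrite ha big_ord_recl.
have /hr[b hb] : J (a ord0) by exists (fun i => a (lift ord0 i)); rewrite -ha.
have Isum : I (\sum_(j < k) b j *: y j).
  by elim/big_ind: _ => // j _; exact: IZ.
have [|d hd] := hh (x - \sum_(j < k) b j *: y j).
  split; first exact: IB.
  have -> : \sum_(j < k) b j *: y j = a ord0 *: g ord0 + \sum_(j < k) G (fun i => b j * c j i).
    rewrite hb scaler_suml -big_split; apply: eq_bigr => j _ /=.
    by rewrite /y scalerDr scalerA GZ.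
  have [d hd] : exists d, \sum_(j < k) G (fun i => b j * c j i) = G d.
    elim/big_ind: _ => [|_ _ [d ->] [d' ->]|j _]; first by exists (fun _ => 0); rewrite G0.
      by exists (fun i => d i + d' i); rewrite GD.
    by exists (fun i => b j * c j i).
  exists (fun i => a (lift ord0 i) + -1 * d i).
  by rewrite -GD -GZ scaleN1r hd {1}ha; zmod.
exists (fun i => match fintype.split i with inl j => b j | inr j => d j end).
rewrite big_split_ord /= -[LHS](subrK (\sum_(j < k) b j *: y j)) hd [LHS]addrC; congr (_ + _).
  by apply: eq_bigr => i _; rewrite (unsplitK (inl i)).
by apply: eq_bigr => i _; rewrite (unsplitK (inr i)).
Qed.

Lemma fin_gen_submodule (M : lmodType R) (I : M -> Prop) (hI : submodule I) :
  fin_gen M -> fin_gen (subm hI).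
Proof.
move=> [n [g hg]]; have [|m [h [Ih hh]]] := @span_submodule M n g I hI.
  by move=> x _; exact: hg.
exists m, (fun i => smk hI (Ih i)) => x; have [c hc] := hh _ (sincP x).
exists c; apply: sinc_inj; rewrite hc linear_sum.
by apply: eq_bigr => i _; rewrite linearZ.
Qed.

(** Bundling finite generation lets the choice of a free cover, and hence of a syzygy, be
    iterated. *)
Definition fgmod := {M : lmodType R | fin_gen M}.

Lemma fg_cover (M : fgmod) : exists (n : nat) (g : 'I_n -> sval M), surj (ffun_comb g).
Proof.
case: M => M [n [g hg]]; exists n, g => x; have [c ->] := hg x.
by exists [ffun i => c i]; apply: eq_bigr => i _; rewrite ffunE.
Qed.
Definition cover_rank (M : fgmod) : nat := sval (cid (fg_cover M)).
Definition cover_gen (M : fgmod) : 'I_(cover_rank M) -> sval M := sval (cid (svalP (cid (fg_cover M)))).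
Definition cover (M : fgmod) : {linear {ffun 'I_(cover_rank M) -> R^o} -> sval M} :=
  ffun_comb (@cover_gen M).
Lemma cover_surj (M : fgmod) : surj (cover M).
Proof. exact: (svalP (cid (svalP (cid (fg_cover M))))). Qed.

Definition syzygy (M : fgmod) : fgmod :=
  exist _ (subm (kernel_submodule (cover M)) : lmodType R)
    (fin_gen_submodule (kernel_submodule (cover M)) (fg_projective_free R (cover_rank M)).1).

Lemma noetherian_resolution (M : lmodType R) : fin_gen M ->
  exists P : proj_resolution M, forall i, fin_gen (pr_ob P i).
Proof.
move=> fM; pose Z i := iter i syzygy (exist _ M fM).
pose P i : lmodType R := {ffun 'I_(cover_rank (Z i)) -> R^o}.
pose inc i := sinc (kernel_submodule (cover (Z i))).
pose d i : {linear P i.+1 -> P i} := inc i \o cover (Z i.+1).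
have k0 i x : cover (Z i) x = 0 <-> exists y, d i y = x.
  split=> [hx|[y <-]].
    have [y hy] := cover_surj (M := Z i.+1) (smk (kernel_submodule (cover (Z i))) hx).
    by exists y; exact: (congr1 (inc i) hy).
  exact: (sincP (cover (Z i.+1) y)).
have kd i x : d i x = 0 <-> cover (Z i.+1) x = 0.
  split=> [h|h]; last by exact: etrans (congr1 (inc i) h) (linear0 (inc i)).
  by apply: (@sinc_inj _ _ _ (kernel_submodule (cover (Z i)))); rewrite linear0.
unshelve eexists (@ProjResolution R M P d (cover (Z 0)) _ _ _ _).
- by move=> i; exact: (fg_projective_free R _).2.
- exact: (@cover_surj (Z 0)).
- exact: k0.
- by move=> i x; split=> [/kd/k0|/k0/kd].
by move=> i; exact: (fg_projective_free R _).1.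
Qed.
End Noetherian.

(** * Resolutions from essential surjectivity *)

Section ConeQuasiIso.
Variable S : pzRingType.
Implicit Types X Y Z : complex S.

Lemma quasi_iso_shift X Y (f : chain_map X Y) : quasi_iso f -> quasi_iso (shift_map f).
Proof.
move=> qf n; have [qi qs] := qf (n + 1); split.
- move=> x /= /eqP; rewrite oppr_eq0 => /eqP hx [y hy].
  have [|x' hx'] := qi x hx; first by exists (- y); rewrite linearN.
  by exists (- x'); rewrite linearN opprK.
- move=> y /= /eqP; rewrite oppr_eq0 => /eqP hy.
  have [x hx [y' hy']] := qs y hy; exists x; first by rewrite hx oppr0.
  by exists (- y'); rewrite linearN opprK.
Qed.

Section ConePost.
Variables (X Y Z : complex S) (v : chain_map X Y) (r : chain_map Y Z).
Let p1 n : {linear cone v n -> X (n + 1)} := fst.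
Let p2 n : {linear cone v n -> Y n} := snd.
Fact cone_post_subproof n (x : cone v n) :
  lpair (p1 (n + 1)) (r (n + 1) \o p2 (n + 1)) (cd (cone v) n x) =
  cd (cone (cm_comp r v)) n (lpair (p1 n) (r n \o p2 n) x).
Proof. by congr (_, _); rewrite /= linearD cmd. Qed.
Definition cone_post : chain_map (cone v) (cone (cm_comp r v)) :=
  @ChainMap S (cone v) (cone (cm_comp r v)) (fun n => lpair (p1 n) (r n \o p2 n))
    cone_post_subproof.

(** The five lemma for the cone triangles of v and r v, chased on elements. *)
Lemma quasi_iso_cone_post : quasi_iso r -> quasi_iso cone_post.
Proof.
move=> qr n; split.
- move=> [x y] [/= /eqP hx hy]; move: hx; rewrite oppr_eq0 => /eqP hx [[x0 z0] [/= h1 h2]].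
  have [ri _] := qr n.
  have [||y0 hy0] := ri (y - v (n + 1) x0).
  + rewrite linearB -cmd; have -> : cd X (n + 1) x0 = - x by rewrite -h1 opprK.
    by rewrite linearN; apply: (eq_modulo hy); zmod.
  + by exists z0; rewrite linearB -h2; zmod.
  exists (x0, y0); congr (_, _) => //=.
  by rewrite hy0; zmod.
- move=> [x z] [/= /eqP hx hz]; move: hx; rewrite oppr_eq0 => /eqP hx.
  have [ri1 _] := qr (n + 1); have [_ rs] := qr n.
  have [||y1 hy1] := ri1 (v (n + 1 + 1) x).
  + by rewrite -cmd hx linear0.
  + by exists (- z); rewrite linearN; apply: (eq_modulo (esym hz)); zmod.
  have [|y2 hy2 [z' hz']] := rs (z + r (n + 1) y1).
    by rewrite linearD -cmd hy1 -[RHS]hz; exact: addrC.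
  exists (x, y2 - y1).
    by congr (_, _) => /=; [rewrite hx oppr0|rewrite linearB hy1 hy2; zmod].
  exists (0, z'); congr (_, _) => /=; first by rewrite linear0 oppr0 subrr.
  by rewrite !linear0 add0r -hz' linearB; zmod.
Qed.
End ConePost.

Section ConeIn.
Variables (X Y : complex S) (g : chain_map X Y).
Let p n : {linear cone (cone_in g) n -> shift X n} :=
  (fst : {linear cone g n -> X (n + 1)}) \o (snd : {linear cone (cone_in g) n -> cone g n}).
Fact cone_in_shift_subproof n (x : cone (cone_in g) n) :
  p (n + 1) (cd (cone (cone_in g)) n x) = cd (shift X) n (p n x).
Proof. by rewrite /= add0r. Qed.
Definition cone_in_shift : chain_map (cone (cone_in g)) (shift X) :=
  @ChainMap S (cone (cone_in g)) (shift X) p cone_in_shift_subproof.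

(** Rotation of the cone triangle: the cone of Y -> cone g is X[1] up to quasi-isomorphism. *)
Lemma quasi_iso_cone_in_shift : quasi_iso cone_in_shift.
Proof.
move=> n; split.
- move=> [w [x w']] [/= /eqP hw hx hw']; move: hw; rewrite oppr_eq0 => /eqP hw [x0 /= hx0].
  exists (w' - g (n + 1) x0, (x0, 0)); congr (_, (_, _)) => /=.
  + rewrite linearB -cmd; have -> : cd X (n + 1) x0 = - x by rewrite -hx0 opprK.
    by rewrite linearN; apply: (eq_modulo (esym hw')); zmod.
  + by rewrite add0r.
  + by rewrite linear0; zmod.
- move=> x /= /eqP; rewrite oppr_eq0 => /eqP hx.
  exists (- g (n + 1 + 1) x, (x, 0)).
    congr (_, (_, _)) => /=; rewrite ?linear0 ?linearN -?cmd ?hx ?linear0; zmod.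
  by exists 0; rewrite linear0 oppr0; exact: subrr.
Qed.
End ConeIn.
End ConeQuasiIso.

Section ResolutionOfComplex.
Variables (S : pzRingType) (L : complex S) (k : int).
Hypothesis pL : forall n, fg_projective (L n).
Hypothesis bL : bounded_above L.

Definition dcast n m (h : n + 1 = m) : {linear L n -> L m} :=
  ecast m {linear L n -> L m} h (cd L n).
Lemma dcast_dcast n m q (h : n + 1 = m) (h' : m + 1 = q) x : dcast h' (dcast h x) = 0.
Proof. by subst m q; exact: cdd. Qed.
Lemma dcast_exact n m q (h : n + 1 = m) (h' : m + 1 = q) : acyclic_at L n ->
  forall x, dcast h' x = 0 -> exists y, dcast h y = x.
Proof. by subst m q. Qed.

(** L is exact above degree k + 1, hence contractible there by projectivity and boundedness. The map
    x -> x - h d x retracts L^(k+1) onto its cycles. *)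
Lemma kernel_retract : (forall n, k < n -> acyclic_at L n) ->
  retract (subm (kernel_submodule (cd L (k + 1))) : lmodType S) (L (k + 1)).
Proof.
move=> aL; pose Z := kernel_submodule (cd L (k + 1)).
have [||h hh] := @null_homotopy S L L (cm_id L) (fun n => k < n) (fun n => (pL n).2) bL.
- by move=> n hn; lia.
- exact: aL.
have kk : k < k + 1 by lia.
have hZ x : cd L (k + 1) (x - h (k + 1) (cd L (k + 1) x)) = 0.
  have := hh (k + 1) kk (cd L (k + 1) x).
  by rewrite cdd linear0 addr0 linearB /= => <-; rewrite subrr.
pose q : {linear L (k + 1) -> L (k + 1)} :=
  (idfun : {linear L (k + 1) -> L (k + 1)}) \- (h (k + 1) \o cd L (k + 1)).
exists (sinc Z), (@scor S _ _ Z _ q hZ) => x.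
by apply: sinc_inj; rewrite scorE /q /= (sincP x) linear0 subr0.
Qed.

(** When the only cohomology of L is M in degree k + 1, a resolution of M starts with the cycles in
    that degree, which are projective by [kernel_retract], and continues with the terms of L in
    degrees k, k - 1, and so on. *)
Lemma resolution_of_complex (M : lmodType S) (c : {linear L (k + 1) -> M}) :
  (forall n, n <> k -> acyclic_at L n) ->
  (forall y, exists2 x, cd L (k + 1) x = 0 & c x = y) ->
  (forall x, cd L (k + 1) x = 0 -> (c x = 0 <-> exists y, cd L k y = x)) ->
  exists P : proj_resolution M, (forall i, fin_gen (pr_ob P i)) /\
    forall i : nat, pr_ob P i.+1 = L (k - i%:Z).
Proof.
move=> aL sc kc; pose I := kernel_submodule (cd L (k + 1)); pose Z : lmodType S := subm I.
have fZ : fg_projective Z.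
  by apply: fg_projective_retract (pL (k + 1)); apply: kernel_retract => n hn; apply: aL; lia.
pose P i : lmodType S := if i is i'.+1 then L (k - i'%:Z) else Z.
have e0 : k - 0%:Z + 1 = k + 1 by lia.
have eS i : k - i.+1%:Z + 1 = k - i%:Z by lia.
have hd0 x : cd L (k + 1) (dcast e0 x) = 0 := dcast_dcast e0 (erefl (k + 1 + 1)) x.
pose d i : {linear P i.+1 -> P i} := match i return {linear P i.+1 -> P i} with
  | 0 => @scor S _ _ I _ (dcast e0) hd0
  | i'.+1 => dcast (eS i')
  end.
have aS n : n < k -> acyclic_at L n by move=> hn; apply: aL; lia.
have kE n (h : n + 1 = k + 1) x : (exists y, cd L k y = x) <-> exists y, dcast h y = x.
  have en : n = k by lia.
  by subst n; rewrite (Prop_irrelevance h erefl).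
unshelve eexists (@ProjResolution S M P d (c \o sinc I) _ _ _ _).
- by case=> [|i]; [exact: fZ.2|exact: (pL _).2].
- by move=> y; have [x hx <-] := sc y; exists (smk I hx).
- move=> x; rewrite /= (kc _ (sincP x)) (kE _ e0); split=> [[y hy]|[y <-]]; exists y => //.
  exact: sinc_inj.
- case=> [|i] x.
    split=> [/(congr1 (sinc I))|[y <-]].
      rewrite scorE linear0; apply: dcast_exact; apply: aS; lia.
    by apply: sinc_inj; rewrite scorE linear0; exact: dcast_dcast.
  split=> [|[y <-]]; last exact: dcast_dcast.
  by apply: dcast_exact; apply: aS; lia.
split=> //; case=> [|i]; [exact: fZ.1|exact: (pL _).1].
Qed.
End ResolutionOfComplex.

Section Forward.
Variables (R : pzRingType) (e : R) (he : e * e = e).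
Local Notation C := (corner he).

(** A dual basis (g_j, c_j) of N exhibits Re (x) N as a retract of (Re)^n, through x (x) y -> (x
    c_j(y))_j and v -> sum of v_j (x) g_j. *)
Lemma ilambda_in_add (N : lmodType C) : fg_projective N ->
  in_add (Re he : lmodType R) (ilambda N).
Proof.
move=> /fg_projective_dual_basis[n [g [c hc]]]; apply/in_addP; exists n.
have hi (j : 'I_n) : exists f : tens (Re_right he) N -> Re he,
    {morph f : s t / s + t} /\ forall x y, f (pure x y) = Re_rscale (c j y) x.
  apply: tens_universal => [x x' y|x y y'|x a y].
  - exact: Re_rscaleDr.
  - by rewrite linearD; exact: Re_rscaleDl.
  - by rewrite linearZ /=; exact: Re_rscaleA.
pose f j := sval (cid (hi j)).
have fD j : {morph f j : s t / s + t} by rewrite /f; case: (cid _) => ? [].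
have fp j x y : f j (pure x y) = Re_rscale (c j y) x by rewrite /f; case: (cid _) => ? [].
have f0 j : f j 0 = 0 by apply: (addrI (f j 0)); rewrite -fD !addr0.
have li : linear (fun t : ilambda N => [ffun j => f j t] : {ffun 'I_n -> Re he}).
  move=> r s t; apply/ffunP => j; rewrite !ffunE fD; congr (_ + _).
  elim/pureW: s => [|x y s ih]; first by rewrite !scaler0 !f0 scaler0.
  rewrite scalerDr !fD scalerDr ih; congr (_ + _); rewrite scale_pure !fp.
  by apply: val_inj; rewrite /= mulrA.
have lp : linear (fun v : {ffun 'I_n -> Re he} =>
    \sum_j (pure (v j : Re_right he) (g j) : ilambda N)).
  move=> a x y; rewrite scaler_sumr -big_split; apply: eq_bigr => j _ /=.
  by rewrite !ffunE scale_pure -pureDl.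
exists (mklinear li), (mklinear lp).
apply: (ilambda_ext (f := mklinear lp \o mklinear li) (g := idfun)) => x y.
rewrite /= [in RHS](hc y) pure_sumr; apply: eq_bigr => j _.
by rewrite ffunE fp -pure_bal.
Qed.

Hypothesis hK : ilambda_preserves_Kmb he.
Hypothesis hP : ilambda_preserves_perfect he.

Lemma ess_surj_add_resolution : left_noetherian R ->
  (forall Y : Dsg R, exists (X : Dsg C) (b : hom (Dsg_ilambda hK hP X) Y), is_iso b) ->
  forall M : lmodType R, fin_gen M ->
  exists (l : int) (P : proj_resolution M),
    (forall i, fin_gen (pr_ob P i)) /\
    (forall i : nat, l <= i%:Z -> in_add (Re he : lmodType R) (pr_ob P i)).
Proof.
move=> noethR es M fM; have [P0 fP0] := noetherian_resolution noethR fM.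
(* Q resolves M placed in degree m + 1, so Q[1] has its cohomology in degree m = k + 1, as
   [resolution_of_complex] expects. *)
pose k : int := 0; pose m := k + 1; pose Q := MkKob (res_in_Kmb (P := P0) m fP0).
have [f qf] := res_quasi_iso P0 m.
have [X [b bi]] := es Q.
have [b' [b'b bb']] := bi.
pose TX := K_ilambda_ob hK X.
pose gam : germ Q TX := fmor (Dsg_germ R) b'.
have igam : @is_iso (gcat R) Q TX gam.
  by apply: (fmor_iso (Dsg_germ R)); exists b.
have [N [g hg]] := germ_real gam.
pose W := Ktrunc N TX.
have ig : @is_iso (gcat R) Q W (germ_of g).
  apply: (@is_iso_heq (gcat R) Q W _ _ (germ_eq_sym hg)).
  apply: (@is_iso_comp (gcat R) Q TX W) igam.
  exact/(perfect_cone_iff (Kret N TX))/trunc_perfect_cone.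
have [B [r [pB bB qr]]] := gcontr_retract (kcxP (Kcone g)) (iso_gcontr_cone ig).
have [aB [b0 hB]] := bB.
pose L := cone (cm_comp r (cone_in g)).
have [pW [bW hW] _] := kcxP W; have [pQ bQ _] := kcxP Q.
have pL n : fg_projective (L n) by apply: fg_projective_prod; [exact: pW|exact: pB].
have bL : bounded_above L.
  exists (Num.max bW b0) => n hn; apply: is_zero_prod; [apply: hW; lia|apply: hB; right; lia].
(* The zigzag runs from L back to the cone of W -> cone g, then on to Q[1] and to M in degree m. *)
have qL : quasi_isomorphic L (shift (conc M (m + 1))).
  apply: (@rst_trans _ _ _ (cone (cone_in g))).
    by apply: rst_sym; apply: rst_step; exists (cone_post (cone_in g) r); exact: quasi_iso_cone_post.
  apply: (@rst_trans _ _ _ (shift Q)); apply: rst_step.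
    by exists (cone_in_shift g); exact: quasi_iso_cone_in_shift.
  by exists (shift_map f); exact: quasi_iso_shift.
have [hq _] := zigzag_quasi_iso (fun n => (pL n).2) bL qL.
have [|phi qphi] := hq; first by exists (cm_id L); exact: quasi_iso_id.
have d0 n y : cd (shift (conc M (m + 1))) n y = 0.
  apply: etrans (congr1 (fun u => - u) (conc_d (y : conc M (m + 1) (n + 1)))) _.
  exact: oppr0.
pose c : {linear L (k + 1) -> M} := conc_inc M (m + 1) (m + 1) \o phi (k + 1).
have [n hn|y|x hx|P [fP eP]] := @resolution_of_complex R L k pL bL M c.
- move=> x hx; have [qi _] := qphi n; apply: (qi x hx); exists 0.
  by rewrite linear0; apply/esym/conc_zero/eqP; rewrite /m => h; apply: hn; lia.
- have [_ qs] := qphi k; have [x hx [z hz]] := qs (conc_ret M (m + 1) (m + 1) y) (d0 _ _).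
  exists x => //; rewrite d0 in hz; move/subr0_eq: hz => hz.
  by apply: etrans (congr1 (conc_inc M (m + 1) (m + 1)) (esym hz)) _; exact: conc_retK.
- split=> [hc|[y <-]].
    have h0 : phi (k + 1) x = 0.
      by apply: (@conc_inc_inj R M (m + 1) (m + 1)); apply: etrans hc (esym (linear0 _)).
    by have [qi _] := qphi k; apply: (qi x hx); exists 0; rewrite linear0 h0.
  have -> : c (cd L k y) = conc_inc M (m + 1) (m + 1) (cd (shift (conc M (m + 1))) k (phi k y)).
    by rewrite -cmd.
  by rewrite d0 linear0.
(* For such indices i + 1 the degree k - i lies below aB, where B vanishes, so the term of L
   retracts onto that of W one degree higher, which lies in add Re. *)
exists (`|k - aB| + 3), P; split=> // -[|i] hi; first by lia.
rewrite eP; have /in_addP[q rq] := ilambda_in_add ((let: And3 pX _ _ := kcxP X in pX) (k - i%:Z + 1)).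
apply/in_addP; exists q; apply: retract_trans rq.
apply: (@retract_trans _ _ (W (k - i%:Z + 1))); last exact: trunc_retract.
by apply: retract_prod_zero; apply: hB; left; lia.
Qed.
End Forward.

Theorem theorem2p3 (R : pzRingType) (e : R) (he : e * e = e)
    (noethR : left_noetherian R)
    (pdRe : finite_proj_dim (Re_right he : lmodType (corner he)^c)) :
  exists (hK : ilambda_preserves_Kmb he) (hP : ilambda_preserves_perfect he),
    let F : functor (Dsg (corner he)) (Dsg R) := Dsg_ilambda hK hP in
    let eta := Dsg_ilambda_shift hK hP in
    [/\ triangle_functor eta, fully_faithful F
      & triangle_equivalence eta <->
        forall M : lmodType R, fin_gen M ->
        exists (l : int) (P : proj_resolution M),
          (forall i, fin_gen (pr_ob P i)) /\
          (forall i : nat, l <= i%:Z -> in_add (Re he : lmodType R) (pr_ob P i))].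
Proof.
pose hK := ilambda_Kmb pdRe; pose hP := ilambda_perfect hK.
exists hK, hP; split; [exact: ilambda_triangle_functor|exact: Dsg_ilambda_ff|split].
  move=> [_ /equivalence_ess_surj es]; exact: (ess_surj_add_resolution noethR es).
move=> hres; split; first exact: ilambda_triangle_functor.
apply: ff_equivalence; first exact: Dsg_ilambda_ff.
exact: add_resolution_ess_surj.
Qed.
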